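(* Let $m$ be an admissible weight on $X\times X$ and let $\mathcal A$ be an admissible Banach-$*$-algebra of kernels on $X\times X$ which is an $\mathcal A_m$-bimodule with respect to composition. Assume that $\mathcal F=\{\psi_x\}_{x\in X}$ is an intrinsically $\mathcal A$-localized continuous frame for $\mathcal H$ with $R\in\mathcal A_m$, such that there exists a moderate admissible covering $\mathcal U=(U_i)_{i\in I}$ of $X$ for which $\mathcal F$ possesses property $D[\delta,m]$ with $\delta>0$ so small that $$\delta\Big(\|R|\mathcal A_m\|+\max\{C_{m,\mathcal U}\|R|\mathcal A_m\|,\ \|R|\mathcal A_m\|+\delta\}\Big)\le1,$$ where $C_{m,\mathcal U}$ is the constant with $\sup_{x,y\in U_i}m(x,y)\le C_{m,\mathcal U}$ for all $i\in I$. Then the discrete system $\mathcal F_d=\{\psi_{x_i}\}_{i\in I}$, with $x_i\in U_i$, is an intrinsically $\mathcal A^\flat$-localized frame for $\mathcal H$ (indexed by $I$ with the measure $a$, $a_i=\mu(U_i)$). Moreover, if $\mathcal A^\flat$ is a spectral algebra, then also the canonical dual of the discrete frame, $\tilde{\mathcal F}_d=\{S_{\mathcal F_d}^{-1}\psi_{x_i}\}_{i\in I}$, is intrinsically $\mathcal A^\flat$-localized, where $S_{\mathcal F_d}$ is the frame operator of the discrete frame.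
   Context: **Frames.** $\mathcal H$ is a separable Hilbert space (inner product linear in the first slot); $X$ is a locally compact, $\sigma$-compact Hausdorff space with positive Radon measure $\mu$, $\operatorname{supp}\mu=X$. A family $\mathcal F=\{\psi_x\}_{x\in X}\subset\mathcal H$ is a continuous frame if there are $0<C_1,C_2<\infty$ with $C_1\|f\|^2\le\int_X|\langle f,\psi_x\rangle|^2d\mu(x)\le C_2\|f\|^2$ for all $f\in\mathcal H$. Standing: $x\mapsto\psi_x$ is weakly continuous and $\sup_x\|\psi_x\|<\infty$. Frame operator: $Sf=\int_X\langle f,\psi_x\rangle\psi_x\,d\mu(x)$ (weakly). $R(x,y)=\langle\psi_y,S^{-1}\psi_x\rangle$. The discrete system $\mathcal F_d$ is a frame for $\mathcal H$ indexed by $(I,a)$ if $C_1\|f\|^2\le\sum_{i\in I}|\langle f,\psi_{x_i}\rangle|^2a_i\le C_2\|f\|^2$ for all $f\in\mathcal H$ with constants $0<C_1,C_2<\infty$; its frame operator is $S_{\mathcal F_d}f=\sum_{i\in I}\langle f,\psi_{x_i}\rangle\psi_{x_i}a_i$. **Kernels.** A kernel acts by $K(F)(x)=\int_XF(y)K(x,y)d\mu(y)$; composition is $K_1\circ K_2(x,y)=\int_XK_1(x,z)K_2(z,y)d\mu(z)$, involution $K^*(x,y)=\overline{K(y,x)}$. $\|K|\mathcal A_1\|=\max\{\operatorname{ess\,sup}_x\int|K(x,y)|d\mu(y),\operatorname{ess\,sup}_y\int|K(x,y)|d\mu(x)\}$. A weight $m:X\times X\to\mathbb R$ is admissible if it is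 continuous, $1\le m(x,y)\le m(x,z)m(z,y)$, $m(x,y)=m(y,x)$ for all $x,y,z$, and $m(x,x)\le C<\infty$. $\mathcal A_m$ is the Banach-$*$-algebra of measurable kernels with $\|K|\mathcal A_m\|=\|Km|\mathcal A_1\|<\infty$. A Banach-$*$-algebra $(\mathcal A,\|\cdot|\mathcal A\|)$ of kernels on $X\times X$ (with composition $K_1\circ K_2(x,y)=\int_XK_1(x,z)K_2(z,y)d\mu(z)$ as multiplication, the involution $K^*(x,y)=\overline{K(y,x)}$ and the action $K(F)(x)=\int_XF(y)K(x,y)d\mu(y)$ on $F\in L^2(X,\mu)$) is admissible with respect to $(X,\mu)$ if (A1) $\mathcal A$ is continuously embedded into $\mathcal B(L^2(X,\mu))$; (A2) $\mathcal A$ is solid: if $K$ is measurable, $|K|\le|L|$ and $L\in\mathcal A$, then $K\in\mathcal A$ and $\|K|\mathcal A\|\le\|L|\mathcal A\|$. An admissible algebra is called spectral if for all $A=A^*\in\mathcal A$ the spectrum of $A$ in $\mathcal A$ equals its spectrum in $\mathcal B(L^2(X,\mu))$. These notions are applied to $\mathcal A^\flat$ with $(X,\mu)$ replaced by $I$ with the discrete measure $a$, $a_i=\mu(U_i)$: matrices act on $\ell^2(I,a)$ by $(\Lambda\alpha)_i=\sum_j\lambda_{i,j}\alpha_j\mu(U_j)$. **Localization.** For frames $\mathcal G=\{g_x\}$, $\mathcal F=\{f_x\}$ over the same index set the crossed Gramian kernel (matrix) is $G(\mathcal G,\mathcal F)(x,y)=\langle f_y,g_x\rangle$; $\mathcal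 F$ is intrinsically $\mathcal A$-localized if $G(\mathcal F,\mathcal F)\in\mathcal A$; likewise with $\mathcal A^\flat$ for discrete systems. **Coverings.** A family $\mathcal U=(U_i)_{i\in I}$ of (measurable) subsets is an admissible covering of $X$ if each $U_i$ is relatively compact with non-void interior, $X=\bigcup_iU_i$, and $\sup_{j}\#\{i:U_i\cap U_j\ne\emptyset\}\le N<\infty$. It is moderate if also $\mu(U_i)\ge D>0$ for all $i$ and $\mu(U_i)\le\widetilde C\mu(U_j)$ whenever $U_i\cap U_j\neq\emptyset$. **Property $D[\delta,m]$.** $\mathcal F$ possesses property $D[\delta,m]$ (for the covering $\mathcal U$) if $\mathcal U$ is a moderate admissible covering with $\sup_{x,y\in U_i}m(x,y)\le C_{m,\mathcal U}$ for all $i$, and $\operatorname{osc}_{\mathcal U}(x,y):=\sup_{z\in Q_y}|R(x,y)-R(x,z)|$, $Q_y:=\bigcup_{i:\,y\in U_i}U_i$, satisfies $\|\operatorname{osc}_{\mathcal U}|\mathcal A_m\|<\delta$. **Matrix algebra.** For a matrix $\Lambda=(\lambda_{i,j})_{i,j\in I}$ put $\Lambda_{\mathcal U}(x,y)=\sum_{i,j\in I}|\lambda_{i,j}|\chi_{U_i}(x)\chi_{U_j}(y)$. Then $\mathcal A^\flat=\mathcal A^\flat(\mathcal U)=\{\Lambda:\Lambda_{\mathcal U}\in\mathcal A\}$ with norm $\|\Lambda|\mathcal A^\flat\|=\|\Lambda_{\mathcal U}|\mathcal A\|$ and multiplication $(\Lambda\circ\mathcal E)_{i,j}=\sum_{k\in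 I}\lambda_{i,k}\epsilon_{k,j}\mu(U_k)$. *)

(* Defs.v *)
From HB Require Import structures.
From mathcomp Require Import all_boot all_order all_algebra finmap complex.
From mathcomp Require Import all_classical all_reals all_analysis ess_sup_inf.
From mathcomp Require summability.

Set Implicit Arguments.
Unset Strict Implicit.
Unset Printing Implicit Defensive.

Import Order.TTheory GRing.Theory Num.Theory.
Import numFieldNormedType.Exports.

Local Open Scope classical_set_scope.
Local Open Scope ring_scope.
Local Open Scope complex_scope.

(* The norm of a complex normed space takes its values in [R[i]]; [nrm] is the
   same number as an element of [R]. It applies to [R[i]] itself as well. *)
Definition nrm (R : realType) (V : normedZmodType R[i]) (v : V) : R :=
  complex.Re `|v|.

Section complex_integral.
Context (R : realType) d (T : measurableType d) (mu : {measure set T -> \bar R}).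
Implicit Types f F : T -> R[i].

Definition cmeasurable f :=
  measurable_fun setT (fun x => complex.Re (f x)) /\
  measurable_fun setT (fun x => complex.Im (f x)).

Definition cintegrable f :=
  mu.-integrable setT (fun x => (complex.Re (f x))%:E) /\
  mu.-integrable setT (fun x => (complex.Im (f x))%:E).

Definition cintegral f : R[i] :=
  (\int[mu]_x complex.Re (f x)) +i* (\int[mu]_x complex.Im (f x)).

Definition L2 : set (T -> R[i]) :=
  [set F | cmeasurable F /\ (\int[mu]_x ((nrm (F x) ^+ 2)%:E) < +oo)%E].

Definition L2norm F : R := Num.sqrt (\int[mu]_x (nrm (F x) ^+ 2)).

Definition aeq F G := {ae mu, forall x, F x = G x}.

(* A bounded linear operator on the space of a.e. classes of [L2] functions,
   given by its action on representatives. *)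
Record bounded_operator (B : (T -> R[i]) -> (T -> R[i])) : Prop := {
  bop_L2 : forall F, L2 F -> L2 (B F) ;
  bop_aeq : forall F G, L2 F -> L2 G -> aeq F G -> aeq (B F) (B G) ;
  bop_linear : forall (c : R[i]) F G, L2 F -> L2 G ->
    aeq (B (fun x => c * F x + G x)) (fun x => c * B F x + B G x) ;
  bop_bounded : exists M : R, forall F, L2 F -> L2norm (B F) <= M * L2norm F
}.

Definition op_spectrum (B : (T -> R[i]) -> (T -> R[i])) : set R[i] :=
  [set lam | ~ exists2 V, bounded_operator V & forall F, L2 F ->
     aeq (V (fun x => B F x - lam * F x)) F /\
     aeq (fun x => B (V F) x - lam * V F x) F].

End complex_integral.

Definition ckernel (R : realType) (T : Type) := T -> T -> R[i].

(* A set of kernels with a norm; the values of the norm outside of the set are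
   irrelevant. *)
Record kernel_space (R : realType) (T : Type) := KernelSpace {
  kmem :> ckernel R T -> Prop ;
  knorm : ckernel R T -> R
}.

Section kernels.
Context (R : realType) d (T : measurableType d) (mu : {measure set T -> \bar R}).

Implicit Types K L : ckernel R T.

(* Measurability is with respect to the product sigma-algebra on [T * T]. *)
Definition mkernel K := cmeasurable (fun z : T * T => K z.1 z.2).

Definition kaeq K L := {ae (mu \x mu)%E, forall z, K z.1 z.2 = L z.1 z.2}.

Definition kcomp K L : ckernel R T :=
  fun x y => cintegral mu (fun z => K x z * L z y).

(* [cintegral] is a total function, so that the absolute convergence of the
   integrals defining [kcomp] and [kact] has to be stated explicitly. *)
Definition kcomp_defined K L :=
  {ae (mu \x mu)%E, forall z, cintegrable mu (fun w => K z.1 w * L w z.2)}.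

Definition kstar K : ckernel R T := fun x y => conjc (K y x).

Definition kact K (F : T -> R[i]) : T -> R[i] :=
  fun x => cintegral mu (fun y => F y * K x y).

Definition kact_defined K (F : T -> R[i]) :=
  {ae mu, forall x, cintegrable mu (fun y => F y * K x y)}.

Definition kzero : ckernel R T := fun _ _ => 0.
Definition kadd K L : ckernel R T := fun x y => K x y + L x y.
Definition kscale (c : R[i]) K : ckernel R T := fun x y => c * K x y.
Definition ksub K L : ckernel R T := kadd K (kscale (-1) L).

(* Kernels which agree almost everywhere are identified. *)
Record banach_star_algebra (A : kernel_space R T) : Prop := {
  bsa_measurable : forall K, A K -> mkernel K ;
  bsa_kaeq : forall K L, A K -> mkernel L -> kaeq K L ->
    A L /\ knorm A L = knorm A K ;
  bsa_zero : A kzero ;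
  bsa_add : forall K L, A K -> A L -> A (kadd K L) ;
  bsa_scale : forall c K, A K -> A (kscale c K) ;
  bsa_norm_ge0 : forall K, A K -> 0 <= knorm A K ;
  bsa_norm_eq0 : forall K, A K -> (knorm A K = 0 <-> kaeq K kzero) ;
  bsa_norm_add : forall K L, A K -> A L ->
    knorm A (kadd K L) <= knorm A K + knorm A L ;
  bsa_norm_scale : forall c K, A K -> knorm A (kscale c K) = nrm c * knorm A K ;
  bsa_complete : forall u : nat -> ckernel R T, (forall n, A (u n)) ->
    (forall e : R, 0 < e -> exists N, forall p q, (N <= p)%N -> (N <= q)%N ->
      knorm A (ksub (u p) (u q)) < e) ->
    exists2 K, A K & knorm A (ksub (u n) K) @[n --> \oo] --> (0 : R) ;
  bsa_comp_defined : forall K L, A K -> A L -> kcomp_defined K L ;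
  bsa_comp : forall K L, A K -> A L -> A (kcomp K L) ;
  bsa_compA : forall K L M, A K -> A L -> A M ->
    kaeq (kcomp K (kcomp L M)) (kcomp (kcomp K L) M) ;
  bsa_norm_comp : forall K L, A K -> A L ->
    knorm A (kcomp K L) <= knorm A K * knorm A L ;
  bsa_star : forall K, A K -> A (kstar K) ;
  bsa_norm_star : forall K, A K -> knorm A (kstar K) = knorm A K
}.

Record admissible_algebra (A : kernel_space R T) : Prop := {
  adm_banach : banach_star_algebra A ;
  adm_bounded : exists M : R, forall K F, A K -> L2 mu F ->
    [/\ kact_defined K F, L2 mu (kact K F) &
        L2norm mu (kact K F) <= M * knorm A K * L2norm mu F] ;
  adm_injective : forall K, A K ->
    (forall F, L2 mu F -> aeq mu (kact K F) (fun=> 0)) -> kaeq K kzero ;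
  adm_solid : forall K L, mkernel K -> A L ->
    {ae (mu \x mu)%E, forall z, nrm (K z.1 z.2) <= nrm (L z.1 z.2)} ->
    A K /\ knorm A K <= knorm A L
}.

(* The boundedness of the two actions follows from the closed graph theorem. *)
Definition bimodule (B A : kernel_space R T) := forall K L, B K -> A L ->
  [/\ kcomp_defined K L, A (kcomp K L), kcomp_defined L K & A (kcomp L K)].

Definition is_unit (A : kernel_space R T) (E : ckernel R T) :=
  A E /\ forall K, A K -> kaeq (kcomp E K) K /\ kaeq (kcomp K E) K.

(* Without a unit, the spectrum is taken in the unitization of [A]: the pair
   [(L, c)] below is the inverse of [(K, - lam)]. *)
Definition alg_resolvent (A : kernel_space R T) (K : ckernel R T) : set R[i] :=
  [set lam |
    (exists E L, [/\ is_unit A E, A L,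
       kaeq (kcomp (ksub K (kscale lam E)) L) E &
       kaeq (kcomp L (ksub K (kscale lam E))) E])
    \/
    (~ (exists E, is_unit A E) /\
     exists L c, [/\ A L, - lam * c = 1,
       kaeq (kadd (kcomp K L) (kadd (kscale c K) (kscale (- lam) L))) kzero &
       kaeq (kadd (kcomp L K) (kadd (kscale c K) (kscale (- lam) L))) kzero])].

Definition alg_spectrum (A : kernel_space R T) (K : ckernel R T) : set R[i] :=
  ~` alg_resolvent A K.

Definition spectral_algebra (A : kernel_space R T) :=
  admissible_algebra A /\
  forall K, A K -> kaeq (kstar K) K ->
    alg_spectrum A K = op_spectrum mu (kact K).

Definition normA1 (K : ckernel R T) : \bar R :=
  Order.max (ess_sup mu (fun x => \int[mu]_y (nrm (K x y))%:E)%E)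
            (ess_sup mu (fun y => \int[mu]_x (nrm (K x y))%:E)%E).

Definition kweight K (m : T -> T -> R) : ckernel R T := fun x y => K x y * (m x y)%:C.

Definition Am (m : T -> T -> R) : kernel_space R T := {|
  kmem := fun K => mkernel K /\ (normA1 (kweight K m) < +oo)%E ;
  knorm := fun K => fine (normA1 (kweight K m))
|}.

End kernels.

Section hilbert.
Context (R : realType) (H : completeNormedModType R[i]) (ip : H -> H -> R[i]).

Record hilbert_space : Prop := {
  ip_linear : forall (a : R[i]) f g h, ip (a *: f + g) h = a * ip f h + ip g h ;
  ip_conj : forall f g, ip g f = conjc (ip f g) ;
  ip_norm : forall f, ip f f = `|f| ^+ 2
}.

Definition separable := exists2 D : set H, countable D & dense D.

(* The value is meaningful where [S] is bijective. *)
Definition op_inv (S : H -> H) : H -> H := 'pinv_(fun=> 0) [set: H] S.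

Definition gram (J : Type) (g f : J -> H) : J -> J -> R[i] :=
  fun x y => ip (f y) (g x).

Definition intrinsically_localized (J : Type) (A : kernel_space R J) (f : J -> H) :=
  A (gram f f).

Section continuous_frame.
Context d (T : measurableType d) (mu : {measure set T -> \bar R}).
Variable psi : T -> H.

Definition continuous_frame := exists C1 C2 : R, [/\ 0 < C1, 0 < C2 &
  forall f, ((C1 * nrm f ^+ 2)%:E <=
              \int[mu]_x ((nrm (ip f (psi x)) ^+ 2)%:E) <=
             (C2 * nrm f ^+ 2)%:E)%E].

Definition frame_op (f : H) : H :=
  get [set h | forall g, ip h g = cintegral mu (fun x => ip f (psi x) * ip (psi x) g)].

Definition frame_kernel : T -> T -> R[i] :=
  fun x y => ip (psi y) (op_inv frame_op (psi x)).

End continuous_frame.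

Definition weakly_continuous (X : topologicalType) (psi : X -> H) :=
  forall f, continuous (fun x => ip f (psi x) : (R[i])^o).

Definition norm_bounded (J : Type) (psi : J -> H) :=
  exists M : R, forall x, nrm (psi x) <= M.

Section discrete_frame.
Context (I : choiceType) (a : I -> \bar R) (psi : I -> H).

Definition discrete_frame := exists C1 C2 : R, [/\ 0 < C1, 0 < C2 &
  forall f, ((C1 * nrm f ^+ 2)%:E <=
              \esum_(i in [set: I]) ((nrm (ip f (psi i)) ^+ 2)%:E * a i) <=
             (C2 * nrm f ^+ 2)%:E)%E].

(* The series converges along the finite subsets of [I]. *)
Definition discrete_frame_op (f : H) : H :=
  get [set h | summability.partial_sum
    (fun i => (ip f (psi i) * (fine (a i))%:C) *: psi i) @ summability.totally --> h].

Definition canonical_dual : I -> H := fun i => op_inv discrete_frame_op (psi i).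

End discrete_frame.

End hilbert.

Definition borel (X : topologicalType) := g_sigma_algebraType (@open X).

Section radon.
Context (R : realType) (X : ptopologicalType).
Variable mu : {measure set (borel X) -> \bar R}.

Definition sigma_compact := exists K : nat -> set X,
  (forall n, compact (K n)) /\ \bigcup_n K n = [set: X].

Record radon_measure : Prop := {
  radon_compact : forall K : set X, compact K -> (mu K < +oo)%E ;
  radon_outer : forall B : set (borel X), measurable B ->
    mu B = ereal_inf [set mu V | V in [set V : set X | open V /\ B `<=` V]] ;
  radon_inner : forall V : set X, open V ->
    mu V = ereal_sup [set mu K | K in [set K : set X | compact K /\ K `<=` V]]
}.

Definition full_support := forall V : set X, open V -> V !=set0 -> (0 < mu V)%E.

Record admissible_weight (m : X -> X -> R) : Prop := {
  weight_continuous : continuous (fun z : X * X => m z.1 z.2) ;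
  weight_ge1 : forall x y, 1 <= m x y ;
  weight_submult : forall x y z, m x y <= m x z * m z y ;
  weight_sym : forall x y, m x y = m y x ;
  weight_diag : exists M : R, forall x, m x x <= M
}.

Context (I : pointedType).
Variable U : I -> set X.

Record admissible_covering : Prop := {
  cov_measurable : forall i, measurable (U i : set (borel X)) ;
  cov_precompact : forall i, precompact (U i) ;
  cov_interior : forall i, (U i)^° !=set0 ;
  cov_cover : \bigcup_i U i = [set: X] ;
  cov_overlap : exists N : nat, forall j,
    ([set i | U i `&` U j !=set0] #<= `I_N)%card
}.

Record moderate_covering : Prop := {
  mod_lower : exists2 D : R, 0 < D & forall i, (D%:E <= mu (U i))%E ;
  mod_compare : exists M : R, forall i j, U i `&` U j !=set0 ->
    (mu (U i) <= M%:E * mu (U j))%E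
}.

Definition osc (K : X -> X -> R[i]) : X -> X -> R[i] := fun x y =>
  (sup [set nrm (K x y - K x z) | z in \bigcup_(i in [set i | U i y]) U i])%:C.

Record property_D (H : completeNormedModType R[i]) (ip : H -> H -> R[i])
    (psi : X -> H) (m : X -> X -> R) (delta C : R) : Prop := {
  D_admissible : admissible_covering ;
  D_moderate : moderate_covering ;
  D_weight : forall i x y, U i x -> U i y -> m x y <= C ;
  D_osc_mem : Am mu m (osc (frame_kernel ip mu psi)) ;
  D_osc : knorm (Am mu m) (osc (frame_kernel ip mu psi)) < delta
}.

End radon.

Definition discrete_space (I : Type) := I.

HB.instance Definition _ (I : pointedType) := Pointed.on (discrete_space I).
HB.instance Definition _ (I : pointedType) :=
  @isMeasurable.Build default_measure_display (discrete_space I)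
    discrete_measurable discrete_measurable0
    discrete_measurableC discrete_measurableU.

Section discretization.
Context (R : realType) d (T : measurableType d) (mu : {measure set T -> \bar R}).
Context (I : pointedType) (U : I -> set T).

Definition cover_measure (S : set (discrete_space I)) : \bar R :=
  \esum_(i in S) mu (U i).

Let cover_measure0 : cover_measure set0 = 0%E.
Proof. exact: esum_set0. Qed.

Let cover_measure_ge0 S : (0 <= cover_measure S)%E.
Proof. exact: esum_ge0. Qed.

Let cover_measure_sigma_additive : semi_sigma_additive cover_measure.
Proof.
move=> F _ tF _; rewrite [X in _ --> X](_ : _ = \sum_(n <oo) cover_measure (F n))%E.
  exact: is_cvg_nneseries.
by rewrite /cover_measure esum_bigcupT// nneseries_esumT// => n; exact: esum_ge0.
Qed.

HB.instance Definition _ := isMeasure.Build _ _ _ cover_measure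
  cover_measure0 cover_measure_ge0 cover_measure_sigma_additive.

(* [\sum_(p \in _)] is the sum over the support of the summand, which has at
   most [N ^ 2] elements for an admissible covering. *)
Definition lift_kernel (L : I -> I -> R[i]) : T -> T -> R[i] := fun x y =>
  (\sum_(p \in [set: I * I])
     (nrm (L p.1 p.2) * \1_(U p.1) x * \1_(U p.2) y))%:C.

(* With respect to [cover_measure], [kcomp] and [kact] are the matrix product
   and the matrix action weighted by [mu (U k)]. *)
Definition flat (A : kernel_space R T) : kernel_space R (discrete_space I) := {|
  kmem := fun L => A (lift_kernel L) ;
  knorm := fun L => knorm A (lift_kernel L)
|}.

End discretization.

(* Main.v *)
(* Write [V f x = <f, psi_x>]. The reproducing formula [V f = R (V f)] shows that
   on each [U_i] the function [V f] oscillates by at most the action of [osc] on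
   [|V f|]. The hypothesis on [delta] forces [delta <= 1], so the kernel [osc]
   has Schur norm [k < 1], whence [|V f (x_i)|] and [|V f|] are comparable in
   [L^2] up to the factors [1 - k] and [1 + k]: this gives the frame bounds.
   Applied to [f = psi_x], the same inequality dominates the discrete Gramian
   [G] on [U_i * U_j] by compositions of the continuous Gramian with [osc] and
   [osc^*], which belong to the algebra by the bimodule property; solidity and
   bounded overlap conclude.

   For the dual, let [S = V^* V] be the discrete frame operator and
   [B = 1 - S / C2], so that [||B|| <= q < 1]. Write [Y T] for the matrix
   [<T psi_j, psi_i>]; then [Y 1 = G] and the dual Gramian is [Y (S^-2)]. The
   norm of [B] in the algebra is not controlled directly, so fix [r > 1] with
   [r q < 1]: for [|z| = r] the matrix of [(1 - z B)^-1] is in the algebra by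
   spectrality, and it is Lipschitz in [z]. Its Fourier coefficients on the
   circle give [||Y (B^j)|| <= M r^-j], and [S^-2] is a power series in [B] which
   converges geometrically. *)
From HB Require Import structures.
Require Import Defs.
From mathcomp Require Import all_boot all_order all_algebra finmap complex.
From mathcomp Require Import all_classical all_reals all_analysis.
From mathcomp Require Import measurable_realfun ess_sup_inf.
From mathcomp Require Import ring lra.
From mathcomp Require summability.

Set Implicit Arguments.
Unset Strict Implicit.
Unset Printing Implicit Defensive.

Import Order.TTheory GRing.Theory Num.Theory.
Import numFieldNormedType.Exports.
(* [kernel] of MathComp-Analysis has its own [kadd] and [kcomp]. *)
Import Defs.

Local Open Scope classical_set_scope.
Local Open Scope ring_scope.
Local Open Scope complex_scope.

(** * Inner products *)

(** The points [x i] may all lie in a null set, so estimates at them have to be pointwise. They are,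
    because the frame kernel is bounded everywhere and [osc] is a supremum over whole cells; the
    other variables are taken almost everywhere. On the index set all atoms have positive finite
    mass, and almost everywhere means everywhere.

    Spectrality yields an inverse for one parameter at a time, without a bound on its norm. The
    resolvent identity bounds the difference of two resolvents by a multiple of the product of their
    norms, each increased by one. Hence the reciprocal of one plus the norm is Lipschitz, and its
    minimum on the compact circle bounds the norm. The Fourier coefficients are limits of averages
    over roots of unity instead of integrals of algebra-valued functions, and these limits are
    identified entry by entry. As the algebra may have no unit, everything is phrased with the
    matrices of [V T V^*], a family closed under composition, where [S] appears between the two
    operators. *)

Section nrm_theory.
Context (R : realType).

Lemma nrmE (V : normedZmodType R[i]) (v : V) : `|v| = (nrm v)%:C.
Proof. by rewrite /nrm RRe_real// ger0_real. Qed.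

Lemma nrm_ge0 (V : normedZmodType R[i]) (v : V) : 0 <= nrm v.
Proof. by rewrite -ler0c -nrmE. Qed.

Lemma nrm0 (V : normedZmodType R[i]) : nrm (0 : V) = 0.
Proof. by rewrite /nrm normr0. Qed.

Lemma nrm_eq0 (V : normedZmodType R[i]) (v : V) : nrm v = 0 -> v = 0.
Proof. by move=> v0; apply/normr0_eq0; rewrite nrmE v0. Qed.

Lemma nrmD (V : normedZmodType R[i]) (u v : V) : nrm (u + v) <= nrm u + nrm v.
Proof. by rewrite -lecR rmorphD/= -!nrmE ler_normD. Qed.

Lemma nrmN (V : normedZmodType R[i]) (v : V) : nrm (- v) = nrm v.
Proof. by rewrite /nrm normrN. Qed.

Lemma nrmBC (V : normedZmodType R[i]) (u v : V) : nrm (u - v) = nrm (v - u).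
Proof. by rewrite -nrmN opprB. Qed.

Lemma nrm_distD (V : normedZmodType R[i]) (w u v : V) :
  nrm (u - v) <= nrm (u - w) + nrm (w - v).
Proof. by rewrite -[u - v](subrKA w) nrmD. Qed.

Lemma nrm_sum (V : normedZmodType R[i]) (J : Type) (r : seq J) (P : pred J) (f : J -> V) :
  nrm (\sum_(i <- r | P i) f i) <= \sum_(i <- r | P i) nrm (f i).
Proof.
elim/big_ind2 : _ => [|u a v b ua vb|//]; first by rewrite nrm0.
exact: le_trans (nrmD _ _) (lerD ua vb).
Qed.

Lemma nrmZ (V : normedModType R[i]) (a : R[i]) (v : V) :
  nrm (a *: v) = nrm a * nrm v.
Proof. by apply: complexI; rewrite rmorphM/= -!nrmE normrZ. Qed.

Lemma nrmM (a b : R[i]) : nrm (a * b) = nrm a * nrm b.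
Proof. by apply: complexI; rewrite rmorphM/= -!nrmE normrM. Qed.

Lemma nrm1 : nrm (1 : R[i]) = 1.
Proof. by rewrite /nrm normr1. Qed.

Lemma nrmV (a : R[i]) : nrm a^-1 = (nrm a)^-1.
Proof.
have [->|a0] := eqVneq a 0; first by rewrite invr0 nrm0 invr0.
have na0 : nrm a != 0 by apply: contra_neq a0; exact: nrm_eq0.
by apply: (mulfI na0); rewrite -nrmM !mulfV// nrm1.
Qed.

Lemma nrmJ (a : R[i]) : nrm (conjc a) = nrm a.
Proof. by rewrite /nrm normcJ. Qed.

Lemma nrm_real (x : R) : nrm x%:C = `|x|.
Proof. by rewrite /nrm normc_def/= expr0n/= addr0 sqrtr_sqr. Qed.

Lemma sqr_nrm (z : R[i]) : nrm z ^+ 2 = complex.Re z ^+ 2 + complex.Im z ^+ 2.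
Proof. by apply: complexI; rewrite rmorphXn/= -nrmE add_Re2_Im2. Qed.

Lemma conjc_mul_nrm (z : R[i]) : z * conjc z = (nrm z ^+ 2)%:C.
Proof. by rewrite -sqr_normc nrmE rmorphXn. Qed.

Lemma Re_le_nrm (z : R[i]) : `|complex.Re z| <= nrm z.
Proof. by rewrite -lecR -nrmE normc_ge_Re. Qed.

Lemma Im_le_nrm (z : R[i]) : `|complex.Im z| <= nrm z.
Proof.
rewrite -[leRHS]ger0_norm ?nrm_ge0// -ler_sqr ?nnegrE// !real_normK ?num_real//.
by rewrite sqr_nrm lerDr sqr_ge0.
Qed.

Lemma ReB (a b : R[i]) : complex.Re (a - b) = complex.Re a - complex.Re b.
Proof. by case: a b => [? ?] [? ?]. Qed.

Lemma ReD (a b : R[i]) : complex.Re (a + b) = complex.Re a + complex.Re b.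
Proof. by case: a b => [? ?] [? ?]. Qed.

Lemma ReMr (x : R) (a : R[i]) : complex.Re (x%:C * a) = x * complex.Re a.
Proof. by case: a => [? ?]; rewrite /= mul0r subr0. Qed.

Lemma complex_ext (a b : R[i]) :
  complex.Re a = complex.Re b -> complex.Im a = complex.Im b -> a = b.
Proof. by case: a b => [? ?] [? ?] /= -> ->. Qed.

(** Radii of balls in [H] are elements of [R[i]]; a positive one is real, which allows the errors to
    be taken in [R]. *)
Lemma cauchy_seq_nrm (H : completeNormedModType R[i]) (u : nat -> H) :
  (forall e : R, 0 < e -> exists N, forall p q, (N <= p)%N -> (N <= q)%N ->
     nrm (u p - u q) < e) ->
  exists h, forall e : R, 0 < e -> exists N, forall n, (N <= n)%N ->
    nrm (h - u n) < e.
Proof.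
move=> cu.
have /cauchy_cvgP : cauchy (u @ \oo).
  apply: cauchy_exP => e e0.
  have e_re : e = (complex.Re e)%:C by rewrite RRe_real// gtr0_real.
  move: e0; rewrite e_re ltcR => e0.
  have [N cN] := cu _ e0.
  exists (u N), N => // n /= Nn.
  by rewrite -ball_normE/= nrmE ltcR; exact: cN.
move=> /cvg_ex[h uh]; exists h => e e0.
have /cvgr_dist_lt/(_ e%:C) := uh.
rewrite ltcR => /(_ e0)[N _ hN]; exists N => n Nn.
by have := hN n Nn; rewrite /= nrmE ltcR.
Qed.

End nrm_theory.

Section inner_product.
Context (R : realType) (H : completeNormedModType R[i]) (ip : H -> H -> R[i]).
Hypothesis hH : hilbert_space ip.

Lemma ipDl f g h : ip (f + g) h = ip f h + ip g h.
Proof. by rewrite -[f]scale1r (ip_linear hH) mul1r scale1r. Qed.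

Lemma ip0l h : ip 0 h = 0.
Proof. by apply: (addrI (ip 0 h)); rewrite -ipDl !addr0. Qed.

Lemma ipZl a f h : ip (a *: f) h = a * ip f h.
Proof. by rewrite -[a *: f]addr0 (ip_linear hH) ip0l addr0. Qed.

Lemma ipNl f h : ip (- f) h = - ip f h.
Proof. by rewrite -scaleN1r ipZl mulN1r. Qed.

Lemma ipBl f g h : ip (f - g) h = ip f h - ip g h.
Proof. by rewrite ipDl ipNl. Qed.

Lemma ipDr f g h : ip h (f + g) = ip h f + ip h g.
Proof. by rewrite (ip_conj hH) ipDl rmorphD/= -!(ip_conj hH). Qed.

Lemma ipZr a f h : ip h (a *: f) = conjc a * ip h f.
Proof. by rewrite (ip_conj hH) ipZl rmorphM/= -!(ip_conj hH). Qed.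

Lemma ip0r h : ip h 0 = 0.
Proof. by rewrite (ip_conj hH) ip0l conjc0. Qed.

Lemma ipBr f g h : ip h (f - g) = ip h f - ip h g.
Proof. by rewrite (ip_conj hH) ipBl rmorphB/= -!(ip_conj hH). Qed.

Lemma ip_suml (J : Type) (r : seq J) (P : pred J) (F : J -> H) h :
  ip (\sum_(i <- r | P i) F i) h = \sum_(i <- r | P i) ip (F i) h.
Proof. by elim/big_rec2 : _ => [|i a b _ <-]; rewrite ?ip0l ?ipDl. Qed.

Lemma ipff f : ip f f = (nrm f ^+ 2)%:C.
Proof. by rewrite (ip_norm hH) nrmE rmorphXn. Qed.

Lemma nrm_ipC f g : nrm (ip f g) = nrm (ip g f).
Proof. by rewrite (ip_conj hH) nrmJ. Qed.

Lemma ip_ext f g : (forall h, ip f h = ip g h) -> f = g.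
Proof.
move=> fg; apply/eqP; rewrite -subr_eq0; apply/eqP/nrm_eq0.
have := ipff (f - g); rewrite ipBl fg subrr => /esym/complexI/eqP.
by rewrite expf_eq0/= => /eqP.
Qed.

Lemma ip_ext0 f : (forall h, ip f h = 0) -> f = 0.
Proof. by move=> f0; apply: ip_ext => h; rewrite f0 ip0l. Qed.

Lemma cauchy_schwarz f g : nrm (ip f g) <= nrm f * nrm g.
Proof.
have [g0|g0] := eqVneq (nrm g) 0.
  by rewrite (nrm_eq0 g0) ip0r !nrm0 mulr0.
have gp : 0 < nrm g by rewrite lt_neqAle eq_sym g0 nrm_ge0.
rewrite -ler_sqr ?nnegrE ?nrm_ge0 ?mulr_ge0 ?nrm_ge0//.
set c := ip f g.
(* Up to the factor [nrm g ^+ 2], this vector is the component of [f] orthogonal to [g]; its squared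
   norm being nonnegative is the inequality. *)
have := ipff ((nrm g ^+ 2)%:C *: f - c *: g).
rewrite ipBl !ipBr !ipZl !ipZr !ipff (ip_conj hH f g) -/c conjc_real.
have -> : (nrm g ^+ 2)%:C * ((nrm g ^+ 2)%:C * (nrm f ^+ 2)%:C)
   - (nrm g ^+ 2)%:C * (conjc c * c)
   - (c * ((nrm g ^+ 2)%:C * conjc c) - c * (conjc c * (nrm g ^+ 2)%:C)) =
   ((nrm g ^+ 2)%:C) * ((nrm g ^+ 2)%:C * (nrm f ^+ 2)%:C - c * conjc c) by ring.
rewrite conjc_mul_nrm -!(rmorphM, rmorphB)/= => /complexI h.
have : 0 <= nrm g ^+ 2 * (nrm g ^+ 2 * nrm f ^+ 2 - nrm c ^+ 2).
  by rewrite h sqr_ge0.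
by rewrite pmulr_rge0 ?exprn_gt0// subr_ge0 exprMn mulrC.
Qed.

Lemma nrm_le_ip f (M : R) : 0 <= M -> (forall g, nrm (ip f g) <= M * nrm g) -> nrm f <= M.
Proof.
move=> M0 fM; have := fM f; rewrite ipff nrm_real ger0_norm ?sqr_ge0// expr2.
have [->//|f0] := eqVneq (nrm f) 0.
by rewrite ler_pM2r// lt_neqAle eq_sym f0 nrm_ge0.
Qed.

(* The solution is the minimizer of [B f f - 2 Re (phi f)]. *)
Lemma lax_milgram (B : H -> H -> R[i]) (phi : H -> R[i]) (c C M : R) :
  (forall a f g h, B (a *: f + g) h = a * B f h + B g h) ->
  (forall f g, B g f = conjc (B f g)) ->
  0 < c -> (forall f, c * nrm f ^+ 2 <= complex.Re (B f f)) ->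
  (forall f g, nrm (B f g) <= C * nrm f * nrm g) ->
  (forall a f g, phi (a *: f + g) = a * phi f + phi g) ->
  (forall f, nrm (phi f) <= M * nrm f) ->
  exists h, forall f, phi f = B f h.
Proof.
move=> Blin Bconj c0 Bc BC philin phiM.
have BDl f g h : B (f + g) h = B f h + B g h by rewrite -[f]scale1r Blin mul1r scale1r.
have B0l h : B 0 h = 0 by apply: (addrI (B 0 h)); rewrite -BDl !addr0.
have BZl a f h : B (a *: f) h = a * B f h by rewrite -[a *: f]addr0 Blin B0l addr0.
have BDr f g h : B h (f + g) = B h f + B h g.
  by rewrite Bconj BDl rmorphD/= -!Bconj.
have BZr a f h : B h (a *: f) = conjc a * B h f.
  by rewrite Bconj BZl rmorphM/= -!Bconj.
have ReB' f g : complex.Re (B g f) = complex.Re (B f g).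
  by rewrite Bconj; case: (B f g).
have phiD f g : phi (f + g) = phi f + phi g by rewrite -[f]scale1r philin mul1r scale1r.
have phi0 : phi 0 = 0 by apply: (addrI (phi 0)); rewrite -phiD !addr0.
have phiZ a f : phi (a *: f) = a * phi f by rewrite -[a *: f]addr0 philin phi0 addr0.
pose rB f g := complex.Re (B f g).
pose rp f := complex.Re (phi f).
pose J f := rB f f - 2 * rp f.
have JD f d (s : R) : J (f + s%:C *: d) =
    J f + s ^+ 2 * rB d d + 2 * s * (rB d f - rp d).
  rewrite /J /rB /rp BDl !BDr !BZl !BZr phiD phiZ conjc_real !ReD !ReMr (ReB' d f).
  by ring.
(* Complete the square in [c t^2 - 2 M t], where [t = nrm f]. *)
have Jlb f : - (M ^+ 2 / c) <= J f.
  have h1 := Bc f; have h2 := le_trans (ler_norm _) (le_trans (Re_le_nrm (phi f)) (phiM f)).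
  rewrite /J /rB /rp.
  suff : 0 <= c * nrm f ^+ 2 - 2 * (M * nrm f) + M ^+ 2 / c by lra.
  have -> : c * nrm f ^+ 2 - 2 * (M * nrm f) + M ^+ 2 / c =
    c * (nrm f - M / c) ^+ 2 by field; rewrite gt_eqF.
  by rewrite mulr_ge0 ?sqr_ge0// ltW.
have hasJ : has_inf (range J).
  split; first by exists (J 0), 0.
  by exists (- (M ^+ 2 / c)) => _ [f _ <-].
pose l := inf (range J).
have lJ f : l <= J f by apply: ge_inf; [exact: hasJ.2|exists f].
have /choice[u uJ] : forall n : nat, exists f, J f < l + n.+1%:R^-1.
  move=> n; have [|_ [f _ <-] Jf] := @inf_adherent _ (range J) (n.+1%:R^-1) _ hasJ.
    by rewrite invr_gt0.
  by exists f.
have rBD f g (s : R) : rB (f + s%:C *: g) (f + s%:C *: g) =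
    rB f f + 2 * s * rB f g + s ^+ 2 * rB g g.
  rewrite /rB BDl !BDr !BZl !BZr conjc_real !ReD !ReMr (ReB' f g).
  by ring.
have rBDl f g h (s : R) : rB (f + s%:C *: g) h = rB f h + s * rB g h.
  by rewrite /rB BDl BZl ReD ReMr.
have rpD f g (s : R) : rp (f + s%:C *: g) = rp f + s * rp g.
  by rewrite /rp phiD phiZ ReD ReMr.
have midpoint (k p q r s t : R) :
    k <= p - 2 * s + 4^-1 * (r + 2 * -1 * q + (-1) ^+ 2 * p) +
      2 / 2 * (q + -1 * p - (t + -1 * s)) ->
    p + 2 * -1 * q + (-1) ^+ 2 * r <= 2 * (p - 2 * s - k) + 2 * (r - 2 * t - k).
  by lra.
(* [m1] and [hf] are opaque here: inside [_%:C], the constants would be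
   elaborated in a copy of [R] on which [lra] fails. *)
have [m1 m1E] : exists s : R, s = -1 by exists (-1).
have [hf hfE] : exists s : R, s = 2^-1 by exists (2^-1).
(* Parallelogram law: since [J] is at least [l] at the midpoint of [f] and [g], two nearly minimal
   points are close to each other. A minimizing sequence is therefore Cauchy. *)
have par f g : rB (f - g) (f - g) <= 2 * (J f - l) + 2 * (J g - l).
  have hm := lJ (f + hf%:C *: (g - f)).
  have E (v w : H) : v - w = v + m1%:C *: w by rewrite m1E rmorphN1 scaleN1r.
  have C' : rB g f = rB f g by exact: ReB'.
  move: hm; rewrite JD !E !rBD rBDl rpD C' /J m1E hfE.
  rewrite (_ : (2^-1 : R) ^+ 2 = 4^-1); last by field.
  move: (rB f f) (rB f g) (rB g g) (rp f) (rp g) => p q r s t hm.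
  exact: midpoint hm.
have small (e : R) : 0 < e -> exists N, forall p, (N <= p)%N -> J (u p) - l < e.
  move=> e0; have [N _ hN] := near_infty_natSinv_lt (PosNum e0).
  exists N => p Np; rewrite ltrBlDl; apply: lt_trans (uJ p) _.
  by rewrite ltrD2l; exact: hN.
have [h uh] : exists h, forall e : R, 0 < e -> exists N, forall n, (N <= n)%N ->
    nrm (h - u n) < e.
  apply: cauchy_seq_nrm => e e0.
  (* The two terms of [par] add up to less than [c e^2], which coercivity turns into a distance less
     than [e]. *)
  have [|N hN] := small (c * e ^+ 2 / 4); first by rewrite divr_gt0// mulr_gt0// exprn_gt0.
  exists N => p q Np Nq.
  have h1 := hN p Np; have h2 := hN q Nq; have h3 := par (u p) (u q).
  have h4 := Bc (u p - u q).
  rewrite -ltr_sqr ?nnegrE ?nrm_ge0 1?ltW//.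
  rewrite -(ltr_pM2l c0); rewrite /rB in h3; lra.
exists h.
have key v : rp v = rB v h.
  apply/eqP; rewrite -subr_eq0; apply/eqP.
  pose K := (1 + (rB v v) + `|C| * nrm v).
  have rBv0 : 0 <= rB v v.
    by apply: le_trans (Bc v); rewrite mulr_ge0 ?sqr_ge0// ltW.
  have K0 : 0 < K.
    by rewrite /K -addrA ltr_pwDl// addr_ge0// mulr_ge0 ?nrm_ge0.
  suff bnd e : 0 < e -> e <= 1 -> `|rp v - rB v h| <= e * K.
    apply/eqP; rewrite -normr_le0; apply/ler_addgt0Pl => e e0; rewrite addr0.
    have em0 : 0 < Num.min 1 (e / K) by rewrite lt_min ltr01 divr_gt0.
    apply: le_trans (bnd _ em0 _) _; first by rewrite ge_min lexx.
    by rewrite -ler_pdivlMr// ge_min lexx orbT.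
  move=> e0 e1.
  have [N1 hN1] := small (e ^+ 2) (exprn_gt0 _ e0).
  have [N2 hN2] := uh e e0.
  pose n := maxn N1 N2.
  have h1 := hN1 n (leq_maxl _ _); have h2 := hN2 n (leq_maxr _ _).
  pose D := rB v (u n) - rp v.
  (* [2 D] is the derivative of [J] at [u n] in direction [v]. As [J (u n) < l + e^2] while [l] is a
     lower bound, the displacements by [e v] and by [- e v] bound it from both sides. *)
  have hD : `|D| <= e * (1 + rB v v).
    have hs s := lJ (u n + s%:C *: v).
    have e2 : 0 < e ^+ 2 by rewrite exprn_gt0.
    have hp := hs e; have hm := hs (- e).
    rewrite JD -/D in hp; rewrite JD -/D in hm.
    have -> : e * (1 + rB v v) = e + e * rB v v by ring.
    have hv : 0 <= e ^+ 2 * rB v v by rewrite mulr_ge0// ltW.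
    have eD : `|e * D| <= e ^+ 2 + e ^+ 2 * rB v v.
      by rewrite ler_norml; apply/andP; split; move: hm hp; rewrite sqrrN; lra.
    rewrite -(ler_pM2l e0) -[X in X * `|_|](gtr0_norm e0) -normrM.
    by rewrite (_ : e * (e + e * rB v v) = e ^+ 2 + e ^+ 2 * rB v v)//; ring.
  have hE : `|rB v (u n) - rB v h| <= `|C| * nrm v * e.
    have -> : rB v (u n) - rB v h = complex.Re (B v (u n - h)).
      by rewrite BDr -[- h]scaleN1r BZr rmorphN1 mulN1r ReB.
    apply: le_trans (Re_le_nrm _) _; apply: le_trans (BC _ _) _.
    rewrite nrmBC; apply: (@le_trans _ _ (`|C| * nrm v * nrm (h - u n))).
      by rewrite !ler_wpM2r ?nrm_ge0 ?ler_norm.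
    by rewrite ler_wpM2l ?mulr_ge0 ?nrm_ge0// ltW.
  have -> : rp v - rB v h = (rB v (u n) - rB v h) - D by rewrite /D; ring.
  apply: le_trans (ler_normB _ _) _; rewrite /K; lra.
move=> f; apply: complex_ext; first exact: key.
(* [Re (- i z) = Im z], so the identity of real parts at [- i f] is the identity of imaginary parts
   at [f]. *)
have := key ((- 'i%C) *: f); rewrite /rp /rB phiZ BZl.
by case: (phi f) (B f h) => [a b] [a' b'] /=; rewrite oppr0 !mul0r !mulN1r !opprK !add0r.
Qed.

End inner_product.

(** * Integrals of complex functions *)

Section complex_measurable.
Context (R : realType) d (T : measurableType d).
Implicit Types f g : T -> R[i].

Lemma cmeasurableD f g : cmeasurable f -> cmeasurable g ->
  cmeasurable (fun x => f x + g x).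
Proof.
move=> [f1 f2] [g1 g2]; split.
  by under eq_fun do rewrite ReD; exact: measurable_funD.
rewrite (_ : (fun _ => _) = fun x => complex.Im (f x) + complex.Im (g x)).
  exact: measurable_funD.
by apply/funext => x; case: (f x) (g x) => [? ?] [? ?].
Qed.

Lemma cmeasurableM f g : cmeasurable f -> cmeasurable g ->
  cmeasurable (fun x => f x * g x).
Proof.
move=> [f1 f2] [g1 g2]; split.
  rewrite (_ : (fun _ => _) = fun x => complex.Re (f x) * complex.Re (g x) -
      complex.Im (f x) * complex.Im (g x)).
    by apply: measurable_funB; exact: measurable_funM.
  by apply/funext => x; case: (f x) (g x) => [? ?] [? ?].
rewrite (_ : (fun _ => _) = fun x => complex.Re (f x) * complex.Im (g x) +
    complex.Im (f x) * complex.Re (g x)).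
  by apply: measurable_funD; exact: measurable_funM.
by apply/funext => x; case: (f x) (g x) => [? ?] [? ?].
Qed.

Lemma cmeasurable_cst (c : R[i]) : cmeasurable (fun _ : T => c).
Proof. by split; exact: measurable_cst. Qed.

Lemma cmeasurableJ f : cmeasurable f -> cmeasurable (fun x => conjc (f x)).
Proof.
move=> [f1 f2]; split.
  rewrite (_ : (fun _ => _) = fun x => complex.Re (f x))//.
  by apply/funext => x; case: (f x).
rewrite (_ : (fun _ => _) = fun x => - complex.Im (f x)).
  exact: measurable_funN.
by apply/funext => x; case: (f x).
Qed.

Lemma cmeasurable_real (h : T -> R) : measurable_fun setT h ->
  cmeasurable (fun x => (h x)%:C).
Proof. by move=> mh; split => //; exact: measurable_cst. Qed.

Lemma measurable_nrm f : cmeasurable f -> measurable_fun setT (fun x => nrm (f x)).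
Proof.
move=> [f1 f2].
rewrite (_ : (fun _ => _) = fun x =>
    Num.sqrt (complex.Re (f x) ^+ 2 + complex.Im (f x) ^+ 2)).
  apply: measurableT_comp; first exact: (continuous_measurable_fun (@sqrt_continuous R)).
  by apply: measurable_funD; exact: measurable_funX.
by apply/funext => x; rewrite -sqr_nrm sqrtr_sqr ger0_norm ?nrm_ge0.
Qed.

End complex_measurable.

Section complex_integral_theory.
Context (R : realType) d (T : measurableType d) (mu : {measure set T -> \bar R}).
Implicit Types f g F G : T -> R[i].

Lemma cintegrableP f : cintegrable mu f <->
  cmeasurable f /\ (\int[mu]_x (nrm (f x))%:E < +oo)%E.
Proof.
split=> [[i1 i2]|[mf foo]].
  have /measurable_EFinP m1 := measurable_int _ i1.
  have /measurable_EFinP m2 := measurable_int _ i2.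
  have mf : cmeasurable f by [].
  split=> //.
  have iD := integrableD measurableT (integrable_abse i1) (integrable_abse i2).
  have /integrableP[_ ] := iD.
  apply: le_lt_trans; apply: ge0_le_integral => //=.
  - by move=> x _; rewrite lee_fin nrm_ge0.
  - exact/measurable_EFinP/measurable_nrm.
  - exact: measurable_int (integrable_abse iD).
  - move=> x _; rewrite /= lee_fin ger0_norm ?addr_ge0//.
    rewrite -ler_sqr ?nnegrE ?nrm_ge0 ?addr_ge0// sqr_nrm sqrrD !real_normK ?num_real//.
    by rewrite lerD2r lerDl mulrn_wge0// mulr_ge0.
have fi : mu.-integrable setT (fun x => (nrm (f x))%:E).
  apply/integrableP; split; first exact/measurable_EFinP/measurable_nrm.
  by under eq_integral do rewrite gee0_abs ?lee_fin ?nrm_ge0//.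
case: mf => m1 m2; split; apply: le_integrable fi => //;
  try exact/measurable_EFinP.
- by move=> x _ /=; rewrite lee_fin [leRHS]ger0_norm ?nrm_ge0 ?Re_le_nrm.
- by move=> x _ /=; rewrite lee_fin [leRHS]ger0_norm ?nrm_ge0 ?Im_le_nrm.
Qed.

Lemma cintegrableZ c f : cintegrable mu f -> cintegrable mu (fun x => c * f x).
Proof.
move=> /cintegrableP[mf foo]; apply/cintegrableP; split.
  by apply: cmeasurableM => //; exact: cmeasurable_cst.
under eq_integral do rewrite nrmM EFinM.
rewrite ge0_integralZl_EFin ?nrm_ge0//.
- by rewrite lte_mul_pinfty ?lee_fin ?nrm_ge0.
- by move=> x _; rewrite lee_fin nrm_ge0.
- exact/measurable_EFinP/measurable_nrm.
Qed.

Lemma cintegralD f g : cintegrable mu f -> cintegrable mu g ->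
  cintegral mu (fun x => f x + g x) = cintegral mu f + cintegral mu g.
Proof.
move=> [f1 f2] [g1 g2]; apply: complex_ext => /=.
  by rewrite -RintegralD//; congr Rintegral; apply/funext => x; rewrite ReD.
rewrite -RintegralD//; congr Rintegral; apply/funext => x.
by case: (f x) (g x) => [? ?] [? ?].
Qed.

Lemma cintegralZ c f : cintegrable mu f ->
  cintegral mu (fun x => c * f x) = c * cintegral mu f.
Proof.
move=> [f1 f2]; case: c => a b; apply: complex_ext => /=.
  rewrite -!RintegralZl// -RintegralB//; last 2 first.
  - exact: (integrableZl measurableT a f1).
  - exact: (integrableZl measurableT b f2).
  by congr Rintegral; apply/funext => x; case: (f x).
rewrite -!RintegralZl// -RintegralD//; last 2 first.
- exact: (integrableZl measurableT a f2).
- exact: (integrableZl measurableT b f1).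
by congr Rintegral; apply/funext => x; case: (f x).
Qed.

Lemma cintegralB f g : cintegrable mu f -> cintegrable mu g ->
  cintegral mu (fun x => f x - g x) = cintegral mu f - cintegral mu g.
Proof.
move=> fi gi; rewrite -mulN1r -cintegralZ// -cintegralD//; last exact: cintegrableZ.
by congr cintegral; apply/funext => x; rewrite mulN1r.
Qed.

Lemma cintegralJ f : cintegrable mu f ->
  cintegral mu (fun x => conjc (f x)) = conjc (cintegral mu f).
Proof.
move=> [f1 f2]; apply: complex_ext => /=.
  by congr Rintegral; apply/funext => x; case: (f x).
rewrite -mulN1r -RintegralZl//.
by congr Rintegral; apply/funext => x; rewrite mulN1r; case: (f x).
Qed.

(** Rotate the integral onto the positive real axis by a unimodular [w]; it then equals the integral
    of the real part of [w f], which is at most [nrm (f x)] pointwise. *)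
Lemma nrm_cintegral_le f : cmeasurable f ->
  ((nrm (cintegral mu f))%:E <= \int[mu]_x (nrm (f x))%:E)%E.
Proof.
move=> mf.
have [foo|] := ltP (\int[mu]_x (nrm (f x))%:E)%E +oo%E; last first.
  by rewrite leye_eq => /eqP ->; rewrite leey.
have fi : cintegrable mu f by apply/cintegrableP.
set z := cintegral mu f.
have [->|z0] := eqVneq z 0.
  by rewrite nrm0 integral_ge0// => x _; rewrite lee_fin nrm_ge0.
have nz0 : nrm z != 0 by apply: contra_neq z0; exact: nrm_eq0.
have [w nw wz] : exists2 w, nrm w = 1 & w * z = (nrm z)%:C.
  exists (conjc z * ((nrm z)^-1)%:C).
    by rewrite nrmM nrmJ nrm_real ger0_norm ?invr_ge0 ?nrm_ge0// mulfV.
  rewrite mulrAC [_ * z]mulrC conjc_mul_nrm -rmorphM/=; congr (_%:C).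
  by rewrite expr2 -mulrA mulfV// mulr1.
have E : \int[mu]_x complex.Re (w * f x) = nrm z.
  by have := congr1 (@complex.Re R) (cintegralZ w fi); rewrite wz.
apply: (@le_trans _ _ (\int[mu]_x complex.Re (w * f x))%:E); first by rewrite E.
have [r1 _] := cintegrableZ w fi.
rewrite /Rintegral fineK; last exact: integrable_fin_num.
apply: le_trans (lee_abs _) _; apply: le_trans (le_abse_integral _ _ _) _ => //.
  exact: measurable_int r1.
apply: ge0_le_integral => //.
- by apply: measurableT_comp => //; exact: measurable_int r1.
- exact/measurable_EFinP/measurable_nrm.
- move=> x _; rewrite lee_fin; apply: le_trans (Re_le_nrm _) _.
  by rewrite nrmM nw mul1r.
Qed.

(** Integrate [2 f g <= t f^2 + g^2 / t]. With [t = 1] this shows that the integral [p] of [f g] is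
    finite; then [t = p / a] gives [p^2 <= a b]. If [a = 0 < b], the choice [t = b / p] excludes
    [p > 0]. *)
Lemma integral_cauchy_schwarz (f g : T -> R) (a b : R) :
  measurable_fun setT f -> measurable_fun setT g ->
  (forall x, 0 <= f x) -> (forall x, 0 <= g x) ->
  (\int[mu]_x (f x ^+ 2)%:E <= a%:E)%E -> (\int[mu]_x (g x ^+ 2)%:E <= b%:E)%E ->
  (\int[mu]_x (f x * g x)%:E <= (Num.sqrt (a * b))%:E)%E.
Proof.
move=> mf mg f0 g0 fa gb.
have m2 (h : T -> R) : measurable_fun setT h -> measurable_fun setT (fun x => (h x ^+ 2)%:E).
  by move=> mh; exact/measurable_EFinP/measurable_funX.
have i0 (h : T -> R) : (0 <= \int[mu]_x (h x ^+ 2)%:E)%E.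
  by apply: integral_ge0 => x _; rewrite lee_fin sqr_ge0.
have a0 : 0 <= a by rewrite -lee_fin; exact: le_trans fa.
have b0 : 0 <= b by rewrite -lee_fin; exact: le_trans gb.
set P := (\int[mu]_x (f x * g x)%:E)%E.
have P0 : (0 <= P)%E by apply: integral_ge0 => x _; rewrite lee_fin mulr_ge0.
have amgm (t : R) : 0 < t -> (2%:E * P <= (t * a + b / t)%:E)%E.
  move=> t0; rewrite -ge0_integralZl_EFin//; last 2 first.
  - by move=> x _; rewrite lee_fin mulr_ge0.
  - exact/measurable_EFinP/measurable_funM.
  apply: (@le_trans _ _ (\int[mu]_x (t%:E * (f x ^+ 2)%:E + t^-1%:E * (g x ^+ 2)%:E))%E).
    apply: ge0_le_integral => //.
    - by move=> x _; rewrite lee_fin !mulr_ge0.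
    - apply: measurable_funeM; exact/measurable_EFinP/measurable_funM.
    - by apply: emeasurable_funD; apply: measurable_funeM; exact: m2.
    - move=> x _; rewrite -!EFinM -EFinD lee_fin -subr_ge0.
      have -> : t * f x ^+ 2 + t^-1 * g x ^+ 2 - 2 * (f x * g x) =
          t^-1 * (t * f x - g x) ^+ 2 by field; rewrite gt_eqF.
      by rewrite mulr_ge0 ?sqr_ge0// invr_ge0 ltW.
  rewrite ge0_integralD//; last 4 first.
  - by move=> x _; rewrite mule_ge0// lee_fin ?sqr_ge0 ?ltW.
  - by apply: measurable_funeM; exact: m2.
  - by move=> x _; rewrite mule_ge0// lee_fin ?sqr_ge0 ?invr_ge0 ?ltW.
  - by apply: measurable_funeM; exact: m2.
  rewrite !ge0_integralZl_EFin ?invr_ge0 ?(ltW t0)//; [|by move=> x _; rewrite lee_fin sqr_ge0|exact: m2|by move=> x _; rewrite lee_fin sqr_ge0|exact: m2].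
  rewrite EFinD !EFinM [(b%:E * _)%E]muleC leeD// lee_pmul2l// ?lte_fin ?invr_gt0//.
have Pfin : P \is a fin_num.
  rewrite ge0_fin_numE// ltNge leye_eq; apply/negP => /eqP Py.
  by have := amgm 1 ltr01; rewrite Py mulry gtr0_sg// mul1e leye_eq.
have [p PE] : exists p, P = p%:E by exists (fine P); rewrite fineK.
move: P0 amgm; rewrite PE !lee_fin => p0 amgm.
rewrite -(ger0_norm p0) -sqrtr_sqr ler_wsqrtr//.
have h t : 0 < t -> 2 * p <= t * a + b / t by move=> /amgm; rewrite -EFinM lee_fin.
have [->|pn0] := eqVneq p 0; first by rewrite expr0n/= mulr_ge0.
have {pn0}p0 : 0 < p by rewrite lt_neqAle eq_sym pn0.
have [a00|an0] := eqVneq a 0.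
  have [b00|bn0] := eqVneq b 0.
    by have := h 1 ltr01; rewrite a00 b00 !mulr0 add0r mul0r; lra.
  have bp : 0 < b by rewrite lt_neqAle eq_sym bn0.
  have := h (b / p) (divr_gt0 bp p0).
  have -> : b / (b / p) = p by field; rewrite !gt_eqF.
  by rewrite a00 mulr0; lra.
have ap : 0 < a by rewrite lt_neqAle eq_sym an0.
have := h (p / a) (divr_gt0 p0 ap).
have -> : p / a * a + b / (p / a) = p + a * b / p by field; rewrite !gt_eqF.
rewrite mulr2n mulrDl !mul1r lerD2l ler_pdivlMr//.
Qed.

Lemma L2norm_ge0 F : 0 <= L2norm mu F.
Proof. exact: sqrtr_ge0. Qed.

Lemma L2normE F : L2 mu F ->
  (\int[mu]_x (nrm (F x) ^+ 2)%:E = (L2norm mu F ^+ 2)%:E)%E.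
Proof.
move=> [mF Foo]; rewrite sqr_sqrtr; last by apply: Rintegral_ge0 => x _; exact: sqr_ge0.
rewrite /Rintegral fineK// ge0_fin_numE//.
by apply: integral_ge0 => x _; rewrite lee_fin sqr_ge0.
Qed.

Lemma L2norm_le F (a : R) : 0 <= a -> L2 mu F ->
  (\int[mu]_x (nrm (F x) ^+ 2)%:E <= (a ^+ 2)%:E)%E -> L2norm mu F <= a.
Proof.
by move=> a0 /L2normE ->; rewrite lee_fin ler_sqr ?nnegrE ?L2norm_ge0.
Qed.

Lemma L2_cintegrableM F G : L2 mu F -> L2 mu G ->
  cintegrable mu (fun x => F x * G x) /\
  nrm (cintegral mu (fun x => F x * G x)) <= L2norm mu F * L2norm mu G.
Proof.
move=> LF LG.
have mFG : cmeasurable (fun x => F x * G x) by apply: cmeasurableM; [case: LF|case: LG].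
have FG : (\int[mu]_x (nrm (F x * G x))%:E <= (L2norm mu F * L2norm mu G)%:E)%E.
  under eq_integral do rewrite nrmM.
  have -> : L2norm mu F * L2norm mu G = Num.sqrt (L2norm mu F ^+ 2 * L2norm mu G ^+ 2).
    by rewrite -exprMn sqrtr_sqr ger0_norm// mulr_ge0 ?L2norm_ge0.
  apply: integral_cauchy_schwarz.
  - by apply: measurable_nrm; case: LF.
  - by apply: measurable_nrm; case: LG.
  - by move=> x; exact: nrm_ge0.
  - by move=> x; exact: nrm_ge0.
  - by rewrite L2normE.
  - by rewrite L2normE.
split; first by apply/cintegrableP; split => //; exact: le_lt_trans FG (ltry _).
by rewrite -lee_fin; apply: le_trans (nrm_cintegral_le mFG) FG.
Qed.

Lemma L2J F : L2 mu F -> L2 mu (fun x => conjc (F x)).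
Proof.
move=> [mF Foo]; split; first exact: cmeasurableJ.
by under eq_integral do rewrite nrmJ.
Qed.

Lemma L2normJ F : L2norm mu (fun x => conjc (F x)) = L2norm mu F.
Proof. by rewrite /L2norm; under eq_Rintegral do rewrite nrmJ. Qed.

Lemma L2_lin_le c F G : L2 mu F -> L2 mu G ->
  (\int[mu]_x (nrm (c * F x + G x) ^+ 2)%:E <=
    (2 * nrm c ^+ 2 * L2norm mu F ^+ 2 + 2 * L2norm mu G ^+ 2)%:E)%E.
Proof.
move=> LF LG.
have [mF _] := LF; have [mG _] := LG.
have m2 K : cmeasurable K -> measurable_fun setT (fun x => (nrm (K x) ^+ 2)%:E).
  by move=> mK; apply/measurable_EFinP/measurable_funX/measurable_nrm.
apply: (@le_trans _ _ (\int[mu]_x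
    ((2 * nrm c ^+ 2)%:E * (nrm (F x) ^+ 2)%:E + 2%:E * (nrm (G x) ^+ 2)%:E))%E).
  apply: ge0_le_integral => //.
  - by move=> x _; rewrite lee_fin sqr_ge0.
  - by apply: m2; apply: cmeasurableD => //; apply: cmeasurableM => //; exact: cmeasurable_cst.
  - by apply: emeasurable_funD; apply: measurable_funeM; exact: m2.
  - move=> x _; rewrite -!EFinM -EFinD lee_fin.
    have h : nrm (c * F x + G x) <= nrm c * nrm (F x) + nrm (G x).
      by rewrite -nrmM nrmD.
    apply: (@le_trans _ _ ((nrm c * nrm (F x) + nrm (G x)) ^+ 2)).
      by rewrite ler_sqr ?nnegrE ?nrm_ge0 ?addr_ge0 ?mulr_ge0 ?nrm_ge0.
    rewrite -subr_ge0; set p := nrm c; set q := nrm (F x); set r := nrm (G x).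
    have -> : 2 * p ^+ 2 * q ^+ 2 + 2 * r ^+ 2 - (p * q + r) ^+ 2 = (p * q - r) ^+ 2 by ring.
    exact: sqr_ge0.
have p0 : 0 <= 2 * nrm c ^+ 2 by rewrite mulr_ge0 ?sqr_ge0.
rewrite ge0_integralD//; last 4 first.
- by move=> x _; rewrite mule_ge0// lee_fin sqr_ge0.
- by apply: measurable_funeM; exact: m2.
- by move=> x _; rewrite mule_ge0// lee_fin sqr_ge0.
- by apply: measurable_funeM; exact: m2.
rewrite !ge0_integralZl_EFin//; [|by move=> x _; rewrite lee_fin sqr_ge0|exact: m2|by move=> x _; rewrite lee_fin sqr_ge0|exact: m2].
by rewrite !L2normE.
Qed.

Lemma L2_lin c F G : L2 mu F -> L2 mu G -> L2 mu (fun x => c * F x + G x).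
Proof.
move=> LF LG; have [mF _] := LF; have [mG _] := LG.
split; last exact: le_lt_trans (L2_lin_le c LF LG) (ltry _).
by apply: cmeasurableD => //; apply: cmeasurableM => //; exact: cmeasurable_cst.
Qed.

Lemma L2Z c F : L2 mu F -> L2 mu (fun x => c * F x).
Proof.
move=> LF; have L0 : L2 mu (fun _ => 0).
  split; first exact: cmeasurable_cst.
  by under eq_integral do rewrite nrm0 expr0n/=; rewrite integral0.
have := L2_lin c LF L0.
by congr (L2 mu _); apply/funext => x; rewrite addr0.
Qed.

Lemma L2B F G : L2 mu F -> L2 mu G -> L2 mu (fun x => F x - G x).
Proof.
move=> LF LG; have := L2_lin (-1) LG LF.
by congr (L2 mu _); apply/funext => x; rewrite mulN1r addrC.
Qed.

End complex_integral_theory.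

(** * Frames over a measure space *)

Section operators.
Context (R : realType) (H : completeNormedModType R[i]) (ip : H -> H -> R[i]).
Hypothesis hH : hilbert_space ip.

Lemma coercive_surjective (S : H -> H) (c C : R) :
  (forall a f g, S (a *: f + g) = a *: S f + S g) ->
  (forall f g, ip (S f) g = ip f (S g)) ->
  0 < c -> (forall f, c * nrm f ^+ 2 <= complex.Re (ip (S f) f)) ->
  (forall f, nrm (S f) <= C * nrm f) ->
  forall y, exists h, S h = y.
Proof.
move=> Slin Ssym c0 Sc SC y.
have [|||||h hP] := @lax_milgram _ _ (fun f g => ip (S f) g) (fun f => ip f y) c C (nrm y) _ _ c0 Sc.
- by move=> a f g h; rewrite Slin (ip_linear hH).
- by move=> f g; rewrite Ssym (ip_conj hH).
- move=> f g; apply: le_trans (cauchy_schwarz hH _ _) _.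
  by rewrite ler_wpM2r ?nrm_ge0.
- by move=> a f g; rewrite (ip_linear hH).
- by move=> f; rewrite mulrC; exact: cauchy_schwarz.
exists h; apply: (ip_ext hH) => g.
by rewrite (ip_conj hH g) -Ssym -hP -(ip_conj hH).
Qed.

(** [L = 1 - z B] is bounded below by [k], but it is not self-adjoint for non-real [z], so
    [lax_milgram] is applied to the form [ip (L f) (L g)]. Its solution [h] makes [w = L h - y]
    orthogonal to the range of [L], that is [w] lies in the kernel of the adjoint [1 - conjc z B].
    The adjoint has the same lower bound, hence [w = 0]. *)
Lemma resolvent_exists (B : H -> H) (q : R) (z : R[i]) :
  (forall a f g, B (a *: f + g) = a *: B f + B g) ->
  (forall f g, ip (B f) g = ip f (B g)) ->
  0 <= q -> (forall f, nrm (B f) <= q * nrm f) -> nrm z * q < 1 ->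
  exists T : H -> H,
    (forall f, T (f - z *: B f) = f) /\ (forall f, T f - z *: B (T f) = f).
Proof.
move=> Blin Bsym q0 Bq zq.
pose k := 1 - nrm z * q.
have k0 : 0 < k by rewrite subr_gt0.
have lowb (w : R[i]) f : nrm w = nrm z -> k * nrm f <= nrm (f - w *: B f).
  move=> wz; have := nrmD (f - w *: B f) (w *: B f).
  rewrite subrK nrmZ wz => h.
  have := ler_wpM2l (nrm_ge0 z) (Bq f); rewrite /k; lra.
pose L f := f - z *: B f.
have Llin a f g : L (a *: f + g) = a *: L f + L g.
  rewrite /L Blin [in RHS]scalerBr scalerDr opprD addrACA; congr (_ - _ + _).
  by rewrite !scalerA mulrC.
have LC f : nrm (L f) <= (1 + nrm z * q) * nrm f.
  apply: le_trans (nrmD _ _) _; rewrite nrmN nrmZ mulrDl mul1r lerD2l -mulrA.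
  by rewrite ler_wpM2l ?nrm_ge0.
have Lsurj y : exists h, L h = y.
  have [|||||||h hP] := @lax_milgram _ _ (fun f g => ip (L f) (L g))
    (fun f => ip (L f) y) (k ^+ 2) ((1 + nrm z * q) ^+ 2) ((1 + nrm z * q) * nrm y).
  - by move=> a f g h; rewrite Llin (ip_linear hH).
  - by move=> f g; rewrite (ip_conj hH).
  - exact: exprn_gt0.
  - move=> f; rewrite (ipff hH)/= -exprMn ler_sqr ?nnegrE ?nrm_ge0 ?mulr_ge0 ?nrm_ge0 ?(ltW k0)//.
    exact: lowb.
  - move=> f g; apply: le_trans (cauchy_schwarz hH _ _) _.
    have -> : (1 + nrm z * q) ^+ 2 * nrm f * nrm g =
      (1 + nrm z * q) * nrm f * ((1 + nrm z * q) * nrm g) by ring.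
    by apply: ler_pM; rewrite ?nrm_ge0 ?LC.
  - by move=> a f g; rewrite Llin (ip_linear hH).
  - move=> f; apply: le_trans (cauchy_schwarz hH _ _) _.
    by rewrite [leRHS]mulrAC ler_wpM2r ?nrm_ge0.
  exists h; apply/eqP; rewrite -subr_eq0; apply/eqP.
  set w := L h - y.
  have w0 : w - conjc z *: B w = 0.
    apply: (ip_ext0 hH) => g.
    have := hP g => /esym/eqP; rewrite -subr_eq0 -(ipBr hH) -/w => /eqP.
    rewrite (ipBl hH) (ipZl hH) (ipBl hH) (ipZl hH) Bsym => h0.
    by rewrite (ip_conj hH g w) (ip_conj hH g (B w)) -rmorphM -rmorphB/= h0 conjc0.
  have := lowb (conjc z) w (nrmJ z); rewrite w0 nrm0 pmulr_rle0// => w00.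
  by apply/nrm_eq0/le_anti; rewrite w00 nrm_ge0.
have /choice[T LT] := Lsurj.
exists T; split=> // f; apply/eqP; rewrite -subr_eq0; apply/eqP/nrm_eq0/le_anti.
rewrite nrm_ge0 andbT -(pmulr_rle0 _ k0).
have -> : 0 = nrm (L (T (f - z *: B f) - f)); last exact: lowb.
rewrite -[_ - f]addrC -[- f]scaleN1r Llin LT -/(L f) scaleN1r addNr nrm0//.
Qed.

End operators.

Section frames.
Context (R : realType) (H : completeNormedModType R[i]) (ip : H -> H -> R[i]).
Hypothesis hH : hilbert_space ip.
Context d (T : measurableType d) (mu : {measure set T -> \bar R}) (psi : T -> H).
Hypothesis mpsi : forall f, cmeasurable (fun x => ip f (psi x)).
Variables (C1 C2 : R).
Hypotheses (C1_gt0 : 0 < C1) (C2_gt0 : 0 < C2).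
Hypothesis frame_bounds : forall f, ((C1 * nrm f ^+ 2)%:E <=
  \int[mu]_x ((nrm (ip f (psi x)) ^+ 2)%:E) <= (C2 * nrm f ^+ 2)%:E)%E.

Definition analysis (f : H) : T -> R[i] := fun x => ip f (psi x).
Local Notation V := analysis.

(** The adjoint of [analysis], defined weakly in the same form as [frame_op], so that
    [frame_op_synthesis] holds by computation. *)
Definition synthesis (F : T -> R[i]) : H :=
  get [set h | forall g, ip h g = cintegral mu (fun x => F x * ip (psi x) g)].

Local Notation S := (frame_op ip mu psi).

Lemma L2_analysis f : L2 mu (V f).
Proof.
split; first exact: mpsi.
by have /andP[_] := frame_bounds f; move/le_lt_trans; apply; exact: ltry.
Qed.

Lemma L2norm_analysis_ge f : C1 * nrm f ^+ 2 <= L2norm mu (V f) ^+ 2.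
Proof.
by have /andP[+ _] := frame_bounds f; rewrite (L2normE (L2_analysis f)) lee_fin.
Qed.

Lemma L2norm_analysis_le f : L2norm mu (V f) <= Num.sqrt C2 * nrm f.
Proof.
rewrite -ler_sqr ?nnegrE ?L2norm_ge0 ?mulr_ge0 ?sqrtr_ge0 ?nrm_ge0//.
rewrite exprMn [Num.sqrt C2 ^+ 2]sqr_sqrtr ?(ltW C2_gt0)// -lee_fin -L2normE; last exact: L2_analysis.
by have /andP[] := frame_bounds f.
Qed.

Lemma analysisJ f x : ip (psi x) f = conjc (V f x).
Proof. by rewrite (ip_conj hH). Qed.

Lemma synthesis_integrable F g : L2 mu F ->
  cintegrable mu (fun x => F x * ip (psi x) g) /\
  nrm (cintegral mu (fun x => F x * ip (psi x) g)) <= L2norm mu F * L2norm mu (V g).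
Proof.
move=> LF; have := L2_cintegrableM LF (L2J (L2_analysis g)).
by rewrite L2normJ; under eq_fun do rewrite -analysisJ.
Qed.

(** Riesz representation, obtained from [lax_milgram] for the form [ip] itself. The functional is
    conjugated because the vector sought stands in the first slot, while [lax_milgram] produces one
    in the second. *)
Lemma synthesisP F : L2 mu F ->
  forall g, ip (synthesis F) g = cintegral mu (fun x => F x * ip (psi x) g).
Proof.
move=> LF.
suff [h hP] : exists h, forall g, ip h g = cintegral mu (fun x => F x * ip (psi x) g).
  exact: (@getPex _ [set h | forall g, ip h g = cintegral mu (fun x => F x * ip (psi x) g)]
    (ex_intro _ h hP)).
pose phi g := conjc (cintegral mu (fun x => F x * ip (psi x) g)).
have [||||h hP] := @lax_milgram _ _ ip phi 1 1 (Num.sqrt C2 * L2norm mu F)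
   (ip_linear hH) (ip_conj hH) ltr01.
- by move=> f; rewrite (ipff hH)/= mul1r.
- by move=> f g; rewrite mul1r; exact: cauchy_schwarz.
- move=> a f g; rewrite /phi -[in RHS](conjcK a) -rmorphM -rmorphD/= -cintegralZ; last first.
    by have [] := synthesis_integrable f LF.
  rewrite -cintegralD; last 2 first.
  - by apply: cintegrableZ; have [] := synthesis_integrable f LF.
  - by have [] := synthesis_integrable g LF.
  congr (conjc (cintegral _ _)); apply/funext => x.
  by rewrite (ipDr hH) (ipZr hH) mulrDr mulrCA.
- move=> f; rewrite nrmJ; have [_ h] := synthesis_integrable f LF; apply: le_trans h _.
  rewrite [X in _ <= X * _]mulrC -mulrA.
  by apply: ler_wpM2l; [exact: L2norm_ge0|exact: L2norm_analysis_le].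
by exists h => g; rewrite (ip_conj hH) -hP conjcK.
Qed.

Lemma nrm_synthesis_le F : L2 mu F -> nrm (synthesis F) <= Num.sqrt C2 * L2norm mu F.
Proof.
move=> LF; apply: (nrm_le_ip hH); first by rewrite mulr_ge0 ?sqrtr_ge0 ?L2norm_ge0.
move=> g; rewrite synthesisP//.
have [_ h] := synthesis_integrable g LF; apply: le_trans h _.
rewrite [X in _ <= X * _]mulrC -mulrA; apply: ler_wpM2l; first exact: L2norm_ge0.
exact: L2norm_analysis_le.
Qed.

Lemma synthesis_lin a F G : L2 mu F -> L2 mu G ->
  synthesis (fun x => a * F x + G x) = a *: synthesis F + synthesis G.
Proof.
move=> LF LG; apply: (ip_ext hH) => g.
rewrite synthesisP; last exact: L2_lin.
rewrite (ip_linear hH) !synthesisP// -cintegralZ; last by have [] := synthesis_integrable g LF.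
rewrite -cintegralD; last 2 first.
- by apply: cintegrableZ; have [] := synthesis_integrable g LF.
- by have [] := synthesis_integrable g LG.
by congr cintegral; apply/funext => x; rewrite mulrDl mulrA.
Qed.

Lemma frame_op_synthesis f : S f = synthesis (V f). Proof. by []. Qed.

Lemma analysis_lin a f g : V (a *: f + g) = fun x => a * V f x + V g x.
Proof. by apply/funext => x; rewrite /V (ip_linear hH). Qed.

Lemma frame_op_lin a f g : S (a *: f + g) = a *: S f + S g.
Proof.
by rewrite !frame_op_synthesis analysis_lin synthesis_lin//; exact: L2_analysis.
Qed.

Lemma frame_opE f g : ip (S f) g = cintegral mu (fun x => V f x * conjc (V g x)).
Proof.
rewrite frame_op_synthesis synthesisP; last exact: L2_analysis.
by congr cintegral; apply/funext => x; rewrite analysisJ.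
Qed.

Lemma frame_op_sym f g : ip (S f) g = ip f (S g).
Proof.
rewrite [RHS](ip_conj hH) !frame_opE -cintegralJ; last first.
  by have [] := L2_cintegrableM (L2_analysis g) (L2J (L2_analysis f)).
by congr cintegral; apply/funext => x; rewrite rmorphM/= conjcK mulrC.
Qed.

Lemma frame_opff f : ip (S f) f = (L2norm mu (V f) ^+ 2)%:C.
Proof.
rewrite frame_opE; apply: complex_ext => /=.
  rewrite sqr_sqrtr; last by apply: Rintegral_ge0 => x _; exact: sqr_ge0.
  by congr Rintegral; apply/funext => x; rewrite conjc_mul_nrm.
rewrite (_ : (fun _ => _) = fun _ => 0); first by rewrite /Rintegral integral0.
by apply/funext => x; rewrite conjc_mul_nrm.
Qed.

Lemma frame_op_coercive f : C1 * nrm f ^+ 2 <= complex.Re (ip (S f) f).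
Proof. by rewrite frame_opff/=; exact: L2norm_analysis_ge. Qed.

(** [contraction_le] compares this square with [L2norm mu (V f) ^+ 2], so the latter is kept and not
    replaced by its bound in terms of [nrm f]. *)
Lemma sqr_nrm_frame_op_le f : nrm (S f) ^+ 2 <= C2 * L2norm mu (V f) ^+ 2.
Proof.
rewrite -[C2 in leRHS]sqr_sqrtr ?(ltW C2_gt0)// -exprMn.
rewrite ler_sqr ?nnegrE ?nrm_ge0 ?mulr_ge0 ?sqrtr_ge0//.
by apply: nrm_synthesis_le; exact: L2_analysis.
Qed.

Lemma nrm_frame_op_le f : nrm (S f) <= C2 * nrm f.
Proof.
apply: le_trans (nrm_synthesis_le (L2_analysis f)) _.
rewrite -[C2 in leRHS]sqr_sqrtr ?(ltW C2_gt0)// expr2 -mulrA ler_wpM2l ?sqrtr_ge0//.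
exact: L2norm_analysis_le.
Qed.

Lemma frame_op_bijective : set_bij [set: H] [set: H] S.
Proof.
split=> //.
- move=> f g _ _ Sfg; apply/eqP; rewrite -subr_eq0; apply/eqP/nrm_eq0/eqP.
  have := frame_op_coercive (f - g).
  have -> : S (f - g) = 0 by rewrite addrC -scaleN1r frame_op_lin Sfg scaleN1r addNr.
  by rewrite (ip0l hH)/= pmulr_rle0// => h; rewrite -sqrf_eq0 eq_le h sqr_ge0.
- move=> y _.
  have [h <-] := @coercive_surjective _ _ _ hH S C1 C2 frame_op_lin frame_op_sym
    C1_gt0 frame_op_coercive nrm_frame_op_le y.
  by exists h.
Qed.

Local Notation Sinv := (op_inv S).

Lemma frame_opK f : Sinv (S f) = f.
Proof.
have [_ inj _] := frame_op_bijective.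
by rewrite /op_inv; apply: (pinvKV _ inj); exact: mem_set.
Qed.

Lemma frame_opVK f : S (Sinv f) = f.
Proof.
have [_ _ sur] := frame_op_bijective.
by have [h _ <-] := sur f I; rewrite frame_opK.
Qed.

Lemma frame_opV_sym f g : ip (Sinv f) g = ip f (Sinv g).
Proof. by rewrite -[in LHS](frame_opVK g) -frame_op_sym frame_opVK. Qed.

Lemma nrm_frame_opV_le f : nrm (Sinv f) <= C1^-1 * nrm f.
Proof.
have [->|f0] := eqVneq (nrm (Sinv f)) 0.
  by rewrite mulr_ge0 ?nrm_ge0// invr_ge0 ltW.
have fp : 0 < nrm (Sinv f) by rewrite lt_neqAle eq_sym f0 nrm_ge0.
rewrite mulrC ler_pdivlMr//.
have := frame_op_coercive (Sinv f); rewrite frame_opVK => h.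
rewrite -(ler_pM2r fp).
have -> : nrm (Sinv f) * C1 * nrm (Sinv f) = C1 * nrm (Sinv f) ^+ 2 by ring.
apply: le_trans h _; apply: le_trans (ler_norm _) _; apply: le_trans (Re_le_nrm _) _.
exact: cauchy_schwarz.
Qed.

Lemma frame_kernelJ x y :
  frame_kernel ip mu psi y x = conjc (frame_kernel ip mu psi x y).
Proof. by rewrite /frame_kernel -(ip_conj hH) -frame_opV_sym. Qed.

Lemma frame_kernelE x y : frame_kernel ip mu psi x y = conjc (V (Sinv (psi x)) y).
Proof. by rewrite /frame_kernel /V (ip_conj hH). Qed.

Lemma L2_frame_kernel x : L2 mu (frame_kernel ip mu psi x).
Proof.
rewrite (_ : frame_kernel _ _ _ _ = fun y => conjc (V (Sinv (psi x)) y)).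
  by apply: L2J; exact: L2_analysis.
by apply/funext => y; exact: frame_kernelE.
Qed.

(** [ip f (psi x) = ip (S f) (Sinv (psi x))], and [S f] is the synthesis of [V f]. *)
Lemma frame_kernel_reproducing f x :
  V f x = cintegral mu (fun y => V f y * frame_kernel ip mu psi x y).
Proof.
rewrite -[in LHS](frame_opK f) /V frame_opV_sym -/(V _ _) frame_op_synthesis.
by rewrite synthesisP//; exact: L2_analysis.
Qed.

Lemma nrm_frame_kernel_le (M : R) x y : (forall z, nrm (psi z) <= M) ->
  nrm (frame_kernel ip mu psi x y) <= M * (C1^-1 * M).
Proof.
move=> psiM; apply: le_trans (cauchy_schwarz hH _ _) _.
apply: ler_pM; rewrite ?nrm_ge0 ?psiM//; apply: le_trans (nrm_frame_opV_le _) _.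
by rewrite ler_wpM2l// invr_ge0 ltW.
Qed.

Definition contraction (f : H) : H := f - (C2^-1)%:C *: S f.

Lemma contraction_lin a f g :
  contraction (a *: f + g) = a *: contraction f + contraction g.
Proof.
rewrite /contraction frame_op_lin scalerBr scalerDr opprD addrACA; congr (_ - _ + _).
by rewrite !scalerA mulrC.
Qed.

Lemma contraction_sym f g : ip (contraction f) g = ip f (contraction g).
Proof.
by rewrite /contraction (ipBl hH) (ipBr hH) (ipZl hH) (ipZr hH) conjc_real frame_op_sym.
Qed.

(** In the expansion of the square, [nrm (S f) ^+ 2 / C2 ^ 2] absorbs half of the mixed term
    [- 2 / C2] times [L2norm mu (V f) ^+ 2]; the lower frame bound is applied to the other half. *)
Lemma contraction_le f : nrm (contraction f) <= Num.sqrt (1 - C1 / C2) * nrm f.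
Proof.
rewrite -ler_sqr ?nnegrE ?nrm_ge0 ?mulr_ge0 ?sqrtr_ge0 ?nrm_ge0// exprMn.
apply: (@le_trans _ _ ((1 - C1 / C2) * nrm f ^+ 2)); last first.
  (* On the zero space nothing forces [C1 <= C2]; the radicand may then be negative and its square
     root is zero. *)
  rewrite ler_wpM2r ?sqr_ge0//; have [h|h] := leP 0 (1 - C1 / C2).
    by rewrite sqr_sqrtr.
  exact: le_trans (ltW h) (sqr_ge0 _).
have E : nrm (contraction f) ^+ 2 =
    nrm f ^+ 2 - 2 * C2^-1 * L2norm mu (V f) ^+ 2 + C2^-1 ^+ 2 * nrm (S f) ^+ 2.
  apply: complexI; rewrite -(ipff hH) /contraction (ipBl hH) !(ipBr hH) !(ipZl hH) !(ipZr hH).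
  rewrite conjc_real -(frame_op_sym f f) frame_opff !(ipff hH).
  rewrite -!(rmorphM, rmorphB, rmorphD)/=; congr (_%:C); ring.
rewrite E.
have h1 := L2norm_analysis_ge f; have h2 := sqr_nrm_frame_op_le f.
have i2 : 0 < C2^-1 by rewrite invr_gt0.
have h3 : C2^-1 ^+ 2 * nrm (S f) ^+ 2 <= C2^-1 * L2norm mu (V f) ^+ 2.
  rewrite expr2 -mulrA ler_pM2l// mulrC ler_pdivrMr// mulrC//.
have h4 : C1 / C2 * nrm f ^+ 2 <= C2^-1 * L2norm mu (V f) ^+ 2.
  by rewrite [C1 / C2]mulrC -mulrA ler_pM2l.
lra.
Qed.

Lemma contraction_factor_lt1 : Num.sqrt (1 - C1 / C2) < 1.
Proof.
rewrite -[ltRHS]sqrtr1 ltr_sqrt// ltrBlDr ltrDl divr_gt0//.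
Qed.

End frames.

(** * Algebras of matrices *)

Section kernel_algebra.
Context (R : realType) d (T : measurableType d) (mu : {measure set T -> \bar R}).
Variable (A : kernel_space R T).
Hypothesis bA : banach_star_algebra mu A.
Implicit Types K L : ckernel R T.

Lemma bsa_sub K L : A K -> A L -> A (ksub K L).
Proof. by move=> AK AL; apply: (bsa_add bA) => //; exact: (bsa_scale bA). Qed.

Lemma bsa_norm_sub K L : A K -> A L -> knorm A (ksub K L) <= knorm A K + knorm A L.
Proof.
move=> AK AL; have ANL := bsa_scale bA (-1) AL.
apply: le_trans (bsa_norm_add bA AK ANL) _.
by rewrite lerD2l (bsa_norm_scale bA)// nrmN nrm1 mul1r.
Qed.

Lemma bsa_norm_subC K L : A K -> A L -> knorm A (ksub K L) = knorm A (ksub L K).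
Proof.
move=> AK AL; have -> : ksub K L = kscale (-1) (ksub L K).
  apply/funext => x; apply/funext => y; by rewrite /ksub /kadd /kscale !mulN1r opprD opprK addrC.
by rewrite (bsa_norm_scale bA) ?nrmN ?nrm1 ?mul1r//; exact: bsa_sub.
Qed.

Lemma bsa_norm_triangle M K L : A K -> A L -> A M ->
  knorm A (ksub K L) <= knorm A (ksub K M) + knorm A (ksub M L).
Proof.
move=> AK AL AM; have -> : ksub K L = kadd (ksub K M) (ksub M L).
  by apply/funext => x; apply/funext => y; rewrite /ksub /kadd /kscale !mulN1r addrA subrK.
by apply: (bsa_norm_add bA); exact: bsa_sub.
Qed.

Lemma bsa_norm_leD K L : A K -> A L -> knorm A K <= knorm A L + knorm A (ksub K L).
Proof.
move=> AK AL; have {1}-> : K = kadd L (ksub K L).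
  by apply/funext => x; apply/funext => y; rewrite /ksub /kadd /kscale mulN1r addrC subrK.
by apply: (bsa_norm_add bA) => //; exact: bsa_sub.
Qed.

Lemma bsa_norm0 : knorm A (@kzero R _ T) = 0.
Proof.
have -> : @kzero R _ T = kscale 0 (@kzero R _ T).
  by apply/funext => x; apply/funext => y; rewrite /kscale mul0r.
by rewrite (bsa_norm_scale bA) ?nrm0 ?mul0r//; exact: (bsa_zero bA).
Qed.

Lemma bsa_sum (f : nat -> ckernel R T) n : (forall k, A (f k)) ->
  A (fun x y => \sum_(k < n) f k x y) /\
  knorm A (fun x y => \sum_(k < n) f k x y) <= \sum_(k < n) knorm A (f k).
Proof.
move=> Af; elim: n => [|n [IH1 IH2]].
  have -> : (fun x y => \sum_(k < 0) f k x y) = @kzero R _ T.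
    by apply/funext => x; apply/funext => y; rewrite big_ord0.
  by rewrite big_ord0 bsa_norm0; split => //; exact: (bsa_zero bA).
have -> : (fun x y => \sum_(k < n.+1) f k x y) =
    kadd (fun x y => \sum_(k < n) f k x y) (f n).
  by apply/funext => x; apply/funext => y; rewrite big_ord_recr.
split; first exact: (bsa_add bA).
by rewrite big_ord_recr/=; apply: le_trans (bsa_norm_add bA IH1 (Af n)) _; rewrite lerD2r.
Qed.

End kernel_algebra.

Lemma kaeq_refl (R : realType) d (T : measurableType d)
    (mu : {measure set T -> \bar R}) (K : ckernel R T) : kaeq mu K K.
Proof.
exists set0; split => // [|z]; last by case.
rewrite /product_measure1; apply: integral0_eq => x _ /=.
by rewrite xsection0 measure0.
Qed.

Section discrete_algebra.
Context (R : realType) (I : pointedType)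
  (nu : {measure set (discrete_space I) -> \bar R}).
Hypothesis nu_atom : forall i : discrete_space I, (0 < nu [set i] < +oo)%E.
Local Notation J := (discrete_space I).

Lemma discrete_measurable_set (B : set J) : measurable B.
Proof. by []. Qed.

Lemma discrete_measurable_fun d (T : measurableType d) (f : J -> T) :
  measurable_fun setT f.
Proof. by []. Qed.

Lemma discrete_cmeasurable (f : J -> R[i]) : cmeasurable f.
Proof. by split; exact: discrete_measurable_fun. Qed.

Definition mass (i : J) : R := fine (nu [set i]).

Lemma massE i : nu [set i] = (mass i)%:E.
Proof.
by have /andP[h1 h2] := nu_atom i; rewrite fineK// ge0_fin_numE// ltW.
Qed.

Lemma mass_gt0 i : 0 < mass i.
Proof. by have /andP[h _] := nu_atom i; rewrite massE lte_fin in h. Qed.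

Lemma discrete_aeP (P : J -> Prop) : {ae nu, forall i, P i} -> forall i, P i.
Proof.
move=> [N [_ N0 PN]] i; apply: contrapT => Pi.
have : (nu [set i] <= nu N)%E.
  apply: le_measure; [exact: mem_set|exact: mem_set|].
  by move=> _ ->; exact: PN.
by rewrite N0 massE lee_fin leNgt mass_gt0.
Qed.

(** A null set containing [(i, j)] would have measure at least [mass i * mass j], which is
    positive. *)
Lemma discrete_ae2P (P : J * J -> Prop) :
  {ae (nu \x nu)%E, forall z, P z} -> forall z, P z.
Proof.
move=> [N [mN N0 PN]] [i j]; apply: contrapT => Pij.
have Nij : N (i, j) by exact: PN.
suff : (0 < (nu \x nu)%E N)%E by rewrite N0 ltxx.
rewrite /product_measure1.
apply: (@lt_le_trans _ _ (\int[nu]_(x in [set i]) (cst (nu [set j]) x))%E).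
  by rewrite integral_cst// !massE -EFinM lte_fin mulr_gt0// mass_gt0.
apply: (@le_trans _ _ (\int[nu]_(x in [set i]) (nu \o xsection N) x)%E).
  apply: ge0_le_integral => //.
  move=> _ /= ->; apply: le_measure; [exact: mem_set|exact: mem_set|].
  by move=> _ ->; rewrite /xsection/= inE.
by apply: ge0_subset_integral; do ?exact: discrete_measurable_set; do ?exact: discrete_measurable_fun.
Qed.

Lemma kaeq_eq K L : kaeq nu K L -> K = L.
Proof.
move=> KL; apply/funext => i; apply/funext => j.
exact: (discrete_ae2P KL (i, j)).
Qed.

Definition unit_vector (j : J) : J -> R[i] := fun i => (\1_[set j] i)%:C.

Lemma discrete_integral_indic (f : J -> \bar R) j :
  (\int[nu]_i (f i * (\1_[set j] i)%:E) = f j * (mass j)%:E)%E.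
Proof.
transitivity (\int[nu]_(i in [set j]) f j)%E.
  rewrite [RHS]integral_mkcond; apply: eq_integral => i _.
  rewrite patchE indicE; case: ifPn => [|]; last by rewrite mule0.
  by rewrite inE/= => ->; rewrite mule1.
by rewrite integral_cst// massE.
Qed.

Lemma L2_unit_vector j : L2 nu (unit_vector j) /\
  L2norm nu (unit_vector j) = Num.sqrt (mass j).
Proof.
have E : (\int[nu]_i (nrm (unit_vector j i) ^+ 2)%:E = (mass j)%:E)%E.
  under eq_integral => i _.
    rewrite /unit_vector nrm_real real_normK ?num_real//.
    rewrite (_ : (\1_[set j] i : R) ^+ 2 = 1 * \1_[set j] i) ?EFinM; last first.
      by rewrite indicE mul1r; case: (_ \in _); rewrite ?expr1n ?expr0n.
    over.
  by rewrite discrete_integral_indic mul1e.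
have L : L2 nu (unit_vector j).
  by split; [exact: discrete_cmeasurable|rewrite E ltry].
by split=> //; rewrite /L2norm /Rintegral E.
Qed.

Lemma kact_unit_vector K i j :
  kact nu K (unit_vector j) i = K i j * (mass j)%:C.
Proof.
have aux (f : J -> R) : \int[nu]_k (f k * \1_[set j] k) = f j * mass j.
  rewrite /Rintegral; under eq_integral do rewrite EFinM.
  by rewrite discrete_integral_indic.
apply: complex_ext => /=.
  rewrite [RHS](_ : _ = complex.Re (K i j) * mass j); last first.
    by case: (K i j) => a b /=; rewrite mulr0 subr0.
  rewrite -(aux (fun k => complex.Re (K i k))); congr Rintegral; apply/funext => k.
  by rewrite /unit_vector; case: (K i k) => a b /=; rewrite mul0r subr0 mulrC.
rewrite [RHS](_ : _ = complex.Im (K i j) * mass j); last first.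
  by case: (K i j) => a b /=; rewrite mulr0 add0r.
rewrite -(aux (fun k => complex.Im (K i k))); congr Rintegral; apply/funext => k.
by rewrite /unit_vector; case: (K i k) => a b /=; rewrite mul0r addr0 mulrC.
Qed.

Lemma L2norm_ge_entry F i : L2 nu F -> nrm (F i) ^+ 2 * mass i <= L2norm nu F ^+ 2.
Proof.
move=> LF; rewrite -lee_fin -L2normE// EFinM.
rewrite -(discrete_integral_indic (fun k => (nrm (F k) ^+ 2)%:E)).
apply: ge0_le_integral => //.
- by move=> k _; rewrite lee_fin mulr_ge0 ?sqr_ge0.
- move=> k _; rewrite -EFinM lee_fin ler_piMr ?sqr_ge0//.
Qed.

Section algebra.
Variable A : kernel_space R J.
Hypothesis admA : admissible_algebra nu A.
Let bA := adm_banach admA.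

Lemma L2_column K j : A K -> L2 nu (fun i => K i j).
Proof.
move=> AK; have [M hM] := adm_bounded admA.
have [_ LK _] := hM K _ AK (L2_unit_vector j).1.
have := L2Z ((mass j)^-1)%:C LK.
congr (L2 nu _); apply/funext => i; rewrite kact_unit_vector mulrC -mulrA -rmorphM/=.
by rewrite mulfV ?mulr1// gt_eqF// mass_gt0.
Qed.

(** Entries are continuous on the algebra, which is what allows a limit in norm to be identified
    entrywise. Test the action of [K] on [unit_vector j]: [|K i j| m_j sqrt m_i <= ||K e_j|| <= |M|
    ||K|| sqrt m_j], where [m] is the mass; the sign of [M] is unknown. *)
Lemma entry_bound i j : exists2 c : R, 0 <= c &
  forall K, A K -> nrm (K i j) <= c * knorm A K.
Proof.
have [M hM] := adm_bounded admA.
have mi := mass_gt0 i; have mj := mass_gt0 j.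
pose c := `|M| * Num.sqrt (mass j) / (Num.sqrt (mass i) * mass j).
exists c => [|K AK].
  by rewrite /c divr_ge0// mulr_ge0 ?sqrtr_ge0// ltW.
have [L1 L1n] := L2_unit_vector j.
have [_ LK nK] := hM K _ AK L1; rewrite L1n in nK.
have {}nK : L2norm nu (kact nu K (unit_vector j)) <= `|M| * knorm A K * Num.sqrt (mass j).
  apply: le_trans nK _; rewrite !ler_wpM2r ?sqrtr_ge0 ?ler_norm//.
  exact: (bsa_norm_ge0 bA).
have := L2norm_ge_entry i LK; rewrite kact_unit_vector nrmM nrm_real gtr0_norm//.
rewrite -[X in _ * X <= _](sqr_sqrtr (ltW mi)) -exprMn.
rewrite ler_sqr ?nnegrE ?mulr_ge0 ?nrm_ge0 ?sqrtr_ge0 ?(ltW mj)//.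
move=> /le_trans/(_ nK) h.
rewrite /c mulrAC ler_pdivlMr ?mulr_gt0 ?sqrtr_gt0//.
rewrite [X in _ <= X](_ : _ = `|M| * knorm A K * Num.sqrt (mass j)); last by ring.
rewrite [X in X <= _](_ : _ = nrm (K i j) * mass j * Num.sqrt (mass i))//.
by ring.
Qed.

(* A geometric bound on the increments makes [u] converge in the algebra, and
   entries depend continuously on the kernel. *)
Lemma geometric_limit_mem (u : nat -> ckernel R J) X (M a s : R) :
  0 <= s -> s < 1 -> (forall n, A (u n)) -> (forall n, knorm A (u n) <= M) ->
  (forall n, knorm A (ksub (u n.+1) (u n)) <= a * s ^+ n) ->
  (forall i j (e : R), 0 < e -> exists N, forall n, (N <= n)%N ->
     nrm (u n i j - X i j) < e) ->
  A X /\ knorm A X <= M.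
Proof.
move=> s0 s1 Au uM ua uX.
have k0 : 0 < 1 - s by rewrite subr_gt0.
have a0 : 0 <= a.
  by have := ua 0%N; rewrite expr0 mulr1; apply: le_trans; apply: (bsa_norm_ge0 bA); exact: (bsa_sub bA).
(* The bound is the exact geometric sum of the increments from [n] to [p + n - 1], so that the
   induction on [p] closes with an equality. *)
have step n p : knorm A (ksub (u (p + n)%N) (u n)) <= a / (1 - s) * (s ^+ n - s ^+ (p + n)).
  elim: p => [|p IH].
    have -> : ksub (u (0 + n)%N) (u n) = @kzero R _ J.
      by apply/funext => x; apply/funext => y; rewrite /ksub /kadd /kscale mulN1r subrr.
    by rewrite (bsa_norm0 bA) subrr mulr0.
  apply: le_trans (bsa_norm_triangle bA (Au _) (Au _) (Au (p + n)%N)) _.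
  apply: le_trans (lerD (ua _) IH) _.
  rewrite addSn exprS le_eqVlt; apply/orP; left; apply/eqP; field.
  by rewrite gt_eqF.
have step' n p : (n <= p)%N -> knorm A (ksub (u p) (u n)) <= a / (1 - s) * s ^+ n.
  move=> np; rewrite -(subnK np); apply: le_trans (step _ _) _.
  by rewrite ler_wpM2l ?divr_ge0 ?(ltW k0)// lerBlDr lerDl exprn_ge0.
have small (e : R) : 0 < e -> exists N, forall n, (N <= n)%N -> a / (1 - s) * s ^+ n < e.
  move=> e0; have : (a / (1 - s) * s ^+ n) @[n --> \oo] --> (0 : R).
    rewrite -[X in _ --> X](mulr0 (a / (1 - s))); apply: cvgM; first exact: cvg_cst.
    by apply: cvg_expr; rewrite ger0_norm.
  move=> /cvgr0_norm_lt/(_ e e0)[N _ hN]; exists N => n Nn.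
  by apply: le_lt_trans (ler_norm _) _; exact: hN.
have [e e0|K AK uK] := bsa_complete bA Au.
  have [N hN] := small (e / 2) (divr_gt0 e0 (ltr0n _ 2)).
  exists N => p q Np Nq; apply: le_lt_trans (bsa_norm_triangle bA (Au _) (Au _) (Au N)) _.
  rewrite (bsa_norm_subC bA (Au N))//.
  have := hN N (leqnn _); have := step' _ _ Np; have := step' _ _ Nq; lra.
have uK' (e : R) : 0 < e -> exists N, forall n, (N <= n)%N -> knorm A (ksub (u n) K) < e.
  move=> e0; have /cvgr0_norm_lt/(_ e e0)[N _ hN] := uK; exists N => n Nn.
  by apply: le_lt_trans (ler_norm _) _; exact: hN.
(* The limit supplied by completeness has the entries of [X], because norm convergence implies
   convergence of each entry by [entry_bound]. *)
have KX : K = X.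
  apply/funext => i; apply/funext => j; apply/eqP; rewrite -subr_eq0; apply/eqP/nrm_eq0/eqP.
  rewrite -normr_le0 ger0_norm ?nrm_ge0//; apply/ler_addgt0Pl => e e0; rewrite addr0.
  have [c c0 hc] := entry_bound i j.
  have e20 : 0 < e / 2 by rewrite divr_gt0.
  have [N1 hN1] := uX i j _ e20.
  have c1 : 0 < c + 1 by rewrite ltr_wpDl.
  have [N2 hN2] := uK' _ (divr_gt0 e20 c1).
  pose n := maxn N1 N2.
  apply: le_trans (nrm_distD (u n i j) _ _) _.
  have h1 := hN1 n (leq_maxl _ _); have h2 := hN2 n (leq_maxr _ _).
  have h3 := hc _ (bsa_sub bA (Au n) AK).
  have h4 : nrm (K i j - u n i j) <= c * knorm A (ksub (u n) K).
    by move: h3; rewrite /ksub /kadd /kscale mulN1r nrmBC.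
  have h5 : c * knorm A (ksub (u n) K) <= e / 2.
    apply: (@le_trans _ _ ((c + 1) * knorm A (ksub (u n) K))).
      by rewrite ler_wpM2r ?lerDl// (bsa_norm_ge0 bA)//; exact: (bsa_sub bA).
    by rewrite mulrC -ler_pdivlMr// ltW.
  lra.
rewrite -KX; split=> //; apply/ler_addgt0Pl => e e0.
have [N hN] := uK' e e0.
apply: le_trans (bsa_norm_leD bA AK (Au N)) _.
rewrite (bsa_norm_subC bA AK (Au N)) addrC; apply: lerD; last exact: uM.
by rewrite ltW// hN.
Qed.

End algebra.
End discrete_algebra.

(** * Resolvents of the Gram matrix *)

Section discrete_frame_algebra.
Context (R : realType) (I : pointedType)
  (nu : {measure set (discrete_space I) -> \bar R}).
Hypothesis nu_atom : forall i : discrete_space I, (0 < nu [set i] < +oo)%E.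
Local Notation J := (discrete_space I).
Context (H : completeNormedModType R[i]) (ip : H -> H -> R[i]).
Hypothesis hH : hilbert_space ip.
Variables (psi : J -> H) (C1 C2 : R).
Hypotheses (C1_gt0 : 0 < C1) (C2_gt0 : 0 < C2).
Hypothesis frame_bounds : forall f, ((C1 * nrm f ^+ 2)%:E <=
  \int[nu]_x ((nrm (ip f (psi x)) ^+ 2)%:E) <= (C2 * nrm f ^+ 2)%:E)%E.
Variable A : kernel_space R J.
Hypothesis specA : spectral_algebra nu A.
Let admA := specA.1.
Let bA := adm_banach admA.

Let mpsi f : cmeasurable (fun x : J => ip f (psi x)) := discrete_cmeasurable _.

Local Notation V := (analysis ip psi).
Local Notation S := (frame_op ip nu psi).
Local Notation synth := (synthesis ip nu psi).

(** For a bounded operator [T], this is the matrix through which [V T V^*] acts on [L2 nu]. *)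
Definition op_kernel (T : H -> H) : ckernel R J := fun i j => ip (T (psi j)) (psi i).
Local Notation G := (op_kernel id).

Hypothesis G_mem : A G.

Let VL2 f : L2 nu (V f) := L2_analysis mpsi frame_bounds f.

Let synthP F : L2 nu F ->
  forall g, ip (synth F) g = cintegral nu (fun x => F x * ip (psi x) g).
Proof. exact: (synthesisP hH mpsi C2_gt0 frame_bounds). Qed.

Let synth_lin a F G : L2 nu F -> L2 nu G ->
  synth (fun x => a * F x + G x) = a *: synth F + synth G.
Proof. exact: (synthesis_lin hH mpsi C2_gt0 frame_bounds). Qed.

Lemma kact_gram F : L2 nu F -> kact nu G F = V (synth F).
Proof. by move=> LF; apply/funext => i; rewrite /V synthP. Qed.

(** Between the two operators [V^* V = S] appears. The adjoint [T'] serves to free [psi k] from [T]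
    under the integral over [k], where it can be recognized as a synthesis. *)
Lemma kcomp_op_kernel (T T' U : H -> H) : (forall f g, ip (T f) g = ip f (T' g)) ->
  kcomp nu (op_kernel T) (op_kernel U) = op_kernel (fun f => T (S (U f))).
Proof.
move=> TT'; apply/funext => i; apply/funext => j.
rewrite /op_kernel TT' (synthP (VL2 _)).
by congr cintegral; apply/funext => k; rewrite mulrC TT'.
Qed.

Lemma kcomp_gram K i j : A K ->
  kcomp nu G K i j = V (synth (fun k => K k j)) i.
Proof.
move=> AK; rewrite -(kact_gram (L2_column nu_atom admA j AK)).
by congr cintegral; apply/funext => k; rewrite mulrC.
Qed.

Lemma kstar_gram : kstar G = G.
Proof. by apply/funext => i; apply/funext => j; rewrite /kstar /op_kernel -(ip_conj hH). Qed.

Section resolvent.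
Variables (lam : R[i]) (T : H -> H).
Hypothesis lam0 : lam != 0.
Hypothesis TK : forall f, T (S f - lam *: f) = f.
Hypothesis KT : forall f, S (T f) - lam *: T f = f.

Let Slin a f g : S (a *: f + g) = a *: S f + S g :=
  frame_op_lin hH mpsi C2_gt0 frame_bounds a f g.

Let Tlin a f g : T (a *: f + g) = a *: T f + T g.
Proof.
rewrite -[RHS]TK Slin; congr T.
rewrite -[in LHS](KT f) -[in LHS](KT g) !scalerDr scalerN opprD addrACA !scalerA.
by rewrite [lam * a]mulrC.
Qed.

(* The resolvent of the Gram operator is [lam^-1 (V T V^* - 1)]. *)
Lemma resolvent_bounded (tau : R) : (forall f, nrm (T f) <= tau * nrm f) ->
  ~ op_spectrum nu (kact nu G) lam.
Proof.
move=> Ttau; apply; have nlam : nrm lam != 0 by apply: contra_neq lam0; exact: nrm_eq0.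
pose W F : J -> R[i] := fun i => - lam^-1 * F i + V (lam^-1 *: T (synth F)) i.
have VZ c h i : V (c *: h) i = c * V h i by rewrite /V (ipZl hH).
have LW F : L2 nu F -> L2 nu (W F) by move=> LF; apply: L2_lin => //; exact: VL2.
exists W; last first.
  move=> F LF.
  have LGF : L2 nu (kact nu G F) by rewrite kact_gram//; exact: VL2.
  split; apply: aeW => i.
    rewrite /W; have -> : synth (fun x => kact nu G F x - lam * F x) =
        S (synth F) - lam *: synth F.
      rewrite frame_op_synthesis -(kact_gram LF) -scaleNr addrC -(synth_lin _ LF LGF).
      by congr synthesis; apply/funext => x; rewrite mulNr addrC.
    rewrite TK kact_gram// VZ mulrBr mulNr [- (_ * _) - _]addrC mulNr opprK mulrA mulVf// mul1r.
    by rewrite subrK.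
  have -> : kact nu G (W F) i = V (T (synth F)) i.
    rewrite (kact_gram (LW _ LF)) (synth_lin _ LF (VL2 _)).
    rewrite -frame_op_synthesis -[lam^-1 *: T _]addr0 Slin.
    have S0 : S 0 = 0 by have := Slin (-1) 0 0; rewrite scaler0 addr0 scaleN1r addNr.
    rewrite S0 addr0 scaleNr addrC -scalerBr.
    have -> : S (T (synth F)) - synth F = lam *: T (synth F).
      by rewrite -[X in _ - X](KT (synth F)) opprB addrCA subrr addr0.
    by rewrite scalerA mulVf// scale1r.
  by rewrite /W VZ mulrDr mulrA mulrN mulfV// !mulrA mulfV// mulN1r mul1r opprD opprK addrCA subrr addr0.
split; first exact: LW.
- by move=> F G' LF LG /(discrete_aeP nu_atom) FG; apply: aeW => i; congr (W _ i); apply/funext.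
- move=> c F G' LF LG; apply: aeW => i.
  rewrite /W (synth_lin _ LF LG) Tlin scalerDr !VZ.
  by rewrite {1}/V (ipDl hH) -!/(V _ _) !VZ; ring.
(* [X] bounds the operator [lam^-1 V T V^*], each of [V] and [V^*] contributing [sqrt C2]; [M]
   collects the two terms of [L2_lin_le]. *)
- pose X := Num.sqrt C2 * (nrm lam^-1 * (`|tau| * Num.sqrt C2)).
  have X0 : 0 <= X by rewrite !mulr_ge0 ?sqrtr_ge0 ?nrm_ge0.
  pose M := Num.sqrt (2 * nrm (- lam^-1) ^+ 2 + 2 * X ^+ 2).
  have M2 : M ^+ 2 = 2 * nrm (- lam^-1) ^+ 2 + 2 * X ^+ 2.
    by rewrite sqr_sqrtr// addr_ge0// mulr_ge0// sqr_ge0.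
  exists M => F LF.
  apply: L2norm_le; [by rewrite mulr_ge0 ?sqrtr_ge0 ?L2norm_ge0|exact: LW|].
  apply: le_trans (L2_lin_le _ LF (VL2 _)) _; rewrite lee_fin.
  rewrite [leRHS]exprMn M2 [leRHS]mulrDl; apply: lerD => //.
  rewrite -[leRHS]mulrA ler_wpM2l// -exprMn.
  rewrite ler_sqr ?nnegrE ?(mulr_ge0 X0 (L2norm_ge0 _ _)) ?L2norm_ge0//.
  apply: le_trans (L2norm_analysis_le mpsi C2_gt0 frame_bounds _) _.
  rewrite /X -!mulrA ler_wpM2l ?sqrtr_ge0// nrmZ; apply: ler_wpM2l; first exact: nrm_ge0.
  apply: le_trans (Ttau _) _.
  apply: (@le_trans _ _ (`|tau| * nrm (synth F))).
    by rewrite ler_wpM2r ?nrm_ge0 ?ler_norm.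
  by rewrite ler_wpM2l// (nrm_synthesis_le hH mpsi C2_gt0 frame_bounds).
Qed.

Let analysis_column (K : ckernel R J) j (c e : R[i]) :
  A K -> c != 0 -> (forall i, c * K i j = V (synth (fun k => K k j)) i + e * V (psi j) i) ->
  forall i, K i j = V (c^-1 *: (synth (fun k => K k j) + e *: psi j)) i.
Proof.
move=> AK c0 hK i; rewrite /V (ipZl hH) (ipDl hH) (ipZl hH) -!/(V _ _) -hK.
by rewrite mulrA mulVf// mul1r.
Qed.

(* An inverse [L] of [G - lam] in the algebra is read off its equation: its
   columns lie in the range of [V], on which [T] inverts [S - lam]. *)
Lemma resolvent_mem (tau : R) : (forall f, nrm (T f) <= tau * nrm f) ->
  A (op_kernel T).
Proof.
move=> Ttau.
(* The equation makes column [j] of [K] equal to [V h], and then says [(S - lam) h = - e psi_j]. *)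
have key K (e : R[i]) : A K ->
    (forall i j, lam * K i j = kcomp nu G K i j + e * G i j) ->
    forall i j, K i j = - e * op_kernel T i j.
  move=> AK hK i j.
  have hV i' := analysis_column AK lam0 (fun i => etrans (hK i j) (congr1 (fun x => x + _) (kcomp_gram i j AK))) i'.
  set h := lam^-1 *: _ in hV.
  have synE : synth (fun k => K k j) = S h.
    by rewrite frame_op_synthesis; congr synthesis; apply/funext => k; exact: hV.
  have hE : lam *: h = S h + e *: psi j.
    by rewrite /h scalerA mulfV// scale1r -synE.
  have hT : h = - e *: T (psi j).
    rewrite -[LHS]TK -[S h](addrK (e *: psi j)) -hE addrAC subrr add0r.
    have T0 : T 0 = 0 by have := Tlin (-1) 0 0; rewrite scaler0 addr0 scaleN1r addNr.
    by rewrite -scaleNr -[_ *: psi j]addr0 Tlin T0 addr0.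
  by rewrite hV hT /V (ipZl hH).
have /contrapT : ~ alg_spectrum nu A G lam.
  rewrite specA.2 ?kstar_gram//; last exact: kaeq_refl.
  exact: resolvent_bounded Ttau.
(* Spectrality gives an inverse in the algebra. With a unit [E], the product [Z = L G] satisfies
   [lam Z = G Z - G], so [key] applies with [e = -1]. Without a unit, the inverse [(L, c)] in the
   unitization satisfies [lam L = G L + c G], and [c] is nonzero because [- lam c = 1]. *)
move=> [[E [L [[AE EU] AL /(kaeq_eq nu_atom) GL _]]]|[_ [L [c [AL lc /(kaeq_eq nu_atom) GL _]]]]].
  have AZ : A (kcomp nu L G) by exact: (bsa_comp bA).
  suff h i j : op_kernel T i j = kcomp nu L G i j.
    by rewrite (_ : op_kernel T = kcomp nu L G)//; apply/funext => i; apply/funext => j.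
  have [/(kaeq_eq nu_atom) EG _] := EU _ G_mem; have [/(kaeq_eq nu_atom) EZ _] := EU _ AZ.
  rewrite (key _ (-1) AZ) ?opprK ?mul1r// => {}i {}j.
  have AGE : A (ksub G (kscale lam E)) by apply: (bsa_sub bA) => //; exact: (bsa_scale bA).
  have /(kaeq_eq nu_atom) := bsa_compA bA AGE AL G_mem; rewrite GL ?EG//.
  move=> /(congr1 (fun K => K i j)).
  have /(discrete_ae2P nu_atom)/(_ (i, j))/= iGZ := bsa_comp_defined bA G_mem AZ.
  have /(discrete_ae2P nu_atom)/(_ (i, j))/= iEZ := bsa_comp_defined bA AE AZ.
  have -> : kcomp nu (ksub G (kscale lam E)) (kcomp nu L G) i j =
      kcomp nu G (kcomp nu L G) i j - lam * kcomp nu E (kcomp nu L G) i j.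
    rewrite /kcomp -cintegralZ// -cintegralB//; last exact: cintegrableZ.
    congr cintegral; apply/funext => k; rewrite /ksub /kadd /kscale mulN1r mulrDl mulNr mulrA.
    by [].
  rewrite EZ => <-; rewrite [X in _ = _ + X](_ : _ =
    - (kcomp nu G (kcomp nu L G) i j - lam * kcomp nu L G i j)); last exact: mulN1r.
  by rewrite opprB addrCA subrr addr0.
have c0 : c != 0 by apply: contra_eq_neq lc => ->; rewrite mulr0 eq_sym oner_eq0.
have h i j : L i j = - c * op_kernel T i j.
  apply: key => // {}i {}j.
  have := congr1 (fun K => K i j) GL; rewrite /kadd /kscale /kzero => /eqP.
  by rewrite addrA addr_eq0 mulNr opprK => /eqP ->.
rewrite (_ : op_kernel T = kscale (- c)^-1 L); first exact: (bsa_scale bA).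
apply/funext => i; apply/funext => j.
by rewrite /kscale h mulrA mulVf ?mul1r// oppr_eq0.
Qed.

End resolvent.

End discrete_frame_algebra.

(** * Averages over roots of unity *)

Section circle.
Context (R : realType).
Implicit Types a b : R.

Definition cis a : R[i] := cos a +i* sin a.

Lemma cisD a b : cis (a + b) = cis a * cis b.
Proof.
rewrite /cis cosD sinD; apply: complex_ext => //=.
by rewrite addrC.
Qed.

Lemma cis0 : cis 0 = 1.
Proof. by rewrite /cis cos0 sin0. Qed.

Lemma nrm_cis a : nrm (cis a) = 1.
Proof.
apply/eqP; rewrite -sqrp_eq1 ?nrm_ge0//; apply/eqP.
by rewrite sqr_nrm cos2Dsin2.
Qed.

Lemma cis_neq0 a : cis a != 0.
Proof. by apply/eqP => c0; have := nrm_cis a; rewrite c0 nrm0 => /esym/eqP; rewrite oner_eq0. Qed.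

Lemma cisN a : cis (- a) = (cis a)^-1.
Proof.
by apply: (mulfI (cis_neq0 a)); rewrite -cisD subrr cis0 mulfV ?cis_neq0.
Qed.

Lemma cisX a n : cis a ^+ n = cis (a *+ n).
Proof. by elim: n => [|n IH]; rewrite ?expr0 ?mulr0n ?cis0// exprS IH mulrS cisD. Qed.

Lemma cis2pi : cis (pi *+ 2) = 1.
Proof.
have s0 : sin (pi *+ 2) = 0 :> R by rewrite mulr2n sinD sinpi mul0r mulr0 addr0.
by rewrite /cis cos2pi s0.
Qed.

(** If [cos a = 1], the double-angle formula makes [sin (a / 2)] vanish, although [a / 2] lies
    strictly between [0] and [pi]. *)
Lemma cis_neq1 a : 0 < a -> a < pi *+ 2 -> cis a != 1.
Proof.
move=> a0 a2; apply/eqP => /(congr1 (@complex.Re R))/= c1.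
have a2' : 0 < a / 2 < pi.
  rewrite divr_gt0//= ltr_pdivrMr//; move: a2; rewrite mulr2n; lra.
have := sin_gt0_pi a2'; have := cos_mulr2n (a / 2).
have -> : (a / 2) *+ 2 = a by rewrite mulr2n; field.
rewrite c1; have := cos2Dsin2 (a / 2); rewrite mulr2n => h1 h2 h3.
have : 0 < sin (a / 2) ^+ 2 by rewrite exprn_gt0.
lra.
Qed.

Lemma lipschitz1_MVT (f df : R -> R) : (forall x : R, is_derive x 1 f (df x)) ->
  (forall x, `|df x| <= 1) -> forall a b, `|f b - f a| <= `|b - a|.
Proof.
move=> fdf df1 a b; wlog ab : a b / a <= b.
  by move=> h; have [/h//|/ltW/h] := leP a b; rewrite distrC [leRHS]distrC.
have cf : {within `[a, b], continuous f}.
  apply: continuous_subspaceT => x.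
  by apply: differentiable_continuous; apply/derivable1_diffP; have := fdf x => -[].
have [c _ ->] := MVT_segment ab (fun x _ => fdf x) cf.
by rewrite normrM ler_piMl.
Qed.

Lemma cis_lipschitz a b : nrm (cis a - cis b) <= 2 * `|a - b|.
Proof.
apply: (@le_trans _ _ (`|cos a - cos b| + `|sin a - sin b|)).
  rewrite -ler_sqr ?nnegrE ?nrm_ge0 ?addr_ge0// sqr_nrm /= [leRHS]sqrrD !real_normK ?num_real//.
  by rewrite lerD2r lerDl mulrn_wge0// mulr_ge0.
rewrite mulr2n mulrDl mul1r; apply: lerD.
- apply: (lipschitz1_MVT (fun x => is_derive_cos x)) => x.
  by rewrite normrN; exact: sin_max.
- by apply: (lipschitz1_MVT (fun x => is_derive_sin x)) => x; exact: cos_max.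
Qed.

(** Powers of two make the grids nested: the even points of level [n + 1] are the points of level
    [n], so two consecutive averages can be compared point by point. *)
Definition dyadic_angle (n k : nat) : R := pi *+ 2 * (k%:R / (2 ^ n)%:R).

Let pow2_gt0 n : 0 < (2 ^ n)%:R :> R.
Proof. by rewrite ltr0n expn_gt0. Qed.

Lemma nrm_pow2V n : nrm ((2 ^ n)%:R^-1 : R[i]) = (2 ^ n)%:R^-1.
Proof.
rewrite nrmV; congr (_^-1).
have -> : ((2 ^ n)%:R : R[i]) = ((2 ^ n)%:R)%:C by rewrite rmorph_nat.
by rewrite nrm_real ger0_norm// ltW.
Qed.

Let twopi_gt0 : 0 < pi *+ 2 :> R.
Proof. by rewrite mulr2n addr_gt0// pi_gt0. Qed.

Lemma dyadic_angle_bound n k : (k < 2 ^ n)%N -> 0 <= dyadic_angle n k <= pi *+ 2.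
Proof.
move=> kn; rewrite /dyadic_angle mulr_ge0 ?divr_ge0 ?(ltW twopi_gt0)//=.
by rewrite ler_piMr ?(ltW twopi_gt0)// ler_pdivrMr// mul1r ler_nat ltnW.
Qed.

Lemma dyadic_angleE n k : dyadic_angle n k = dyadic_angle n 1 *+ k.
Proof. by rewrite /dyadic_angle -[in RHS]mulrnAr -[(_ / _) *+ k]mulrnAl. Qed.

Lemma dyadic_angle_double n k : dyadic_angle n.+1 k.*2 = dyadic_angle n k.
Proof.
rewrite /dyadic_angle expnS mul2n -!mul2n !natrM; congr (_ * _); field.
by rewrite gt_eqF ?pow2_gt0.
Qed.

Lemma dyadic_angle_succ n k :
  dyadic_angle n k.+1 - dyadic_angle n k = pi *+ 2 / (2 ^ n)%:R.
Proof.
by rewrite /dyadic_angle -mulrBr -mulrBl -natr1 addrAC subrr add0r mul1r.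
Qed.

(** The sum is geometric with ratio [rho = w^l / w^j], a [2^n]-th root of unity which differs from
    [1] unless [l = j], since [l] and [j] are both less than [2^n]. *)
Lemma cis_dyadic_orth n l j : (l < 2 ^ n)%N -> (j < 2 ^ n)%N ->
  \sum_(k < 2 ^ n) cis (dyadic_angle n k) ^+ l * (cis (dyadic_angle n k) ^+ j)^-1 =
  (if l == j then (2 ^ n)%:R else 0).
Proof.
move=> ln jn; set N := (2 ^ n)%N.
pose w := cis (dyadic_angle n 1).
have wN : w ^+ N = 1.
  rewrite /w cisX -dyadic_angleE /dyadic_angle mulfV ?mulr1 ?cis2pi//.
  by rewrite gt_eqF ?pow2_gt0.
have w1 m : (0 < m < N)%N -> w ^+ m != 1.
  move=> /andP[m0 mN]; rewrite /w cisX -dyadic_angleE; apply: cis_neq1.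
    by rewrite /dyadic_angle mulr_gt0// divr_gt0// ltr0n.
  by rewrite /dyadic_angle gtr_pMr// ltr_pdivrMr// mul1r ltr_nat.
have wn0 : w != 0 by exact: cis_neq0.
pose rho := w ^+ l / w ^+ j.
have -> : \sum_(k < N) cis (dyadic_angle n k) ^+ l * (cis (dyadic_angle n k) ^+ j)^-1 =
    \sum_(k < N) rho ^+ k.
  apply: eq_bigr => k _; rewrite dyadic_angleE -cisX -/w /rho expr_div_n.
  by rewrite -!exprM mulnC [(j * k)%N]mulnC.
case: eqVneq => [lj|lj].
  rewrite /rho lj mulfV ?expf_neq0//; under eq_bigr do rewrite expr1n.
  by rewrite sumr_const card_ord.
have rho1 : rho != 1.
  rewrite /rho; apply/eqP => /(congr1 (fun x => x * w ^+ j)).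
  rewrite mul1r divfK ?expf_neq0// => wlj.
  have [ltlj|ltjl] := ltnP l j.
    have := w1 (j - l)%N; rewrite subn_gt0 ltlj/= (leq_ltn_trans (leq_subr _ _) jn) => /(_ isT)/eqP.
    by apply; apply: (mulfI (expf_neq0 l wn0)); rewrite -exprD subnKC ?mulr1// ltnW.
  have {ltjl} ltjl : (j < l)%N by rewrite ltn_neqAle eq_sym lj.
  have := w1 (l - j)%N; rewrite subn_gt0 ltjl/= (leq_ltn_trans (leq_subr _ _) ln) => /(_ isT)/eqP.
  by apply; apply: (mulfI (expf_neq0 j wn0)); rewrite -exprD subnKC ?mulr1// ltnW.
have rhoN : rho ^+ N = 1.
  by rewrite /rho expr_div_n -!exprM mulnC exprM wN expr1n mulnC exprM wN expr1n divr1.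
apply: (mulfI (_ : 1 - rho != 0)); first by rewrite subr_eq0 eq_sym.
by rewrite mulr0 -[LHS]opprK -mulNr opprB -subrX1 rhoN subrr oppr0.
Qed.

End circle.

Section dyadic_average.
Context (R : realType) (I : pointedType)
  (nu : {measure set (discrete_space I) -> \bar R}).
Hypothesis nu_atom : forall i : discrete_space I, (0 < nu [set i] < +oo)%E.
Local Notation J := (discrete_space I).
Variable A : kernel_space R J.
Hypothesis admA : admissible_algebra nu A.
Let bA := adm_banach admA.

Definition dyadic_average (f : R -> ckernel R J) (n : nat) : ckernel R J :=
  kscale ((2 ^ n)%:R^-1) (fun i j => \sum_(k < 2 ^ n) f (dyadic_angle R n k) i j).

Lemma sum_doubleS (V : zmodType) (g : nat -> V) n :
  \sum_(k < n.*2) g k = \sum_(k < n) (g k.*2 + g k.*2.+1).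
Proof.
elim: n => [|n IH]; first by rewrite !big_ord0.
by rewrite doubleS !big_ord_recr/= IH addrA.
Qed.

Let pow2_gt0 n : 0 < (2 ^ n)%:R :> R.
Proof. by rewrite ltr0n expn_gt0. Qed.

(** Refining the grid adds to each point a right neighbour at distance [2 pi / 2^(n+1)]. The average
    changes by [2^-(n+1)] times a sum of [2^n] differences, hence by at most [L (2 pi) / 4] times
    [2^-n], and [geometric_limit_mem] applies. *)
Lemma dyadic_average_limit_mem f X (M L : R) :
  (forall t, A (f t)) ->
  (forall t, 0 <= t <= pi *+ 2 -> knorm A (f t) <= M) ->
  (forall s t, 0 <= s <= pi *+ 2 -> 0 <= t <= pi *+ 2 ->
     knorm A (ksub (f s) (f t)) <= L * `|s - t|) ->
  (forall i j (e : R), 0 < e -> exists N, forall n, (N <= n)%N ->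
     nrm (dyadic_average f n i j - X i j) < e) ->
  A X /\ knorm A X <= M.
Proof.
move=> Af fM fL fX.
have Asum n : A (fun i j => \sum_(k < 2 ^ n) f (dyadic_angle R n k) i j).
  exact: (bsa_sum bA (2 ^ n) (fun k => Af (dyadic_angle R n k))).1.
have Aav n : A (dyadic_average f n) by exact: (bsa_scale bA).
apply: (geometric_limit_mem nu_atom admA (a := L * (pi *+ 2) / 4) (s := 2^-1)
  _ _ Aav _ _ fX).
- by rewrite invr_ge0.
- by rewrite invf_lt1// ltr1n.
- move=> n; rewrite (bsa_norm_scale bA)// nrm_pow2V mulrC ler_pdivrMr//.
  have [_ h] := bsa_sum bA (2 ^ n) (fun k => Af (dyadic_angle R n k)).
  apply: le_trans h _; apply: (@le_trans _ _ (\sum_(k < 2 ^ n) M)).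
    by apply: ler_sum => k _; apply: fM; exact: dyadic_angle_bound.
  by rewrite sumr_const card_ord mulr_natr.
move=> n.
pose g k : ckernel R J := ksub (f (dyadic_angle R n.+1 k.*2.+1)) (f (dyadic_angle R n.+1 k.*2)).
have Ag k : A (g k) by exact: (bsa_sub bA).
have [Asg sg] := bsa_sum bA (2 ^ n) Ag.
have -> : ksub (dyadic_average f n.+1) (dyadic_average f n) =
    kscale ((2 ^ n.+1)%:R^-1) (fun i j => \sum_(k < 2 ^ n) g k i j).
  apply/funext => i; apply/funext => j; rewrite /ksub /kadd /dyadic_average /kscale.
  have -> : \sum_(k < 2 ^ n.+1) f (dyadic_angle R n.+1 k) i j = \sum_(k < 2 ^ n)
      (f (dyadic_angle R n.+1 k.*2) i j + f (dyadic_angle R n.+1 k.*2.+1) i j).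
    by rewrite expnS mul2n -(sum_doubleS (fun k => f (dyadic_angle R n.+1 k) i j)).
  rewrite mulN1r big_split/=; under [X in _ * (X + _)]eq_bigr do rewrite dyadic_angle_double.
  under [X in _ = _ * X]eq_bigr do rewrite /g /ksub /kadd /kscale dyadic_angle_double mulN1r.
  rewrite big_split/= sumrN.
  set P := \sum_(_ < _) _; set Q := \sum_(_ < _) _.
  rewrite expnS natrM invfM.
  have E (x : R[i]) : x = 2^-1 * x + 2^-1 * x by field.
  by rewrite [X in - (X * _)]E; ring.
rewrite (bsa_norm_scale bA)// nrm_pow2V mulrC ler_pdivrMr//.
apply: le_trans sg _.
apply: (@le_trans _ _ (\sum_(k < 2 ^ n) L * (pi *+ 2 / (2 ^ n.+1)%:R))).
  apply: ler_sum => k _.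
  have kn : (k.*2.+1 < 2 ^ n.+1)%N by rewrite expnS mul2n ltn_Sdouble.
  apply: le_trans (fL _ _ _ _) _; [exact: dyadic_angle_bound..|apply: dyadic_angle_bound; exact: ltnW|].
  rewrite dyadic_angle_succ ger0_norm// divr_ge0// ?ltW// mulr2n addr_gt0// pi_gt0//.
rewrite sumr_const card_ord -[leLHS]mulr_natr expnS natrM exprVn natrX.
rewrite le_eqVlt; apply/orP; left; apply/eqP; field.
by rewrite expf_neq0// pnatr_eq0.
Qed.

End dyadic_average.

(** * The dual Gram matrix *)

Section linear_functions.
Context (K : pzRingType) (U W : lmodType K) (F : U -> W).
Hypothesis Flin : forall a f g, F (a *: f + g) = a *: F f + F g.

Lemma lin_fun0 : F 0 = 0.
Proof. by have := Flin (-1) 0 0; rewrite scaler0 addr0 scaleN1r addNr. Qed.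

Lemma lin_funZ a f : F (a *: f) = a *: F f.
Proof. by rewrite -[a *: f]addr0 Flin lin_fun0 addr0. Qed.

Lemma lin_funB f g : F (f - g) = F f - F g.
Proof. by rewrite addrC -scaleN1r Flin scaleN1r addrC. Qed.

Lemma lin_funD f g : F (f + g) = F f + F g.
Proof. by rewrite -[f]scale1r Flin !scale1r. Qed.

End linear_functions.

Lemma iter_lin (K : pzRingType) (U : lmodType K) (F : U -> U) n :
  (forall a f g, F (a *: f + g) = a *: F f + F g) ->
  forall a f g, iter n F (a *: f + g) = a *: iter n F f + iter n F g.
Proof. by move=> Flin a f g; elim: n => //= n ->. Qed.

Lemma resolvent_lin (K : comPzRingType) (U : lmodType K) (F T : U -> U) (z : K) :
  (forall a f g, F (a *: f + g) = a *: F f + F g) ->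
  (forall f, T (f - z *: F f) = f) -> (forall f, T f - z *: F (T f) = f) ->
  forall a f g, T (a *: f + g) = a *: T f + T g.
Proof.
move=> Flin TK KT a f g; rewrite -[RHS]TK Flin; congr T.
rewrite -[in LHS](KT f) -[in LHS](KT g) !scalerDr scalerN opprD addrACA !scalerA.
by rewrite [z * a]mulrC.
Qed.

Lemma lipschitz_continuous (R : realType) (h : R -> R) (L : R) :
  (forall a b, `|h a - h b| <= L * `|a - b|) -> continuous h.
Proof.
move=> hL a; apply/cvgrPdist_lt => e e0.
have L0 : 0 < `|L| + 1 by rewrite ltr_wpDl.
near=> b.
apply: le_lt_trans (hL _ _) _; apply: (@le_lt_trans _ _ ((`|L| + 1) * `|a - b|)).
  by rewrite ler_wpM2r// ler_wpDr// ler_norm.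
rewrite mulrC -ltr_pdivlMr//; near: b.
have : id b @[b --> a] --> a by exact: cvg_id.
by move=> /cvgr_dist_lt; apply; rewrite divr_gt0.
Unshelve. all: by end_near. Qed.

Lemma sum_geometric_le (R : realFieldType) (s : R) n : 0 <= s -> s < 1 ->
  \sum_(k < n) s ^+ k <= (1 - s)^-1.
Proof.
move=> s0 s1; have k0 : 0 < 1 - s by rewrite subr_gt0.
rewrite -[leRHS]mul1r ler_pdivlMr//.
suff -> : (\sum_(k < n) s ^+ k) * (1 - s) = 1 - s ^+ n by rewrite gerBl exprn_ge0.
elim: n => [|n IH]; first by rewrite big_ord0 mul0r expr0 subrr.
by rewrite big_ord_recr/= mulrDl IH exprS; ring.
Qed.

Lemma geometric_small (R : realType) (s : R) : 0 <= s -> s < 1 ->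
  forall K e : R, 0 < e -> exists N, forall n, (N <= n)%N -> K * s ^+ n < e.
Proof.
move=> s0 s1 K e e0; have : (K * s ^+ n) @[n --> \oo] --> (0 : R).
  rewrite -[X in _ --> X](mulr0 K); apply: cvgM; first exact: cvg_cst.
  by apply: cvg_expr; rewrite ger0_norm.
move=> /cvgr0_norm_lt/(_ e e0)[N _ hN]; exists N => n Nn.
by apply: le_lt_trans (ler_norm _) _; exact: hN.
Qed.

Section dual_gram.
Context (R : realType) (I : pointedType)
  (nu : {measure set (discrete_space I) -> \bar R}).
Hypothesis nu_atom : forall i : discrete_space I, (0 < nu [set i] < +oo)%E.
Local Notation J := (discrete_space I).
Context (H : completeNormedModType R[i]) (ip : H -> H -> R[i]).
Hypothesis hH : hilbert_space ip.
Variables (psi : J -> H) (C1 C2 : R).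
Hypotheses (C1_gt0 : 0 < C1) (C2_gt0 : 0 < C2).
Hypothesis frame_bounds : forall f, ((C1 * nrm f ^+ 2)%:E <=
  \int[nu]_x ((nrm (ip f (psi x)) ^+ 2)%:E) <= (C2 * nrm f ^+ 2)%:E)%E.
Variable A : kernel_space R J.
Hypothesis specA : spectral_algebra nu A.
Let admA := specA.1.
Let bA := adm_banach admA.
Let mpsi f : cmeasurable (fun x : J => ip f (psi x)) := discrete_cmeasurable _.

Local Notation S := (frame_op ip nu psi).
Local Notation Sinv := (op_inv S).
Local Notation op_kernel := (op_kernel ip psi).
Local Notation G := (op_kernel id).
Hypothesis G_mem : A G.

Local Notation B := (contraction ip nu psi C2).
Let q := Num.sqrt (1 - C1 / C2).
Let q_ge0 : 0 <= q. Proof. exact: sqrtr_ge0. Qed.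
Let q_lt1 : q < 1. Proof. exact: contraction_factor_lt1. Qed.
Let Bq f : nrm (B f) <= q * nrm f.
Proof. exact: (contraction_le hH mpsi C2_gt0 frame_bounds). Qed.
Let Blin a f g : B (a *: f + g) = a *: B f + B g.
Proof. exact: (contraction_lin hH mpsi C2_gt0 frame_bounds). Qed.
Let Bsym f g : ip (B f) g = ip f (B g).
Proof. exact: (contraction_sym hH mpsi C2_gt0 frame_bounds). Qed.
Let BE f : B f = f - (C2^-1)%:C *: S f. Proof. by []. Qed.
Let BZ a f : B (a *: f) = a *: B f.
Proof. exact: (lin_funZ Blin). Qed.
Let t : R[i] := (C2^-1)%:C.
Let tC : t * C2%:C = 1.
Proof. by rewrite -rmorphM/= mulVf ?gt_eqF// rmorph1. Qed.
Let t0 : t != 0.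
Proof. by apply/eqP => t0; move: tC; rewrite t0 mul0r => /esym/eqP; rewrite oner_eq0. Qed.
Let C2c : (C2%:C : R[i]) != 0.
Proof. by apply/eqP => /complexI/eqP; rewrite gt_eqF. Qed.
Let tS f : t *: S f = f - B f.
Proof. by rewrite BE opprB addrCA subrr addr0. Qed.
(** Chosen to satisfy [1 < r] and [r q < 1], with no division by [q], which may be zero. *)
Let r := 2 / (1 + q).
Let q1_gt0 : 0 < 1 + q. Proof. by rewrite ltr_pwDl. Qed.
Let r_gt1 : 1 < r.
Proof. by rewrite ltr_pdivlMr// mul1r; have := q_lt1; lra. Qed.
Let r_gt0 : 0 < r. Proof. exact: lt_trans r_gt1. Qed.
Let rq_lt1 : r * q < 1.
Proof. by rewrite mulrAC ltr_pdivrMr// mul1r; have := q_lt1; lra. Qed.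

Let iterBq n f : nrm (iter n B f) <= q ^+ n * nrm f.
Proof.
elim: n => [|n IH]; first by rewrite expr0 mul1r.
by apply: le_trans (Bq _) _; rewrite exprS -mulrA ler_wpM2l.
Qed.

Section resolvents.
Variable T : R[i] -> H -> H.
Hypothesis TK : forall z, nrm z = r -> forall f, T z (f - z *: B f) = f.
Hypothesis KT : forall z, nrm z = r -> forall f, T z f - z *: B (T z f) = f.

Let Tlin z a f g : nrm z = r -> T z (a *: f + g) = a *: T z f + T z g.
Proof.
by move=> zr; exact: (resolvent_lin Blin (TK zr) (KT zr)).
Qed.

Let k := (1 - r * q)^-1.
Let k_gt0 : 0 < k. Proof. by rewrite invr_gt0 subr_gt0. Qed.

Let Tbound z f : nrm z = r -> nrm (T z f) <= k * nrm f.
Proof.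
move=> zr; rewrite /k mulrC ler_pdivlMr ?subr_gt0//.
have h1 := nrmD (T z f - z *: B (T z f)) (z *: B (T z f)).
rewrite subrK (KT zr) nrmZ zr in h1.
have h2 := ler_wpM2l (ltW r_gt0) (Bq (T z f)).
have -> : nrm (T z f) * (1 - r * q) = nrm (T z f) - r * (q * nrm (T z f)) by ring.
lra.
Qed.

Let Tadj z f g : nrm z = r -> ip (T z f) g = ip f (T (conjc z) g).
Proof.
move=> zr; have zr' : nrm (conjc z) = r by rewrite nrmJ.
rewrite -[in LHS](KT zr' g) (ipBr hH) (ipZr hH) conjcK -Bsym -(ipZl hH) -(ipBl hH).
rewrite KT//.
Qed.

Let z_neq0 (z : R[i]) : nrm z = r -> z != 0.
Proof. by move=> zr; apply: contra_eq_neq zr => ->; rewrite nrm0 lt_eqF. Qed.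

Let z_neq1 (z : R[i]) : nrm z = r -> z != 1.
Proof. by move=> zr; apply: contra_eq_neq zr => ->; rewrite nrm1 lt_eqF. Qed.

Local Notation y z := (op_kernel (T z)).

(** [1 - z B = (z / C2) (S - lam)] for [lam = C2 (1 - z^-1)], so [T z] is a multiple of the
    resolvent of [S] at [lam]. As [nrm z = r > 1], [lam] is nonzero and [resolvent_mem] applies. *)
Let y_mem z : nrm z = r -> A (y z).
Proof.
move=> zr; have z0 := z_neq0 zr.
pose lam := C2%:C * (1 - z^-1).
pose c := t * z.
have c0 : c != 0 by rewrite mulf_neq0.
have SL f : S f - lam *: f = c^-1 *: (f - z *: B f).
  rewrite -[LHS]scale1r -(mulVf c0) -scalerA; congr (_ *: _).
  have cl : c * lam = z - 1 by rewrite /c /lam mulrACA tC mul1r mulrBr mulr1 mulfV.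
  rewrite scalerBr scalerA cl /c [t * z]mulrC -scalerA tS scalerBr scalerBl scale1r opprB.
  by rewrite addrC addrA subrK.
have TZ a f : T z (a *: f) = a *: T z f by apply: lin_funZ => *; exact: Tlin.
have Ac : A (op_kernel (fun f => c *: T z f)).
  apply: (@resolvent_mem _ _ _ nu_atom _ _ hH _ C1 C2 C2_gt0 frame_bounds _ specA G_mem lam _ _ _ _ (nrm c * k)).
  - rewrite mulf_neq0// subr_eq0 eq_sym; apply/eqP => zV.
    by have := z_neq1 zr; rewrite -[z]invrK zV invr1 eqxx.
  - by move=> f; rewrite SL TZ TK// scalerA mulfV// scale1r.
  - move=> f; have zc : z *: (c *: B (T z f)) = c *: (z *: B (T z f)) by rewrite !scalerA mulrC.
    by rewrite SL BZ zc -scalerBr KT// scalerA mulVf// scale1r.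
  - by move=> f; rewrite nrmZ -mulrA ler_wpM2l ?nrm_ge0//; exact: Tbound.
rewrite (_ : y z = kscale c^-1 (op_kernel (fun f => c *: T z f))); first exact: (bsa_scale bA).
apply/funext => i; apply/funext => j.
by rewrite /kscale /op_kernel (ipZl hH) mulrA mulVf// mul1r.
Qed.

Local Notation N K := (knorm A K).
(** The added [1] absorbs the terms without a factor [y] in the resolvent identity, and it keeps [u]
    invertible. *)
Let u z := 1 + N (y z).

Let u_ge1 z : nrm z = r -> 1 <= u z.
Proof. by move=> zr; rewrite lerDl (bsa_norm_ge0 bA)//; exact: y_mem. Qed.

Let g := N G.
Let g_ge0 : 0 <= g. Proof. exact: (bsa_norm_ge0 bA). Qed.

(** The factor [(r - 1)^-1] bounds [(1 - z)^-1]; [(1 + r / C2) u z] bounds the effect of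
    [1 - (z / C2) T z S]; and [r^-1 (1 + g) u w] bounds the kernel of [B T w]. *)
Let Lc := (r - 1)^-1 * ((1 + r / C2) * (r^-1 * (1 + g))).

(* [T z - T w = (z - w) T z B T w], where [w B T w = T w - 1] and
   [(1 - z) T z = 1 - (z / C2) T z S], so that the kernel of [T z B T w] is a
   polynomial in [G], [y z] and [y w]. *)
Let y_diff z w : nrm z = r -> nrm w = r ->
  N (ksub (y z) (y w)) <= Lc * nrm (z - w) * (u z * u w).
Proof.
move=> zr wr; have w0 := z_neq0 wr.
have Ayz := y_mem zr; have Ayw := y_mem wr.
pose P := kscale w^-1 (ksub (y w) G).
have AP : A P by apply: (bsa_scale bA); exact: (bsa_sub bA).
have PE : P = op_kernel (fun f => B (T w f)).
  apply/funext => i; apply/funext => j.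
  rewrite /P /ksub /kadd /kscale mulN1r /op_kernel -(ipBl hH) -(ipZl hH).
  rewrite -[X in _ *: (_ - X)](KT wr) opprB addrCA subrr addr0 scalerA mulVf//.
  by rewrite scale1r.
have z1 : 1 - z != 0 by rewrite subr_eq0 eq_sym z_neq1.
pose Q' := ksub P (kscale (z * t) (kcomp nu (y z) P)).
have AyP : A (kcomp nu (y z) P) by exact: (bsa_comp bA).
have AzyP : A (kscale (z * t) (kcomp nu (y z) P)) by exact: (bsa_scale bA).
have AQ' : A Q' by exact: (bsa_sub bA).
have QE : ksub (y z) (y w) = kscale ((z - w) * (1 - z)^-1) Q'.
  rewrite /Q' PE (kcomp_op_kernel hH C2_gt0 frame_bounds (T' := T (conjc z))); last first.
    by move=> f h; exact: Tadj.
  apply/funext => i; apply/funext => j.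
  rewrite /ksub /kadd /kscale !mulN1r /op_kernel -!(ipZl hH) -!(ipBl hH) -!(ipZl hH).
  congr (ip _ _); set f := psi j; set h := B (T w f).
  have hE v : v - z *: B v = (1 - z) *: v + (z * t) *: S v.
    by rewrite -scalerA tS [in RHS]scalerBr [in RHS]scalerBl scale1r addrA subrK.
  have -> : h - (z * t) *: T z (S h) = (1 - z) *: T z h.
    apply/eqP; rewrite subr_eq; apply/eqP.
    rewrite -[LHS](TK zr) hE Tlin//; congr (_ + _).
    by apply: lin_funZ => *; exact: Tlin.
  rewrite scalerA -mulrA mulVf// mulr1.
  have fE : f = (z - w) *: h + (T w f - z *: h).
    by rewrite -[LHS](KT wr) -/h scalerBl [RHS]addrC addrA subrK.
  by rewrite {1}fE Tlin// TK// addrK.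
have nz1 : r - 1 <= nrm (1 - z).
  by have := nrmD (1 - z) z; rewrite subrK nrm1 zr => h1; have := nrmD (z - 1) 1;
    rewrite subrK zr nrm1 nrmBC; lra.
have r10 : 0 < r - 1 by rewrite subr_gt0.
have nt : nrm t = C2^-1 by rewrite nrm_real ger0_norm// invr_ge0 ltW.
have uz := u_ge1 zr; have uw := u_ge1 wr.
have Nz : 0 <= N (y z) by exact: (bsa_norm_ge0 bA).
have Nw : 0 <= N (y w) by exact: (bsa_norm_ge0 bA).
have NP : N P <= r^-1 * (1 + g) * u w.
  rewrite (bsa_norm_scale bA); last exact: (bsa_sub bA).
  rewrite nrmV wr -mulrA ler_pM2l ?invr_gt0//.
  apply: le_trans (bsa_norm_sub bA Ayw G_mem) _; rewrite -/g /u.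
  have -> : (1 + g) * (1 + N (y w)) = N (y w) + g + (1 + g * N (y w)) by ring.
  by rewrite lerDl addr_ge0// mulr_ge0.
have NP0 : 0 <= N P by exact: (bsa_norm_ge0 bA).
have rC2 : 0 <= r / C2 by rewrite divr_ge0 ?ltW.
have NQ' : N Q' <= (1 + r / C2) * u z * (r^-1 * (1 + g) * u w).
  apply: le_trans (bsa_norm_sub bA AP AzyP) _.
  apply: (@le_trans _ _ ((1 + r / C2 * N (y z)) * N P)).
    rewrite mulrDl mul1r lerD2l (bsa_norm_scale bA)// nrmM zr nt -[leRHS]mulrA.
    by apply: ler_wpM2l => //; exact: (bsa_norm_comp bA).
  apply: ler_pM => //; first by rewrite addr_ge0// mulr_ge0.
  have -> : (1 + r / C2) * u z = 1 + r / C2 * N (y z) + (r / C2 + N (y z)) by rewrite /u; ring.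
  by rewrite lerDl addr_ge0.
rewrite QE (bsa_norm_scale bA)// nrmM nrmV.
have -> : Lc * nrm (z - w) * (u z * u w) =
  nrm (z - w) * (r - 1)^-1 * ((1 + r / C2) * u z * (r^-1 * (1 + g) * u w)).
  by rewrite /Lc; ring.
apply: ler_pM => //.
- by rewrite mulr_ge0 ?nrm_ge0 ?invr_ge0 ?nrm_ge0.
- exact: (bsa_norm_ge0 bA).
- rewrite ler_wpM2l ?nrm_ge0// lef_pV2 ?posrE//.
  exact: lt_le_trans nz1.
Qed.

Let Lc_ge0 : 0 <= Lc.
Proof.
have h1 : 0 <= (r - 1)^-1 by rewrite invr_ge0 subr_ge0 ltW.
have h2 : 0 <= r / C2 by rewrite divr_ge0 ?ltW.
have h3 : 0 <= r^-1 by rewrite invr_ge0 ltW.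
by apply: mulr_ge0 => //; apply: mulr_ge0; [rewrite addr_ge0|apply: mulr_ge0; rewrite ?addr_ge0].
Qed.

Let zt (a : R) : R[i] := r%:C * cis a.

Let zt_r a : nrm (zt a) = r.
Proof. by rewrite nrmM nrm_cis mulr1 nrm_real ger0_norm// ltW. Qed.

Let zt_lip a b : nrm (zt a - zt b) <= r * (2 * `|a - b|).
Proof.
rewrite -mulrBr nrmM nrm_real ger0_norm ?(ltW r_gt0)// ler_pM2l//.
exact: cis_lipschitz.
Qed.

(** The bound of [y_diff] contains the quantities that are to be bounded, so it does not directly
    give continuity of the norm. Divided by [u z * u w], it says that [1 / u] is Lipschitz along the
    circle; being positive, [1 / u] has a positive minimum on the compact interval. *)
Lemma resolvent_circle_bounded :
  exists M, forall a, 0 <= a <= pi *+ 2 -> N (y (zt a)) <= M.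
Proof.
pose h a := (u (zt a))^-1.
have u0 a : 0 < u (zt a) by exact: lt_le_trans (u_ge1 (zt_r a)).
have hL a b : `|h a - h b| <= (Lc * (r * 2)) * `|a - b|.
  have -> : h a - h b = (u (zt b) - u (zt a)) / (u (zt a) * u (zt b)).
    by rewrite /h; field; rewrite !gt_eqF.
  rewrite normrM [X in _ * X]ger0_norm ?invr_ge0 ?mulr_ge0 ?(ltW (u0 _))//.
  rewrite ler_pdivrMr ?mulr_gt0//.
  apply: (@le_trans _ _ (N (ksub (y (zt a)) (y (zt b))))).
    have Aa := y_mem (zt_r a); have Ab := y_mem (zt_r b).
    have h1 := bsa_norm_leD bA Aa Ab; have h2 := bsa_norm_leD bA Ab Aa.
    rewrite (bsa_norm_subC bA Ab Aa) in h2.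
    by rewrite /u ler_norml; apply/andP; split; lra.
  apply: le_trans (y_diff (zt_r a) (zt_r b)) _.
  apply: ler_wpM2r; first by rewrite mulr_ge0 ?(ltW (u0 _)).
  by rewrite -[leRHS]mulrA -[r * 2 * _]mulrA; apply: ler_wpM2l; [exact: Lc_ge0|exact: zt_lip].
have pi2 : 0 <= pi *+ 2 :> R by rewrite mulrn_wge0// pi_ge0.
have [c _ hc] := EVT_min pi2 (continuous_subspaceT (lipschitz_continuous hL)).
exists (u (zt c)) => a a2.
have := hc a; rewrite in_itv/= => /(_ a2); rewrite /h lef_pV2 ?posrE//.
by apply: le_trans; rewrite /u lerDr.
Qed.

Let resolvent_expansion z n f : nrm z = r ->
  T z f - z ^+ n *: iter n B (T z f) = \sum_(l < n) z ^+ l *: iter l B f.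
Proof.
move=> zr; elim: n => [|n IH]; first by rewrite expr0 scale1r subrr big_ord0.
rewrite big_ord_recr/= -IH.
have -> : iter n B f = iter n B (T z f) - z *: iter n.+1 B (T z f).
  by rewrite iterSr -(lin_funZ (iter_lin n Blin)) -(lin_funB (iter_lin n Blin)) KT.
by rewrite [in RHS]scalerBr scalerA -exprSr addrA subrK.
Qed.

(* [r ^+ j *: B ^ j] is the [j]-th Fourier coefficient of
   [a |-> (1 - r e^(i a) B)^-1], approximated by averages over the [2 ^ n]-th
   roots of unity, whose kernels form a Cauchy sequence in the algebra. *)
Lemma iter_contraction_bound : exists M, forall j,
  A (op_kernel (iter j B)) /\ N (op_kernel (iter j B)) <= M * r^-1 ^+ j.
Proof.
have [M hM] := resolvent_circle_bounded.
have pi2 : 0 <= pi *+ 2 :> R by rewrite mulrn_wge0// pi_ge0.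
have M0 : 0 <= M.
  by apply: le_trans (hM 0 _); [apply: (bsa_norm_ge0 bA); exact: y_mem|rewrite lexx].
exists M => j.
pose w a : R[i] := (cis a ^+ j)^-1.
have wE a : w a = cis (- (a *+ j)) by rewrite cisN -cisX.
have w1 a : nrm (w a) = 1 by rewrite wE nrm_cis.
pose f a := kscale (w a) (y (zt a)).
have Af a : A (f a) by apply: (bsa_scale bA); exact: y_mem.
pose X := kscale (r ^+ j)%:C (op_kernel (iter j B)).
have [AX NX] : A X /\ N X <= M.
  (* Lipschitz constant of the product [w y]: [2 j M] comes from the factor [w], whose angle is
     [- j a], and the rest from [y_diff] with [u <= 1 + M]. *)
  apply: (dyadic_average_limit_mem nu_atom admA (f := f)
    (L := 2 * j%:R * M + Lc * (r * 2) * ((1 + M) * (1 + M)))) => //.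
  - by move=> a a2; rewrite (bsa_norm_scale bA) ?w1 ?mul1r ?hM//; exact: y_mem.
  - move=> a b a2 b2.
    have Aya := y_mem (zt_r a); have Ayb := y_mem (zt_r b).
    have -> : ksub (f a) (f b) =
        kadd (kscale (w a - w b) (y (zt a))) (kscale (w b) (ksub (y (zt a)) (y (zt b)))).
      apply/funext => i; apply/funext => i'.
      by rewrite /f /ksub /kadd /kscale !mulN1r; ring.
    have A1 : A (kscale (w a - w b) (y (zt a))) by exact: (bsa_scale bA).
    have A2 : A (ksub (y (zt a)) (y (zt b))) by exact: (bsa_sub bA).
    have A3 : A (kscale (w b) (ksub (y (zt a)) (y (zt b)))) by exact: (bsa_scale bA).
    apply: le_trans (bsa_norm_add bA A1 A3) _.
    rewrite !(bsa_norm_scale bA)// w1 mul1r [leRHS]mulrDl; apply: lerD.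
      rewrite [leRHS]mulrAC; apply: ler_pM; rewrite ?nrm_ge0 ?hM ?(bsa_norm_ge0 bA)//.
      rewrite !wE; apply: le_trans (cis_lipschitz _ _) _.
      rewrite -mulrA ler_wpM2l// opprK addrC -mulrnBl normrMn distrC.
      by rewrite mulr_natl.
    apply: le_trans (y_diff (zt_r a) (zt_r b)) _.
    rewrite [leRHS]mulrAC; apply: ler_pM.
    + by rewrite mulr_ge0 ?nrm_ge0.
    + by rewrite mulr_ge0// /u addr_ge0// (bsa_norm_ge0 bA).
    + rewrite -[leRHS]mulrA -[r * 2 * _]mulrA.
      by apply: ler_wpM2l; [exact: Lc_ge0|exact: zt_lip].
    + by apply: ler_pM; rewrite /u ?addr_ge0 ?lerD2l ?hM ?(bsa_norm_ge0 bA).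
  move=> i i' e e0.
  pose Cn n h := (2 ^ n)%:R^-1 *: \sum_(m < 2 ^ n) w (dyadic_angle R n m) *: T (zt (dyadic_angle R n m)) h : H.
  have avE n : dyadic_average f n i i' = ip (Cn n (psi i')) (psi i).
    rewrite /dyadic_average /kscale /Cn (ipZl hH); congr (_ * _).
    by rewrite (ip_suml hH); apply: eq_bigr => m _; rewrite (ipZl hH).
  have n2 n : ((2 ^ n)%:R : R[i]) != 0 by rewrite pnatr_eq0 expn_eq0.
  (* At the [2^n]-th roots of unity [z^(2^n) = r^(2^n)] is independent of the point, so the finite
     Neumann expansion can be averaged with its remainder, and orthogonality retains only [l = j].
     The error of the average is thus exactly [r^(2^n) B^(2^n) Cn], of size [(r q)^(2^n)]. *)
  have CnE n h : (j < 2 ^ n)%N ->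
      Cn n h - (r ^+ (2 ^ n))%:C *: iter (2 ^ n) B (Cn n h) = (r ^+ j)%:C *: iter j B h.
    move=> jn; set M2 := (2 ^ n)%N.
    rewrite /Cn -/M2 (lin_funZ (iter_lin _ Blin)) scalerA [_ * M2%:R^-1]mulrC -scalerA.
    rewrite -scalerBr (big_morph (iter M2 B) (lin_funD (iter_lin _ Blin)) (lin_fun0 (iter_lin _ Blin))).
    rewrite scaler_sumr -sumrB.
    transitivity (M2%:R^-1 *: \sum_(m < M2) \sum_(l < M2)
        ((r ^+ l)%:C * (cis (dyadic_angle R n m) ^+ l * w (dyadic_angle R n m))) *: iter l B h).
      congr (_ *: _); apply: eq_bigr => m _; set a := dyadic_angle R n m.
      rewrite (lin_funZ (iter_lin _ Blin)) scalerA mulrC -scalerA -scalerBr.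
      have -> : (r ^+ M2)%:C = zt a ^+ M2.
        have cN : cis a ^+ M2 = 1.
          rewrite cisX /a dyadic_angleE -mulrnA mulnC mulrnA -dyadic_angleE.
          rewrite /dyadic_angle mulfV ?pnatr_eq0 ?expn_eq0// mulr1 -cisX cis2pi.
          exact: expr1n.
        by rewrite /zt [in RHS]exprMn cN mulr1 rmorphXn.
      rewrite (resolvent_expansion _ _ (zt_r a)) scaler_sumr; apply: eq_bigr => l _.
      by rewrite scalerA /zt [in LHS]exprMn rmorphXn/=; congr (_ *: _); ring.
    rewrite exchange_big/=.
    under eq_bigr => l _.
      rewrite -scaler_suml -mulr_sumr cis_dyadic_orth//.
      over.
    rewrite (bigD1 (Ordinal jn))//= eqxx big1 ?addr0; last first.
      move=> l lj; rewrite ifF ?mulr0 ?scale0r//.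
      by apply: contra_neqF lj => /eqP lj; apply: val_inj.
    by rewrite scalerA mulrCA mulVf ?n2// mulr1.
  have Cnb n h : nrm (Cn n h) <= k * nrm h.
    rewrite /Cn nrmZ nrm_pow2V mulrC ler_pdivrMr ?ltr0n ?expn_gt0//.
    apply: le_trans (nrm_sum _ _ _) _.
    rewrite mulr_natr -[X in _ *+ X]card_ord -sumr_const; apply: ler_sum => m _.
    by rewrite nrmZ w1 mul1r; exact: Tbound.
  have rq0 : 0 <= r * q by apply: mulr_ge0; [exact: ltW|].
  pose K := k * nrm (psi i') * nrm (psi i).
  have K0 : 0 <= K by rewrite !mulr_ge0 ?nrm_ge0 ?(ltW k_gt0).
  have [n0 hn0] := geometric_small rq0 rq_lt1 K e0.
  exists (maxn n0 j) => n nn.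
  have jn : (j < 2 ^ n)%N.
    by apply: leq_ltn_trans (ltn_expl n _) => //; exact: leq_trans (leq_maxr _ _) nn.
  have -> : X i i' = ip ((r ^+ j)%:C *: iter j B (psi i')) (psi i).
    by rewrite /X /kscale (ipZl hH).
  rewrite avE -(CnE n (psi i') jn) -(ipBl hH) opprB addrCA subrr addr0.
  apply: le_lt_trans (cauchy_schwarz hH _ _) _.
  apply: le_lt_trans (hn0 (2 ^ n)%N _); last first.
    by apply: leq_trans (leq_trans (leq_maxl _ _) nn) _; exact: ltnW (ltn_expl n _).
  have -> : K * (r * q) ^+ (2 ^ n) =
      r ^+ (2 ^ n) * (q ^+ (2 ^ n) * (k * nrm (psi i'))) * nrm (psi i).
    by rewrite exprMn /K; ring.
  rewrite nrmZ nrm_real ger0_norm ?exprn_ge0 ?(ltW r_gt0)//.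
  apply: ler_wpM2r; first exact: nrm_ge0.
  apply: ler_wpM2l; first by rewrite exprn_ge0 ?(ltW r_gt0).
  by apply: le_trans (iterBq _ _) _; apply: ler_wpM2l; [exact: exprn_ge0|].
have E : op_kernel (iter j B) = kscale (r^-1 ^+ j)%:C X.
  apply/funext => i; apply/funext => i'; rewrite /X /kscale mulrA -rmorphM/=.
  by rewrite exprVn mulVf ?rmorph1 ?mul1r// expf_neq0// gt_eqF.
split; first by rewrite E; exact: (bsa_scale bA).
rewrite E (bsa_norm_scale bA)// nrm_real ger0_norm ?exprn_ge0 ?invr_ge0 ?(ltW r_gt0)// mulrC.
by rewrite ler_wpM2r ?exprn_ge0 ?invr_ge0 ?(ltW r_gt0).
Qed.

End resolvents.

Let frameSK f : Sinv (S f) = f.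
Proof. exact: (frame_opK hH mpsi C1_gt0 C2_gt0 frame_bounds). Qed.
Let frameKS f : S (Sinv f) = f.
Proof. exact: (frame_opVK hH mpsi C1_gt0 C2_gt0 frame_bounds). Qed.
Let Slin a f g : S (a *: f + g) = a *: S f + S g.
Proof. exact: (frame_op_lin hH mpsi C2_gt0 frame_bounds). Qed.
Let Sinv_lin a f g : Sinv (a *: f + g) = a *: Sinv f + Sinv g.
Proof. by rewrite -[RHS]frameSK Slin !frameKS. Qed.
Let Sinv_le f : nrm (Sinv f) <= C1^-1 * nrm f.
Proof. exact: (nrm_frame_opV_le hH mpsi C1_gt0 C2_gt0 frame_bounds). Qed.

(* [Sinv = C2^-1 (1 + B + B^2 + ...)]. *)
Lemma neumann_step (F : H -> H) (phi s M : R) :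
  (forall a f g, F (a *: f + g) = a *: F f + F g) ->
  0 <= phi -> (forall f, nrm (F f) <= phi * nrm f) ->
  0 <= s -> s < 1 ->
  (forall n, A (op_kernel (fun f => F (iter n B f))) /\
     knorm A (op_kernel (fun f => F (iter n B f))) <= M * s ^+ n) ->
  exists M', forall n, A (op_kernel (fun f => F (Sinv (iter n B f)))) /\
     knorm A (op_kernel (fun f => F (Sinv (iter n B f)))) <= M' * s ^+ n.
Proof.
move=> Flin phi0 Fphi s0 s1 hF.
have M0 : 0 <= M.
  have [A0 N0] := hF 0%N; rewrite expr0 mulr1 in N0.
  by apply: le_trans N0; exact: (bsa_norm_ge0 bA).
have nt : nrm t = C2^-1 by rewrite nrm_real ger0_norm// invr_ge0 ltW.
have C20 : 0 <= C2^-1 by rewrite invr_ge0 ltW.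
exists (C2^-1 * M * (1 - s)^-1) => n.
pose D l := op_kernel (fun f => F (iter (n + l) B f)).
have AD l : A (D l) by exact: (hF _).1.
have ND l : knorm A (D l) <= M * s ^+ n * s ^+ l by rewrite -mulrA -exprD; exact: (hF _).2.
pose v m : ckernel R J := kscale t (fun i j => \sum_(l < m) D l i j).
have Asum m := (bsa_sum bA m AD).1.
apply: (geometric_limit_mem nu_atom admA (u := v) (a := C2^-1 * M * s ^+ n) (s := s)) => //.
- by move=> m; apply: (bsa_scale bA).
- move=> m; rewrite (bsa_norm_scale bA)// nt -!mulrA ler_wpM2l//.
  apply: le_trans (bsa_sum bA m AD).2 _.
  apply: (@le_trans _ _ (\sum_(l < m) M * s ^+ n * s ^+ l)); first exact: ler_sum.
  rewrite -mulr_sumr -mulrA ler_wpM2l// mulrC ler_wpM2r ?exprn_ge0//.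
  exact: sum_geometric_le.
- move=> m.
  have -> : ksub (v m.+1) (v m) = kscale t (D m).
    apply/funext => i; apply/funext => j; rewrite /ksub /kadd /v /kscale mulN1r.
    by rewrite big_ord_recr/= mulrDr addrAC subrr add0r.
  by rewrite (bsa_norm_scale bA)// nt -!mulrA ler_wpM2l// mulrA.
move=> i j e e0.
pose K := phi * (C1^-1 * nrm (psi j)) * nrm (psi i).
have [N hN] := geometric_small q_ge0 q_lt1 K e0.
exists N => m Nm.
(* [t S = 1 - B] makes the Neumann series telescope: its partial sums are
   [F Sinv B^n - F Sinv B^(n+m)], and the last term decays like [q^(n+m)]. *)
have step l : t *: F (iter l B (psi j)) = F (Sinv (iter l B (psi j))) - F (Sinv (iter l.+1 B (psi j))).
  rewrite -(lin_funB Flin) -(lin_funB Sinv_lin) iterS -tS.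
  by rewrite (lin_funZ Sinv_lin) frameSK (lin_funZ Flin).
have vE : v m i j = ip (F (Sinv (iter n B (psi j))) - F (Sinv (iter (n + m) B (psi j)))) (psi i).
  rewrite /v /kscale /D; elim: m {Nm} => [|m IH].
    by rewrite big_ord0 mulr0 addn0 subrr (ip0l hH).
  rewrite big_ord_recr/= mulrDr IH -(ipZl hH) step -(ipDl hH) addnS.
  by rewrite addrA subrK.
rewrite vE /op_kernel -(ipBl hH) addrAC subrr add0r (ipNl hH) nrmN.
apply: le_lt_trans (cauchy_schwarz hH _ _) _; apply: le_lt_trans (hN (n + m)%N _); last first.
  by apply: leq_trans Nm _; rewrite leq_addl.
rewrite /K mulrAC ler_wpM2r ?nrm_ge0//; apply: le_trans (Fphi _) _.
rewrite -mulrA ler_wpM2l//; apply: le_trans (Sinv_le _) _.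
rewrite -mulrA ler_wpM2l ?invr_ge0 ?(ltW C1_gt0)// mulrC; exact: iterBq.
Qed.

Lemma gram_dual_mem : A (gram ip (fun i => Sinv (psi i)) (fun i => Sinv (psi i))).
Proof.
have /choice[T hT] : forall z : R[i], exists T : H -> H, nrm z = r ->
    (forall f, T (f - z *: B f) = f) /\ (forall f, T f - z *: B (T f) = f).
  move=> z; have [zr|zr] := eqVneq (nrm z) r; last first.
    (* [T] has to be total; its values off the circle [nrm z = r] do not enter. *)
    by exists id => h; rewrite h eqxx in zr.
  have zq : nrm z * q < 1 by rewrite zr.
  have [T hT] := resolvent_exists hH Blin Bsym q_ge0 Bq zq.
  by exists T.
have [M hM] := iter_contraction_bound (fun z zr => (hT z zr).1) (fun z zr => (hT z zr).2).
have rV0 : 0 <= r^-1 by rewrite invr_ge0 ltW.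
have rV1 : r^-1 < 1 by rewrite invf_lt1.
have id_le f : nrm (id f : H) <= 1 * nrm f by rewrite mul1r.
(* [neumann_step] keeps the powers of [B] and the rate [r^-1], so that it can be iterated: from [id]
   to [Sinv], then to [Sinv Sinv]. The power zero is the dual Gramian. *)
have [M1 hM1] := neumann_step (F := id) (fun _ _ _ => erefl) ler01 id_le rV0 rV1 hM.
have [|M2 hM2] := neumann_step Sinv_lin _ Sinv_le rV0 rV1 hM1.
  by rewrite invr_ge0 ltW.
have [h _] := hM2 0%N.
rewrite (_ : gram _ _ _ = op_kernel (fun f => Sinv (Sinv (iter 0 B f))))//.
apply/funext => i; apply/funext => j.
by rewrite /gram /op_kernel [RHS](frame_opV_sym hH mpsi C1_gt0 C2_gt0 frame_bounds).
Qed.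

End dual_gram.

(** * Schur's test *)

Section countable_sums.
Context (R : realType) (I : choiceType).
Hypothesis countI : countable [set: I].
Implicit Types f : I -> \bar R.

(** Turns an [esum] over [I] into a series over [nat], for which integration term by term is
    available. The empty sets stand for the integers outside the range of the enumeration. *)
Lemma countable_singletons : exists D : nat -> set I,
  [/\ trivIset setT D, \bigcup_n D n = setT &
      forall n, D n = set0 \/ exists i, D n = [set i]].
Proof.
have /countable_injP[e einj] := countI.
exists (fun n => e @^-1` [set n]); split.
- apply/trivIsetP => m n _ _ mn; apply/seteqP; split => // i [/= em en].
  by move: mn; rewrite -em -en eqxx.
- by apply/seteqP; split => // i _; exists (e i).
- move=> n; have [[i ein]|ne] := pselect (exists i, e i = n); last first.
    by left; apply/seteqP; split => // i /= ein; apply: ne; exists i.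
  right; exists i; apply/seteqP; split => [j /= ejn|_ -> //].
  by apply: einj; rewrite ?inE// ejn.
Qed.

Lemma esum_finite_le f (b : \bar R) : (forall i, 0 <= f i)%E ->
  (forall J : {fset I}, (\sum_(i <- J) f i <= b)%E) -> (\esum_(i in setT) f i <= b)%E.
Proof.
move=> f0 fb; apply: ub_ereal_sup => _ [X [finX _] <-].
by rewrite fsbig_finite//.
Qed.

Lemma fset_sum_le_esum f (J : {fset I}) : (forall i, 0 <= f i)%E ->
  (\sum_(i <- J) f i <= \esum_(j in setT) f j)%E.
Proof.
move=> f0; apply: esum_ge; exists [set` J]; first by split.
by rewrite fsbig_finite// set_fsetK.
Qed.

Lemma esum_ge_term f i : (forall i, 0 <= f i)%E -> (f i <= \esum_(j in setT) f j)%E.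
Proof.
move=> f0; apply: esum_ge; exists [set i]; first by split => //; exact: finite_set1.
by rewrite fsbig_set1.
Qed.

Lemma esum_le_card f (S : {fset I}) (b : R) : (forall i, 0 <= f i <= b%:E)%E ->
  (forall i, i \notin S -> f i = 0%E) -> (\esum_(i in setT) f i <= (b *+ #|` S|)%:E)%E.
Proof.
move=> fb fS; have f0 i : (0 <= f i)%E by have /andP[] := fb i.
apply: esum_finite_le => // J.
have [->|[i0 _]] := fset_0Vmem J.
  rewrite big_seq_fset0 lee_fin; case: (fset_0Vmem S) => [->|[i _]].
    by rewrite cardfs0 mulr0n.
  by rewrite mulrn_wge0// -lee_fin; have /andP[h1 h2] := fb i; exact: le_trans h2.
have b0 : 0 <= b.
  by rewrite -lee_fin; have /andP[h1 h2] := fb i0; exact: le_trans h2.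
rewrite (bigID (mem S))/= [X in (_ + X)%E]big1 ?adde0; last by move=> i /fS.
apply: (@le_trans _ _ (\sum_(i <- J | i \in S) b%:E)%E).
  by apply: lee_sum => i _; have /andP[] := fb i.
rewrite sumEFin lee_fin big_const_seq iter_addr_0 ler_wpMn2l//.
rewrite -size_filter; apply: uniq_leq_size; first by rewrite filter_uniq// fset_uniq.
by move=> i; rewrite mem_filter => /andP[].
Qed.

Lemma esum_enum (D : nat -> set I) f : trivIset setT D -> \bigcup_n D n = setT ->
  (forall i, 0 <= f i)%E ->
  \esum_(i in setT) f i = (\sum_(n <oo) \esum_(i in D n) f i)%E.
Proof.
move=> tD UD f0; rewrite -UD esum_bigcupT// nneseries_esumT// => n.
exact: esum_ge0.
Qed.

Lemma measurable_esum d (T : measurableType d) (h : I -> T -> \bar R) :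
  (forall i x, 0 <= h i x)%E -> (forall i, measurable_fun setT (h i)) ->
  measurable_fun setT (fun x => \esum_(i in setT) h i x).
Proof.
move=> h0 mh; have [D [tD UD D1]] := countable_singletons.
under eq_fun => x do rewrite (esum_enum tD UD)//.
apply: ge0_emeasurable_sum => [n x _ _|n _]; first exact: esum_ge0.
have [->|[i ->]] := D1 n.
  by under eq_fun => x do rewrite esum_set0; exact: measurable_cst.
by rewrite (_ : (fun _ => _) = h i)//; apply/funext => x; rewrite esum_set1.
Qed.

Lemma integral_esum d (T : measurableType d) (mu : {measure set T -> \bar R})
    (h : I -> T -> \bar R) :
  (forall i x, 0 <= h i x)%E -> (forall i, measurable_fun setT (h i)) ->
  (\int[mu]_x (\esum_(i in setT) h i x) = \esum_(i in setT) \int[mu]_x h i x)%E.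
Proof.
move=> h0 mh; have [D [tD UD D1]] := countable_singletons.
rewrite (esum_enum tD UD); last by move=> i; exact: integral_ge0.
under eq_integral => x _ do rewrite (esum_enum tD UD)//.
rewrite integral_nneseries//.
- apply: eq_eseriesr => n _; have [->|[i ->]] := D1 n.
    under eq_integral do rewrite esum_set0.
    by rewrite esum_set0 integral0.
  under eq_integral do rewrite esum_set1//.
  by rewrite esum_set1// integral_ge0.
- move=> n; have [->|[i ->]] := D1 n.
    by under eq_fun => x do rewrite esum_set0; exact: measurable_cst.
  by rewrite (_ : (fun _ => _) = h i)//; apply/funext => x; rewrite esum_set1.
- by move=> n x _; exact: esum_ge0.
Qed.

End countable_sums.

Section measure_facts.
Context (R : realType) d (T : measurableType d) (mu : {measure set T -> \bar R}).
Hypothesis sf : sigma_finite setT mu.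

(** Sigma-finiteness is here a hypothesis on [mu]; the same measure is repackaged with that
    structure so that Tonelli's theorem can be applied to it. *)
Lemma tonelli_measurable (f : T * T -> \bar R) : measurable_fun setT f ->
  (forall z, 0 <= f z)%E -> measurable_fun setT (fun x => \int[mu]_y f (x, y))%E.
Proof.
pose m := HB.pack_for (sigma_finite_measure T R) (Measure.sort mu)
  (isSFinite.Build _ _ _ (Measure.sort mu) (sfinite_measure_sigma_finite sf))
  (isSigmaFinite.Build _ _ _ (Measure.sort mu) sf).
move=> mf f0; exact: (@measurable_fun_fubini_tonelli_F _ _ _ _ _ m _ mf f0).
Qed.

Lemma tonelli_swap (f : T * T -> \bar R) : measurable_fun setT f ->
  (forall z, 0 <= f z)%E ->
  (\int[mu]_x \int[mu]_y f (x, y) = \int[mu]_y \int[mu]_x f (x, y))%E.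
Proof.
pose m := HB.pack_for (sigma_finite_measure T R) (Measure.sort mu)
  (isSFinite.Build _ _ _ (Measure.sort mu) (sfinite_measure_sigma_finite sf))
  (isSigmaFinite.Build _ _ _ (Measure.sort mu) sf).
move=> mf f0; exact: (@fubini_tonelli _ _ _ _ _ m m _ mf f0).
Qed.

Lemma ae_xsection (P : T * T -> Prop) : {ae (mu \x mu)%E, forall z, P z} ->
  {ae mu, forall x, {ae mu, forall y, P (x, y)}}.
Proof.
move=> [N [mN N0 PN]].
have mphi : measurable_fun setT (mu \o xsection N).
  pose m := HB.pack_for (sigma_finite_measure T R) (Measure.sort mu)
    (isSFinite.Build _ _ _ (Measure.sort mu) (sfinite_measure_sigma_finite sf))
    (isSigmaFinite.Build _ _ _ (Measure.sort mu) sf).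
  exact: (@measurable_fun_xsection _ _ _ _ _ m).
have : (\int[mu]_x `|(mu \o xsection N) x| = 0)%E.
  by under eq_integral do rewrite gee0_abs//.
move=> /(ae_eq_integral_abs mu measurableT mphi); apply: filterS => x /= /(_ I) Nx0.
exists (xsection N x); split => //; first exact: measurable_xsection.
by move=> y /= nPxy; rewrite /xsection/= inE; exact: PN.
Qed.

Lemma ae_fst (P : T -> Prop) : {ae mu, forall x, P x} ->
  {ae (mu \x mu)%E, forall z, P z.1}.
Proof.
move=> [N [mN N0 PN]]; exists (N `*` setT); split.
- exact: measurableX.
(* The section over [x] is everything or empty. If [mu setT] is infinite, the convention that zero
   times infinity is zero concludes. *)
- rewrite /product_measure1 (eq_integral (fun x => mu setT * (\1_N x)%:E)%E); last first.
    move=> x _ /=; rewrite indicE; have [xN|xN] := boolP (x \in N).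
      rewrite mule1; congr (mu _); apply/seteqP; split => // y _.
      by rewrite /xsection/= inE; split => //; exact: set_mem.
    rewrite mule0; rewrite (_ : xsection _ _ = set0) ?measure0//.
    apply/seteqP; split => // y; rewrite /xsection/= inE => -[/= Nx _].
    by move: xN; rewrite notin_setE.
  by rewrite ge0_integralZl//; [rewrite integral_indic// setIT N0 mule0|
    exact/measurable_EFinP/measurable_indic].
- by move=> [x y] /= nP; split => //; exact: PN.
Qed.

(** Cauchy-Schwarz for [(h sqrt o) (sqrt o)] and the bound in [oy] give [g^2 <= k w], where [w] is
    the action of the transposed kernel on [h^2]. Tonelli and the bound in [ox] give that the
    integral of [w] is at most [k a]. *)
Lemma schur_test (o : T -> T -> R) (h : T -> R) (k a : R) :
  measurable_fun setT (fun z : T * T => o z.1 z.2) -> (forall x y, 0 <= o x y) ->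
  measurable_fun setT h -> (forall x, 0 <= h x) -> 0 < k -> 0 <= a ->
  {ae mu, forall x, (\int[mu]_y (o x y)%:E <= k%:E)%E} ->
  {ae mu, forall y, (\int[mu]_x (o x y)%:E <= k%:E)%E} ->
  (\int[mu]_x (h x ^+ 2)%:E <= a%:E)%E ->
  let g y := (\int[mu]_x (h x * o x y)%:E)%E in
  [/\ measurable_fun setT g, {ae mu, forall y, (g y < +oo)%E} &
      (\int[mu]_y (fine (g y) ^+ 2)%:E <= (k ^+ 2 * a)%:E)%E].
Proof.
move=> mo o0 mh h0 k0 a0 ox oy ha g.
have mo' : measurable_fun setT (fun z : T * T => o z.2 z.1).
  exact: (measurableT_comp mo (@measurable_swap _ _ T T)).
have mox y : measurable_fun setT (o ^~ y).
  exact: (measurableT_comp mo (measurable_pair2 y)).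
have mho n : measurable_fun setT (fun z : T * T => (h z.2 ^+ n * o z.2 z.1)%:E).
  apply/measurable_EFinP; apply: measurable_funM => //; apply: measurable_funX.
  exact: (measurableT_comp mh measurable_snd).
have g0 y : (0 <= g y)%E by apply: integral_ge0 => x _; rewrite lee_fin mulr_ge0.
have mg : measurable_fun setT g.
  have := tonelli_measurable (mho 1%N) (fun z => _); apply => z.
  by rewrite lee_fin mulr_ge0// exprn_ge0.
pose w y := (\int[mu]_x (h x ^+ 2 * o x y)%:E)%E.
have w0 y : (0 <= w y)%E by apply: integral_ge0 => x _; rewrite lee_fin mulr_ge0 ?sqr_ge0.
have mw : measurable_fun setT w.
  have := tonelli_measurable (mho 2%N) (fun z => _); apply => z.
  by rewrite lee_fin mulr_ge0// exprn_ge0.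
have wle : (\int[mu]_y w y <= (k * a)%:E)%E.
  rewrite /w (tonelli_swap (mho 2%N)); last by move=> z; rewrite lee_fin mulr_ge0 ?sqr_ge0.
  apply: (@le_trans _ _ (\int[mu]_x (k%:E * (h x ^+ 2)%:E))%E).
    apply: ae_ge0_le_integral => //.
    - by move=> x _; apply: integral_ge0 => y _; rewrite lee_fin mulr_ge0 ?sqr_ge0.
    - have mz : measurable_fun setT (fun z : T * T => (h z.1 ^+ 2 * o z.1 z.2)%:E).
        apply/measurable_EFinP; apply: measurable_funM => //; apply: measurable_funX.
        exact: (measurableT_comp mh measurable_fst).
      by apply: (tonelli_measurable mz) => z; rewrite lee_fin mulr_ge0 ?sqr_ge0.
    - by move=> x _; rewrite mule_ge0// lee_fin ?sqr_ge0 ?ltW.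
    - by apply: measurable_funeM; exact/measurable_EFinP/measurable_funX.
    - apply: filterS ox => x oxk _ /=.
      under eq_integral do rewrite EFinM.
      rewrite ge0_integralZl_EFin ?sqr_ge0//.
      + by rewrite muleC lee_wpmul2r// lee_fin sqr_ge0.
      + by move=> y _; rewrite lee_fin.
      + by apply/measurable_EFinP; exact: (measurableT_comp mo (measurable_pair1 x)).
  rewrite ge0_integralZl_EFin ?(ltW k0)//.
  - by rewrite EFinM lee_wpmul2l// lee_fin ltW.
  - by move=> x _; rewrite lee_fin sqr_ge0.
  - exact/measurable_EFinP/measurable_funX.
have wfin : {ae mu, forall y, (w y < +oo)%E}.
  have /integrable_ae : mu.-integrable setT w.
    apply/integrableP; split => //.
    by under eq_integral do rewrite gee0_abs//; exact: le_lt_trans wle (ltry _).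
  move=> /(_ measurableT); apply: filterS => y /(_ I).
  by rewrite ge0_fin_numE.
have gw : {ae mu, forall y, (g y < +oo)%E /\ fine (g y) ^+ 2 <= k * fine (w y)}.
  apply: filterS2 oy wfin => y oyk wy.
  have := @integral_cauchy_schwarz _ _ _ mu (fun x => h x * Num.sqrt (o x y))
     (fun x => Num.sqrt (o x y)) (fine (w y)) k.
  have mso : measurable_fun setT (fun x => Num.sqrt (o x y)).
    exact: (measurableT_comp (continuous_measurable_fun (@sqrt_continuous R)) (mox y)).
  have so x : Num.sqrt (o x y) ^+ 2 = o x y by rewrite sqr_sqrtr.
  move=> /(_ (measurable_funM mh mso) mso); have -> : (fun x => (h x * Num.sqrt (o x y) * Num.sqrt (o x y))%:E) = fun x => (h x * o x y)%:E.
    by apply/funext => x; rewrite -mulrA -expr2 so.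
  move=> /(_ (fun x => mulr_ge0 (h0 x) (sqrtr_ge0 _)) (fun x => sqrtr_ge0 _)).
  under eq_integral do rewrite exprMn so.
  rewrite fineK ?ge0_fin_numE// => /(_ (lexx _)).
  under eq_integral do rewrite so.
  move=> /(_ oyk) gle.
  have gfin : (g y < +oo)%E by exact: le_lt_trans gle (ltry _).
  split=> //; move: gle; rewrite -/(g y) -[X in (X <= _)%E]fineK ?ge0_fin_numE// lee_fin => gle.
  have -> : k * fine (w y) = Num.sqrt (fine (w y) * k) ^+ 2.
    by rewrite sqr_sqrtr 1?mulrC// mulr_ge0 ?fine_ge0// ltW.
  by rewrite ler_sqr ?nnegrE ?sqrtr_ge0 ?fine_ge0.
split=> //; first by apply: filterS gw => y [].
apply: (@le_trans _ _ (\int[mu]_y (k%:E * w y))%E).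
  apply: ae_ge0_le_integral => //.
  - by move=> y _; rewrite lee_fin sqr_ge0.
  - by apply/measurable_EFinP/measurable_funX; exact: (measurableT_comp (fine_measurable measurableT) mg).
  - by move=> y _; rewrite mule_ge0// lee_fin ltW.
  - exact: measurable_funeM.
  - apply: filterS2 gw wfin => y [_ h1] h2 _.
    by rewrite -[w y]fineK ?ge0_fin_numE// -EFinM lee_fin.
rewrite ge0_integralZl_EFin ?(ltW k0)//.
by rewrite expr2 -mulrA EFinM lee_wpmul2l// lee_fin ltW.
Qed.

End measure_facts.

(** * Coverings *)

Section borel_facts.
Context (R : realType) (X : ptopologicalType).

Lemma continuous_borel_measurable (f : X -> R) : continuous f ->
  measurable_fun setT (f : borel X -> R).
Proof.
move=> /continuousP cf; apply: (measurability _ (RGenOpens.measurableE R)).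
move=> _ [_ [a [b ->] <-]]; rewrite setTI; apply: sub_sigma_algebra.
exact/cf/interval_open.
Qed.

Lemma continuous_cmeasurable (f : X -> R[i]) :
  continuous (f : X -> (R[i])^o) -> cmeasurable (f : borel X -> R[i]).
Proof.
move=> cf; split; apply: continuous_borel_measurable => x; apply/cvgrPdist_lt => e e0;
  have /cvgrPdist_lt/(_ e%:C) := cf x; rewrite ltcR => /(_ e0); apply: filterS => y /=;
  rewrite nrmE ltcR; apply: le_lt_trans.
- by rewrite -ReB; exact: Re_le_nrm.
- apply: le_trans (Im_le_nrm _).
  by case: (f x) (f y) => [? ?] [? ?].
Qed.

Lemma closed_borel (K : set X) : closed K -> measurable (K : set (borel X)).
Proof.
move=> cK; rewrite -[K]setCK; apply: measurableC; apply: sub_sigma_algebra.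
by rewrite /= openC.
Qed.

Variable mu : {measure set (borel X) -> \bar R}.
Hypotheses (hX : hausdorff_space X) (scX : sigma_compact X) (rmu : radon_measure mu).

Lemma radon_sigma_finite : sigma_finite setT mu.
Proof.
have [K [cK UK]] := scX; exists K; first by rewrite UK.
move=> n; split; last exact: (radon_compact rmu).
by apply: closed_borel; apply: (compact_closed hX); exact: cK.
Qed.

Lemma precompact_finite_measure (B : set X) : measurable (B : set (borel X)) ->
  precompact B -> (mu B < +oo)%E.
Proof.
rewrite precompactE => mB cB; apply: le_lt_trans (radon_compact rmu cB).
apply: le_measure; rewrite ?inE//; last exact: subset_closure.
by apply: closed_borel; exact: closed_closure.
Qed.

End borel_facts.

Section covering.
Context (R : realType) (X : ptopologicalType) (mu : {measure set (borel X) -> \bar R}).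
Context (I : pointedType) (U : I -> set X).
Hypotheses (hX : hausdorff_space X) (scX : sigma_compact X) (rmu : radon_measure mu).
Hypotheses (covU : admissible_covering U) (modU : moderate_covering mu U).

Let mU i : measurable (U i : set (borel X)) := cov_measurable covU i.

Lemma cover_mass i : (0 < mu (U i) < +oo)%E.
Proof.
have [D D0 /(_ i) hD] := mod_lower modU.
apply/andP; split; first by apply: lt_le_trans hD; rewrite lte_fin.
exact: (precompact_finite_measure rmu (mU i) (cov_precompact covU i)).
Qed.

Lemma cover_point x : exists i, U i x.
Proof. by have : setT x by []; rewrite -(cov_cover covU) => -[i _ Ux]; exists i. Qed.

(** All cells through [x] meet any given cell through [x], to which the overlap bound applies. *)
Lemma cover_multiplicity : exists N : nat, forall x : X,
  finite_set [set i | U i x] /\ (#|` fset_set [set i | U i x]| <= N)%N.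
Proof.
have [N hN] := cov_overlap covU; exists N => x.
have [j Ujx] := cover_point x.
have h : ([set i | U i x] #<= `I_N)%card.
  apply: card_le_trans (hN j); apply: subset_card_le => i /= Uix.
  by exists x; split.
by split; [exact: card_le_finite h (finite_II N)|exact: geq_card_fset_set].
Qed.

Lemma esum_cover_le (h : I -> R) (b : R) (N : nat) x :
  finite_set [set i | U i x] -> (#|` fset_set [set i | U i x]| <= N)%N ->
  (forall i, U i x -> 0 <= h i <= b) -> 0 <= b ->
  (\esum_(i in setT) ((\1_(U i) x * h i)%:E : \bar R) <= (b *+ N)%:E)%E.
Proof.
move=> fS cS hb b0.
apply: (@le_trans _ _ (b *+ #|` fset_set [set i | U i x]|)%:E); last first.
  by rewrite lee_fin ler_wpMn2l.
apply: esum_le_card => i; rewrite indicE.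
  have [Ux|Ux] := boolP (x \in U i); rewrite ?mul1r ?mul0r ?lexx ?lee_fin//.
  by apply: hb; exact: set_mem.
rewrite in_fset_set// => /negP Ux; rewrite memNset ?mul0r// => /mem_set.
by move: Ux; rewrite !inE.
Qed.

(** A cell has positive measure, so it meets some compact [K n] in positive measure. For each
    threshold [1 / (k + 1)] only finitely many cells exceed it on [K n], because by bounded
    multiplicity the measures of [U i] within [K n] add up to at most [N] times the measure of
    [K n]. *)
Lemma cover_countable : countable [set: I].
Proof.
have [N hN] := cover_multiplicity.
have [K [cK UK]] := scX.
have mK n : measurable (K n : set (borel X)).
  by apply: closed_borel; apply: (compact_closed hX); exact: cK.
have muK n : (mu (K n) < +oo)%E by exact: (radon_compact rmu).
pose B n k := [set i | (k.+1%:R^-1%:E < mu (U i `&` K n))%E].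
have finB n k : finite_set (B n k).
  apply: contrapT => /infinite_set_fset infB.
  pose c := fine (mu (K n)) *+ N.
  have c0 : 0 <= c by rewrite mulrn_wge0// fine_ge0.
  (* More than [c (k + 1)] cells of measure above [1 / (k + 1)] would exceed the total [c]. *)
  have [J JB cJ] := infB (Num.bound (c * k.+1%:R)).
  have key : (\sum_(i <- J) mu (U i `&` K n) <= c%:E)%E.
    have -> : (\sum_(i <- J) mu (U i `&` K n) =
        \int[mu]_(x in (K n : set (borel X))) (\sum_(i <- J) (\1_(U i) x)%:E))%E.
      rewrite ge0_integral_sum//.
      - by apply: eq_bigr => i _; rewrite integral_indic.
      - by move=> i; apply/measurable_EFinP; apply: measurable_indic; exact: mU.
    apply: (@le_trans _ _ (\int[mu]_(x in (K n : set (borel X))) (N%:R)%:E)%E).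
      apply: ge0_le_integral => //.
      - by move=> x _; apply: sume_ge0 => i _; rewrite lee_fin.
      - apply: emeasurable_sum => i; apply/measurable_EFinP.
        by apply: measurable_indic; exact: mU.
      - move=> x _; have [fS cS] := hN x.
        apply: le_trans (fset_sum_le_esum (f := fun i => (\1_(U i) x)%:E) J _) _.
          by move=> i; rewrite lee_fin.
        under eq_esum do rewrite -[X in X%:E]mulr1.
        by apply: (esum_cover_le fS cS (b := 1)) => // i _; rewrite ler01 lexx.
    by rewrite integral_cst// /c -[fine _ *+ N]mulr_natl EFinM fineK// ge0_fin_numE.
  have : (\sum_(i <- J) (k.+1%:R^-1 : R)%:E <= c%:E)%E.
    apply: le_trans key; rewrite big_seq_cond [X in (_ <= X)%E]big_seq_cond.
    by apply: lee_sum => i /andP[iJ _]; apply/ltW/JB.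
  rewrite sumEFin lee_fin big_const_seq iter_addr_0 count_predT -[leLHS]mulr_natl.
  rewrite ler_pdivrMr// => h.
  have := archi_boundP (_ : 0 <= c * k.+1%:R); rewrite mulr_ge0// => /(_ isT).
  rewrite ltNge => /negP; apply; apply: le_trans h.
  by rewrite ler_nat.
apply: (@sub_countable _ _ _ (\bigcup_n \bigcup_k B n k)); last first.
  by apply: bigcup_countable => // n _; apply: bigcup_countable => // k _; exact: finite_set_countable.
apply: subset_card_le => i _.
have [n Un] : exists n, (0 < mu (U i `&` K n))%E.
  apply: contrapT => h; have /andP[mi _] := cover_mass i.
  have : mu (U i) = 0.
    apply/negligibleP; first exact: mU.
    rewrite -[U i]setIT -UK setI_bigcupr; apply: negligible_bigcup => n.
    apply/negligibleP; first exact: measurableI.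
    apply/eqP; rewrite eq_le measure_ge0 andbT leNgt; apply/negP => Un.
    by apply: h; exists n.
  by move=> mi0; rewrite mi0 ltxx in mi.
have Ufin : (mu (U i `&` K n) < +oo)%E.
  apply: le_lt_trans (muK n); apply: le_measure; rewrite ?inE//; exact: measurableI.
have u0 : 0 < fine (mu (U i `&` K n)) by rewrite fine_gt0// Un.
have [k _ hk] := near_infty_natSinv_lt (PosNum u0).
exists n => //; exists k => //; rewrite /B/= -[X in (_ < X)%E]fineK ?ge0_fin_numE//.
by rewrite lte_fin; exact: hk k (leqnn k).
Qed.

End covering.

(** * Sampling *)

Section sampling.
Context (R : realType) (X : ptopologicalType) (mu : {measure set (borel X) -> \bar R}).
Context (I : pointedType) (U : I -> set X).
Hypotheses (hX : hausdorff_space X) (scX : sigma_compact X) (rmu : radon_measure mu).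
Hypotheses (covU : admissible_covering U) (modU : moderate_covering mu U).
Context (H : completeNormedModType R[i]) (ip : H -> H -> R[i]).
Hypothesis hH : hilbert_space ip.
Variables (psi : borel X -> H) (C1 C2 : R).
Hypothesis mpsi : forall f, cmeasurable (fun x => ip f (psi x)).
Hypotheses (C1_gt0 : 0 < C1) (C2_gt0 : 0 < C2).
Hypothesis frame_bounds : forall f, ((C1 * nrm f ^+ 2)%:E <=
  \int[mu]_x ((nrm (ip f (psi x)) ^+ 2)%:E) <= (C2 * nrm f ^+ 2)%:E)%E.
Hypothesis bound_psi : norm_bounded psi.

Local Notation V := (analysis ip psi).
Local Notation Rk := (frame_kernel ip mu psi).

Let mU i : measurable (U i : set (borel X)) := cov_measurable covU i.
Let sf : sigma_finite setT mu := radon_sigma_finite hX scX rmu.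

Definition oscR (z w : borel X) : R := complex.Re (osc U Rk z w).

Lemma oscE z w : osc U Rk z w = (oscR z w)%:C. Proof. by []. Qed.

Let osc_set z w := [set nrm (Rk z w - Rk z w') | w' in \bigcup_(i in [set i | U i w]) U i].

(** A supremum in [R] bounds its set only if the set is bounded; here the bound comes from the
    uniform bound on [psi]. *)
Let has_sup_osc z w : has_sup (osc_set z w).
Proof.
split.
  have [i Uiw] := cover_point covU w.
  by exists (nrm (Rk z w - Rk z w)), w => //; exists i.
have [M psiM] := bound_psi.
have RM u v := nrm_frame_kernel_le hH mpsi C1_gt0 C2_gt0 frame_bounds u v psiM.
exists (M * (C1^-1 * M) + M * (C1^-1 * M)) => _ [w' _ <-].
by apply: le_trans (nrmD _ _) _; rewrite nrmN; exact: lerD.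
Qed.

Lemma le_oscR i z w w' : U i w -> U i w' -> nrm (Rk z w - Rk z w') <= oscR z w.
Proof.
move=> Uw Uw'; apply: (sup_upper_bound (has_sup_osc z w)).
by exists w' => //; exists i.
Qed.

Lemma oscR_ge0 z w : 0 <= oscR z w.
Proof.
have [i Uiw] := cover_point covU w.
exact: le_trans (nrm_ge0 _) (le_oscR z Uiw Uiw).
Qed.

Hypothesis mosc : measurable_fun setT (fun z : borel X * borel X => oscR z.1 z.2).

Let mosc1 w : measurable_fun setT (oscR ^~ w).
Proof. exact: (measurableT_comp mosc (measurable_pair2 w)). Qed.

(* The reproducing formula [V f w = \int V f z * Rk w z dz] and the hermitian
   symmetry of [Rk] bound the oscillation of [V f] by that of [Rk]. *)
Lemma analysis_osc_le f i w w' : U i w -> U i w' ->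
  ((nrm (V f w' - V f w))%:E <= \int[mu]_z (nrm (V f z) * oscR z w)%:E)%E.
Proof.
move=> Uw Uw'.
have LV := L2_analysis mpsi frame_bounds f.
have LR u := L2_frame_kernel hH mpsi frame_bounds u.
have rep u := frame_kernel_reproducing hH mpsi C1_gt0 C2_gt0 frame_bounds f u.
rewrite (rep w) (rep w') -cintegralB; last 2 first.
- by have [] := L2_cintegrableM LV (LR w').
- by have [] := L2_cintegrableM LV (LR w).
have mV := mpsi f.
apply: le_trans (nrm_cintegral_le _ _) _.
  have [m1 _] := LR w; have [m2 _] := LR w'.
  have := cmeasurableD (cmeasurableM mV m2) (cmeasurableM (cmeasurable_cst _ (-1)) (cmeasurableM mV m1)).
  by congr cmeasurable; apply/funext => z; rewrite mulN1r.
apply: ge0_le_integral => //.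
- by move=> z _; rewrite lee_fin nrm_ge0.
- apply/measurable_EFinP/measurable_nrm.
  have [m1 _] := LR w; have [m2 _] := LR w'.
  have := cmeasurableD (cmeasurableM mV m2) (cmeasurableM (cmeasurable_cst _ (-1)) (cmeasurableM mV m1)).
  by congr cmeasurable; apply/funext => z; rewrite mulN1r.
- apply/measurable_EFinP/measurable_funM; last exact: mosc1.
  exact: measurable_nrm.
- move=> z _; rewrite lee_fin -mulrBr nrmM ler_wpM2l ?nrm_ge0//.
  rewrite (frame_kernelJ hH mpsi C1_gt0 C2_gt0 frame_bounds z w).
  rewrite (frame_kernelJ hH mpsi C1_gt0 C2_gt0 frame_bounds z w') -rmorphB nrmJ nrmBC.
  exact: le_oscR Uw Uw'.
Qed.

Section frame.
Variables (x : I -> X) (k : R).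
Hypotheses (xU : forall i, U i (x i)) (k_gt0 : 0 < k) (k_lt1 : k < 1).
Hypothesis osc_row : {ae mu, forall z, (\int[mu]_w (oscR z w)%:E <= k%:E)%E}.
Hypothesis osc_col : {ae mu, forall w, (\int[mu]_z (oscR z w)%:E <= k%:E)%E}.

Let countI : countable [set: I] := cover_countable hX scX rmu covU modU.

(** The weighted sum is the integral over [y] of the values [F (x i) ^+ 2], summed over the cells
    containing [y]. On such a cell [F (x i)] and [F y] differ by at most [G y], and the Schur test
    bounds the norm of [G] by [k] times that of [F]. At least one cell and at most [N] cells contain
    [y]. *)
Lemma sampled_frame_bounds : exists D1 D2 : R, [/\ 0 < D1, 0 < D2 & forall f,
  ((D1 * nrm f ^+ 2)%:E <=
   \esum_(i in setT) ((nrm (V f (x i)) ^+ 2)%:E * mu (U i)) <=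
   (D2 * nrm f ^+ 2)%:E)%E].
Proof.
have [N hN] := cover_multiplicity covU.
(* The upper constant comes from [(a + b)^2 <= 2 a^2 + 2 b^2] for each of at most [N] cells; the
   successor keeps it positive. *)
exists ((1 - k) ^+ 2 * C1), (2 * (1 + k ^+ 2) * C2 * N.+1%:R).
split.
- by rewrite mulr_gt0// exprn_gt0// subr_gt0.
- by rewrite !mulr_gt0// ltr_wpDr// sqr_ge0.
move=> f.
pose F z := nrm (V f z).
have mF : measurable_fun setT F by apply: measurable_nrm; exact: mpsi.
have F0 z : 0 <= F z by exact: nrm_ge0.
pose n2 := L2norm mu (V f) ^+ 2.
have n20 : 0 <= n2 by exact: sqr_ge0.
have Fn2 : (\int[mu]_z (F z ^+ 2)%:E = n2%:E)%E.
  by rewrite (L2normE (L2_analysis mpsi frame_bounds f)).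
have n2lo : C1 * nrm f ^+ 2 <= n2 by exact: (L2norm_analysis_ge mpsi frame_bounds f).
have n2hi : n2 <= C2 * nrm f ^+ 2.
  by rewrite -lee_fin -Fn2; have /andP[] := frame_bounds f.
have Fle : (\int[mu]_z (F z ^+ 2)%:E <= n2%:E)%E by rewrite Fn2.
have [mg gfin gle] := schur_test sf mosc oscR_ge0 mF F0 k_gt0 n20 osc_row osc_col Fle.
set g := (fun y => _) in mg gfin gle.
have g0 y : (0 <= g y)%E.
  by apply: integral_ge0 => z _; rewrite lee_fin mulr_ge0 ?oscR_ge0.
pose G y := fine (g y).
have mG : measurable_fun setT G by exact: (measurableT_comp (fine_measurable measurableT) mg).
have G0 y : 0 <= G y by exact: fine_ge0.
have oscF : {ae mu, forall y, forall i, U i y -> `|F (x i) - F y| <= G y}.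
  apply: filterS gfin => y gy i Uy.
  have := analysis_osc_le f Uy (xU i); rewrite -/(g y) -[X in (_ <= X)%E]fineK ?ge0_fin_numE//.
  rewrite lee_fin; apply: le_trans.
  have h1 := nrmD (V f (x i) - V f y) (V f y); have h2 := nrmD (V f y - V f (x i)) (V f (x i)).
  rewrite subrK -/(F _) -/(F _) in h1; rewrite subrK nrmBC -/(F _) -/(F _) in h2.
  by rewrite ler_norml; apply/andP; split; lra.
pose h i (y : borel X) : \bar R := (\1_(U i) y * F (x i) ^+ 2)%:E.
have h0 i y : (0 <= h i y)%E by rewrite lee_fin mulr_ge0 ?sqr_ge0.
have mh i : measurable_fun setT (h i).
  by apply/measurable_EFinP; apply: measurable_funM => //; apply: measurable_indic; exact: mU.
have -> : \esum_(i in setT) ((nrm (V f (x i)) ^+ 2)%:E * mu (U i))%E =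
    (\int[mu]_y (\esum_(i in setT) h i y))%E.
  rewrite integral_esum//; apply: eq_esum => i _.
  rewrite /h; under eq_integral do rewrite mulrC EFinM.
  rewrite ge0_integralZl_EFin ?sqr_ge0//.
  - by rewrite integral_indic ?setIT//; exact: mU.
  - by apply/measurable_EFinP; apply: measurable_indic; exact: mU.
have msum := measurable_esum countI h0 mh.
have m2 (K : borel X -> R) : measurable_fun setT K -> measurable_fun setT (fun y => (K y ^+ 2)%:E).
  by move=> mK; exact/measurable_EFinP/measurable_funX.
have sum0 y : (0 <= \esum_(i in setT) h i y)%E by exact: esum_ge0.
have lin2 (a b : R) : 0 <= a -> 0 <= b ->
    (\int[mu]_y (a%:E * (F y ^+ 2)%:E + b%:E * (G y ^+ 2)%:E) <=
     (a * n2 + b * (k ^+ 2 * n2))%:E)%E.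
  move=> a0 b0; rewrite ge0_integralD//; last 4 first.
  - by move=> y _; rewrite mule_ge0// lee_fin ?sqr_ge0.
  - by apply: measurable_funeM; exact: m2.
  - by move=> y _; rewrite mule_ge0// lee_fin ?sqr_ge0.
  - by apply: measurable_funeM; exact: m2.
  rewrite !ge0_integralZl_EFin//; [|by move=> y _; rewrite lee_fin sqr_ge0|exact: m2
    |by move=> y _; rewrite lee_fin sqr_ge0|exact: m2].
  by rewrite Fn2 EFinD -EFinM leeD2l// EFinM lee_wpmul2l.
apply/andP; split.
- suff key : (((1 - k) ^+ 2 * n2)%:E <= \int[mu]_y (\esum_(i in setT) h i y))%E.
    apply: le_trans key; rewrite lee_fin -mulrA ler_wpM2l// sqr_ge0//.
  have k1 : 0 < 1 - k by rewrite subr_gt0.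
  have ik : 0 <= (1 - k)^-1 by rewrite invr_ge0 ltW.
  (* By convexity [(a + b)^2 <= a^2 / (1 - k) + b^2 / k]. With these weights the square of [G]
     contributes exactly [k n2], which the left side absorbs; this is where [(1 - k)^2] comes
     from. *)
  have : (n2%:E <= (1 - k)^-1%:E * (\int[mu]_y (\esum_(i in setT) h i y)) + (k * n2)%:E)%E.
    rewrite -{1}Fn2.
    apply: (@le_trans _ _ (\int[mu]_y ((1 - k)^-1%:E * (\esum_(i in setT) h i y) +
        k^-1%:E * (G y ^+ 2)%:E))%E).
      apply: ae_ge0_le_integral => //.
      - by move=> y _; rewrite lee_fin sqr_ge0.
      - exact: m2.
      - by move=> y _; rewrite adde_ge0// mule_ge0// lee_fin ?sqr_ge0 ?invr_ge0 ?(ltW k_gt0).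
      - apply: emeasurable_funD; apply: measurable_funeM => //; exact: m2.
      - apply: (@filterS _ _ (ae_filter_ringOfSetsType mu) _ _ _ oscF) => y hy _.
        have [i Uy] := cover_point covU y.
        apply: (@le_trans _ _ ((1 - k)^-1%:E * h i y + k^-1%:E * (G y ^+ 2)%:E)%E); last first.
          apply: leeD2r; apply: lee_wpmul2l; first by rewrite lee_fin.
          exact: (esum_ge_term (f := h ^~ y) i).
        rewrite /h indicE mem_set// mul1r -!EFinM -EFinD lee_fin.
        have := hy i Uy; rewrite ler_norml => /andP[hm _].
        have hle : F y <= F (x i) + G y by lra.
        apply: (@le_trans _ _ ((F (x i) + G y) ^+ 2)).
          by rewrite ler_sqr ?nnegrE ?addr_ge0.
        rewrite -subr_ge0.
        have -> : (1 - k)^-1 * F (x i) ^+ 2 + k^-1 * G y ^+ 2 - (F (x i) + G y) ^+ 2 =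
           (k * F (x i) - (1 - k) * G y) ^+ 2 / (k * (1 - k)).
          by field; rewrite !gt_eqF.
        by rewrite divr_ge0 ?sqr_ge0// mulr_ge0 ?ltW.
    rewrite ge0_integralD//; last 4 first.
    - by move=> y _; rewrite mule_ge0// lee_fin.
    - exact: measurable_funeM.
    - by move=> y _; rewrite mule_ge0// lee_fin ?sqr_ge0 ?invr_ge0 ?(ltW k_gt0).
    - by apply: measurable_funeM; exact: m2.
    rewrite !ge0_integralZl_EFin ?invr_ge0 ?(ltW k_gt0) ?(ltW k1)//; [|by move=> y _; rewrite lee_fin sqr_ge0|exact: m2].
    rewrite leeD2l//; apply: (@le_trans _ _ (k^-1%:E * (k ^+ 2 * n2)%:E)%E).
      by rewrite lee_wpmul2l// lee_fin invr_ge0 ltW.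
    by rewrite -EFinM expr2 !mulrA mulVf ?gt_eqF// mul1r.
  set E := (\int[mu]_y _)%E; have E0 : (0 <= E)%E by exact: integral_ge0.
  move: E0; case: E => [e||] // e0; last by rewrite leey.
  rewrite -EFinM -EFinD !lee_fin => h1.
  have : (1 - k) * n2 <= (1 - k)^-1 * e by lra.
  by rewrite [leRHS]mulrC ler_pdivlMr// mulrAC -expr2.
- apply: (@le_trans _ _ (\int[mu]_y ((2 * N.+1%:R)%:E * (F y ^+ 2)%:E + (2 * N.+1%:R)%:E * (G y ^+ 2)%:E))%E).
    apply: ae_ge0_le_integral => //.
    + by move=> y _; rewrite adde_ge0// mule_ge0// lee_fin ?sqr_ge0 ?mulr_ge0.
    + by apply: emeasurable_funD; apply: measurable_funeM; exact: m2.
    + apply: (@filterS _ _ (ae_filter_ringOfSetsType mu) _ _ _ oscF) => y hy _; have [fS cS] := hN y.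
      apply: (@le_trans _ _ ((2 * (F y ^+ 2 + G y ^+ 2)) *+ N)%:E).
        apply: (esum_cover_le fS cS); last by rewrite mulr_ge0// addr_ge0// sqr_ge0.
        move=> i Uy; rewrite sqr_ge0/=.
        have := hy i Uy; rewrite ler_norml => /andP[_ hm].
        have hle : F (x i) <= F y + G y by lra.
        apply: (@le_trans _ _ ((F y + G y) ^+ 2)).
          by rewrite ler_sqr ?nnegrE ?addr_ge0.
        rewrite -subr_ge0; have -> : 2 * (F y ^+ 2 + G y ^+ 2) - (F y + G y) ^+ 2 = (F y - G y) ^+ 2 by ring.
        exact: sqr_ge0.
      rewrite -!EFinM -EFinD lee_fin -mulrDr -[leLHS]mulr_natr mulrAC.
      rewrite ler_wpM2r ?addr_ge0 ?sqr_ge0// ler_wpM2l// ler_nat//.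
  apply: le_trans (lin2 _ _ _ _) _; rewrite ?mulr_ge0// lee_fin.
  have -> : 2 * N.+1%:R * n2 + 2 * N.+1%:R * (k ^+ 2 * n2) = 2 * (1 + k ^+ 2) * N.+1%:R * n2 by ring.
  rewrite [leRHS](_ : _ = 2 * (1 + k ^+ 2) * N.+1%:R * (C2 * nrm f ^+ 2)); last by ring.
  by rewrite ler_wpM2l// !mulr_ge0// addr_ge0// sqr_ge0.
Qed.

End frame.
End sampling.

(** * Localization of the samples *)

Lemma card_fsetM_le (J J' : choiceType) (S : {fset J}) (S' : {fset J'}) :
  (#|` (S `*` S')%fset| <= #|` S| * #|` S'|)%N.
Proof.
rewrite -(size_allpairs pair S S'); apply: uniq_leq_size => [|[i j]].
  exact: fset_uniq.
by rewrite in_fsetM/= => /andP[iS jS]; exact: allpairs_f.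
Qed.

Section kernel_ae.
Context (R : realType) d (T : measurableType d) (mu : {measure set T -> \bar R}).

Lemma ae2W (P : T * T -> Prop) : (forall z, P z) -> {ae (mu \x mu)%E, forall z, P z}.
Proof.
move=> hP; exists set0; split => // [|z nPz]; last by have := nPz (hP z).
rewrite /product_measure1; apply: integral0_eq => x _ /=.
by rewrite xsection0 measure0.
Qed.

Hypothesis sf : sigma_finite setT mu.

Lemma ae2_filterI (P Q : T * T -> Prop) : {ae (mu \x mu)%E, forall z, P z} ->
  {ae (mu \x mu)%E, forall z, Q z} -> {ae (mu \x mu)%E, forall z, P z /\ Q z}.
Proof.
pose m := HB.pack_for (sigma_finite_measure T R) (Measure.sort mu)
  (isSFinite.Build _ _ _ (Measure.sort mu) (sfinite_measure_sigma_finite sf))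
  (isSigmaFinite.Build _ _ _ (Measure.sort mu) sf).
move=> hP hQ.
exact: (@filterI _ _ (ae_filter_ringOfSetsType (m \x m)%E) _ _ hP hQ).
Qed.

Lemma ae2_sub (P Q : T * T -> Prop) : (forall z, P z -> Q z) ->
  {ae (mu \x mu)%E, forall z, P z} -> {ae (mu \x mu)%E, forall z, Q z}.
Proof.
move=> PQ [N [mN N0 PN]]; exists N; split => // z nQ; apply: PN => Pz; exact/nQ/PQ.
Qed.

End kernel_ae.

Section real_kernels.
Context (R : realType) d (T : measurableType d) (mu : {measure set T -> \bar R}).

Lemma cintegral_real (h : T -> R) :
  cintegral mu (fun x => (h x)%:C) = (\int[mu]_x h x)%:C.
Proof.
rewrite /cintegral; congr (_ +i* _).
by rewrite /Rintegral integral0.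
Qed.

Lemma cintegrable_real (h : T -> R) : (forall x, 0 <= h x) ->
  cintegrable mu (fun x => (h x)%:C) ->
  measurable_fun setT h /\ (\int[mu]_x (h x)%:E = (\int[mu]_x h x)%:E)%E.
Proof.
move=> h0 [i1 _]; split; first by apply/measurable_EFinP; exact: measurable_int i1.
by rewrite /Rintegral fineK//; exact: integrable_fin_num i1.
Qed.

(** Converts the sum over the support in [lift_kernel] into an [esum], whose measurability in the
    parameters and whose bounds are available. *)
Lemma fsum_esum (J : choiceType) (f : J -> R) (S : set J) : finite_set S ->
  (forall j, 0 <= f j) -> (forall j, ~ S j -> f j = 0) ->
  ((\sum_(j \in [set: J]) f j)%:E = \esum_(j in setT) (f j)%:E)%E.
Proof.
move=> finS f0 fS.
have -> : \sum_(j \in [set: J]) f j = \sum_(j \in S) f j.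
  by apply/esym/fsbig_widen => // j [_ nSj]; exact: fS.
rewrite -fsumEFin//.
rewrite -esum_fset//; last by move=> j _; rewrite lee_fin.
rewrite esum_mkcond; apply: eq_esum => j _; case: ifPn => // /negP nSj.
by rewrite fS// => Sj; apply: nSj; exact: mem_set.
Qed.

End real_kernels.

Section localization.
Context (R : realType) (X : ptopologicalType) (mu : {measure set (borel X) -> \bar R}).
Context (I : pointedType) (U : I -> set X).
Hypotheses (hX : hausdorff_space X) (scX : sigma_compact X) (rmu : radon_measure mu).
Hypotheses (covU : admissible_covering U) (modU : moderate_covering mu U).
Context (H : completeNormedModType R[i]) (ip : H -> H -> R[i]).
Hypothesis hH : hilbert_space ip.
Variables (psi : borel X -> H) (C1 C2 : R).
Hypothesis mpsi : forall f, cmeasurable (fun x => ip f (psi x)).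
Hypotheses (C1_gt0 : 0 < C1) (C2_gt0 : 0 < C2).
Hypothesis frame_bounds : forall f, ((C1 * nrm f ^+ 2)%:E <=
  \int[mu]_x ((nrm (ip f (psi x)) ^+ 2)%:E) <= (C2 * nrm f ^+ 2)%:E)%E.
Hypothesis bound_psi : norm_bounded psi.
Variables (m : X -> X -> R) (A : kernel_space R (borel X)).
Hypothesis m_sym : forall x y, m x y = m y x.
Hypothesis admA : admissible_algebra mu A.
Hypothesis bimodA : bimodule mu (Am mu m) A.
Local Notation Rk := (frame_kernel ip mu psi).
Local Notation o := (oscR mu U ip psi).
Hypothesis osc_mem : Am mu m (osc U Rk).
Local Notation G := (gram ip psi psi).
Hypothesis G_mem : A G.
Variable x : I -> X.
Hypothesis xU : forall i, U i (x i).

Let bA := adm_banach admA.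
Let mU i : measurable (U i : set (borel X)) := cov_measurable covU i.
Let sf : sigma_finite setT mu := radon_sigma_finite hX scX rmu.
Let countI : countable [set: I] := cover_countable hX scX rmu covU modU.

Let mosc : measurable_fun setT (fun z : borel X * borel X => o z.1 z.2).
Proof. by have [[h _] _] := osc_mem. Qed.

Let o0 z w : 0 <= o z w.
Proof. exact: (oscR_ge0 covU hH mpsi C1_gt0 C2_gt0 frame_bounds bound_psi). Qed.

Let g y w : R := nrm (G y w).
Let gA : ckernel R (borel X) := fun y w => (g y w)%:C.
Let oA : ckernel R (borel X) := osc U Rk.

Let gA_mem : A gA.
Proof.
apply: (adm_solid admA _ G_mem _).1.
  by apply: cmeasurable_real; apply: measurable_nrm; exact: (bsa_measurable bA G_mem).
by apply: ae2W => z; rewrite /gA nrm_real ger0_norm// nrm_ge0.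
Qed.

(** The involution exchanges the row and the column suprema, the weight being symmetric. *)
Lemma Am_star K : Am mu m K -> Am mu m (kstar K).
Proof.
move=> [mK nK]; split.
  have := cmeasurableJ mK => -[h1 h2].
  by split; [exact: (measurableT_comp h1 (@measurable_swap _ _ _ _))|
             exact: (measurableT_comp h2 (@measurable_swap _ _ _ _))].
rewrite /normA1 maxC; move: nK; rewrite /normA1.
have E a b : nrm (kweight (kstar K) m a b) = nrm (kweight K m b a).
  by rewrite /kweight /kstar !nrmM nrmJ m_sym.
have e1 : (fun a => \int[mu]_b (nrm (kweight (kstar K) m a b))%:E)%E =
    (fun a => \int[mu]_b (nrm (kweight K m b a))%:E)%E.
  by apply/funext => a; apply: eq_integral => b _; rewrite E.
have e2 : (fun b => \int[mu]_a (nrm (kweight (kstar K) m a b))%:E)%E =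
    (fun b => \int[mu]_a (nrm (kweight K m b a))%:E)%E.
  by apply/funext => b; apply: eq_integral => a _; rewrite E.
by rewrite e1 e2.
Qed.

(* [g (x i) w <= k1 y w] for [y] in [U i], and [g (x i) (x j) <= k2 y w] for
   moreover [w] in [U j]; both kernels are obtained from [G] by composition
   with the oscillation and its adjoint. *)
Let k1 y w : R := g y w + \int[mu]_z (o z y * g z w).
Let k2 y w : R := k1 y w + \int[mu]_z (k1 y z * o z w).

Let g0 y w : 0 <= g y w. Proof. exact: nrm_ge0. Qed.
Let k10 y w : 0 <= k1 y w.
Proof. by rewrite addr_ge0// Rintegral_ge0// => z _; rewrite mulr_ge0. Qed.
Let k20 y w : 0 <= k2 y w.
Proof. by rewrite addr_ge0// Rintegral_ge0// => z _; rewrite mulr_ge0. Qed.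

Let K1 := kadd gA (kcomp mu (kstar oA) gA).
Let K1E : K1 = fun y w => (k1 y w)%:C.
Proof.
apply/funext => y; apply/funext => w; rewrite /K1 /kadd /kcomp /k1 rmorphD/=.
rewrite -cintegral_real; congr (_ + cintegral _ _); apply/funext => z.
by rewrite /kstar /oA oscE conjc_real rmorphM.
Qed.

(** The real integral in [k1] is the extended one only where the latter is finite. The absolute
    convergence contained in [bimodule] provides this almost everywhere. *)
Let K1_mem : A K1 /\ {ae (mu \x mu)%E, forall z,
   (\int[mu]_w (o w z.1 * g w z.2)%:E = (\int[mu]_w (o w z.1 * g w z.2))%:E)%E}.
Proof.
have [d1 A1 _ _] := bimodA (Am_star osc_mem) gA_mem.
split; first exact: (bsa_add bA).
apply: ae2_sub d1 => z /=.
rewrite (_ : (fun w => _) = fun w => (o w z.1 * g w z.2)%:C); last first.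
  by apply/funext => w; rewrite /kstar /oA oscE conjc_real rmorphM.
by move=> /cintegrable_real[] // w; rewrite mulr_ge0.
Qed.

Let K2 := kadd K1 (kcomp mu K1 oA).
Let K2E : K2 = fun y w => (k2 y w)%:C.
Proof.
apply/funext => y; apply/funext => w; rewrite /K2 /kadd K1E /kcomp /k2 [in RHS]rmorphD/=.
rewrite -cintegral_real; congr (_ + cintegral _ _); apply/funext => z.
by rewrite /oA oscE rmorphM.
Qed.

Let K2_mem : A K2 /\ {ae (mu \x mu)%E, forall z,
  measurable_fun setT (fun w => k1 z.1 w * o w z.2) /\
   (\int[mu]_w (k1 z.1 w * o w z.2)%:E = (\int[mu]_w (k1 z.1 w * o w z.2))%:E)%E}.
Proof.
have [_ _ d2 A2] := bimodA osc_mem K1_mem.1.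
split; first by apply: (bsa_add bA) => //; exact: K1_mem.1.
apply: ae2_sub d2 => z /=; rewrite K1E.
rewrite (_ : (fun w => _) = fun w => (k1 z.1 w * o w z.2)%:C); last first.
  by apply/funext => w; rewrite oscE rmorphM.
by move=> /cintegrable_real[] // w; rewrite mulr_ge0.
Qed.

Let osc_le f i w w' := analysis_osc_le covU hH mpsi C1_gt0 C2_gt0 frame_bounds bound_psi mosc f (i := i) (w := w) (w' := w').

Let analysis_le f i w : U i w ->
  ((nrm (ip f (psi (x i))))%:E <=
   (nrm (ip f (psi w)))%:E + \int[mu]_z (nrm (ip f (psi z)) * o z w)%:E)%E.
Proof.
move=> Uw; have h := osc_le f Uw (xU i).
apply: (@le_trans _ _ ((nrm (ip f (psi w)))%:E + (nrm (analysis ip psi f (x i) - analysis ip psi f w))%:E)%E).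
  rewrite -EFinD lee_fin addrC; have := nrmD (analysis ip psi f (x i) - analysis ip psi f w) (analysis ip psi f w).
  by rewrite subrK.
by rewrite leeD2l.
Qed.

(** [analysis_le] at [f = psi w] moves the first variable from [x i] to [y]; the exceptional pairs
    are those where the integral in [k1] is not the extended one. *)
Let first_bound : {ae (mu \x mu)%E, forall z, forall i, U i z.1 -> g (x i) z.2 <= k1 z.1 z.2}.
Proof.
apply: ae2_sub K1_mem.2 => -[y w] /= hyw i Uy.
have := analysis_le (psi w) Uy.
rewrite -lee_fin /k1 EFinD -hyw.
by under [X in (_ <= _ + X)%E -> _]eq_integral do rewrite mulrC.
Qed.

(** [analysis_le] at [f = psi (x i)] moves the second variable from [x j] to [w]. Under the integral
    [first_bound] is needed at [(y, z)] for almost all [z], which [ae_xsection] provides for almost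
    all [y]. *)
Let second_bound : {ae (mu \x mu)%E, forall z, forall i j,
  U i z.1 -> U j z.2 -> g (x i) (x j) <= k2 z.1 z.2}.
Proof.
have h1 := ae_fst (mu := mu) (ae_xsection sf first_bound).
apply: ae2_sub (ae2_filterI sf (ae2_filterI sf first_bound h1) K2_mem.2).
move=> [y w] /= [[b1 b2] [mk eqk]] i j Uy Uw.
have gJ u : g (x i) u = nrm (ip (psi (x i)) (psi u)) by rewrite /g /gram nrm_ipC.
have := analysis_le (psi (x i)) Uw; rewrite -gJ.
have mgx : measurable_fun setT (fun u => g (x i) u).
  by under eq_fun do rewrite gJ; exact: measurable_nrm.
have mo1 : measurable_fun setT (o ^~ w) by exact: (measurableT_comp mosc (measurable_pair2 w)).
move=> /le_trans; rewrite -lee_fin; apply.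
rewrite /k2 EFinD -eqk; apply: leeD; first by rewrite lee_fin -gJ; exact: b1.
apply: ae_ge0_le_integral => //.
- by move=> z _; rewrite lee_fin mulr_ge0 ?nrm_ge0.
- by apply/measurable_EFinP/measurable_funM => //; exact: measurable_nrm.
- by move=> z _; rewrite lee_fin mulr_ge0.
- exact/measurable_EFinP.
- apply: (@filterS _ _ (ae_filter_ringOfSetsType mu) _ _ _ b2) => z hz _.
  by rewrite lee_fin ler_wpM2r// -gJ; exact: hz.
Qed.

Lemma sampled_gram_mem :
  flat (T := borel X) U A (gram ip (fun i => psi (x i)) (fun i => psi (x i))).
Proof.
have [N hN] := cover_multiplicity covU.
set L := gram _ _ _.
pose f (y w : borel X) (p : I * I) : R := nrm (L p.1 p.2) * \1_(U p.1) y * \1_(U p.2) w.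
have f0 y w p : 0 <= f y w p by rewrite !mulr_ge0 ?nrm_ge0.
pose S y w := [set i | U i y] `*` [set i | U i w].
have finS y w : finite_set (S y w) by apply: finite_setX; [exact: (hN y).1|exact: (hN w).1].
have fS y w p : ~ S y w p -> f y w p = 0.
  rewrite /S/= => nS; rewrite /f !indicE.
  have [Uy|Uy] := boolP (y \in U p.1); last by rewrite mulr0 mul0r.
  have [Uw|Uw] := boolP (w \in U p.2); last by rewrite mulr0.
  by case: nS; split; exact: set_mem.
pose h y w := \sum_(p \in [set: I * I]) f y w p.
have liftE y w : ((h y w)%:E = \esum_(p in setT) (f y w p)%:E)%E.
  by apply: fsum_esum (finS y w) _ _ => // p; exact: fS.
have h0 y w : 0 <= h y w.
  have : (0 <= (h y w)%:E)%E by rewrite liftE esum_ge0// => p _; rewrite lee_fin.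
  by rewrite lee_fin.
have count2 : countable [set: I * I] by rewrite -setXTT; exact: countableX.
have mh : measurable_fun setT (fun z : borel X * borel X => h z.1 z.2).
  apply/measurable_EFinP.
  apply: (eq_measurable_fun (fun z => \esum_(p in setT) (f z.1 z.2 p)%:E)%E).
    by move=> z _; exact/esym/liftE.
  apply: (measurable_esum count2) => [p z|p]; first by rewrite lee_fin.
  apply/measurable_EFinP; apply: measurable_funM.
    apply: measurable_funM; first exact: measurable_cst.
    exact: (measurableT_comp (@measurable_indic _ (borel X) R setT _ (mU p.1)) measurable_fst).
  exact: (measurableT_comp (@measurable_indic _ (borel X) R setT _ (mU p.2)) measurable_snd).
(* At most [N] cells contain [y] and at most [N] contain [w], so at most [N * N] pairs contribute,
   each by at most [k2 y w]. *)
apply: (adm_solid admA (L := kscale ((N * N)%:R)%:C K2) _ _ _).1.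
- exact: cmeasurable_real.
- by apply: (bsa_scale bA); exact: K2_mem.1.
apply: ae2_sub second_bound => -[y w] /= hyw.
rewrite /lift_kernel -/(f y w) -/(h y w) nrm_real ger0_norm//.
rewrite K2E /kscale nrmM !nrm_real !ger0_norm ?ler0n//.
suff : ((h y w)%:E <= ((N * N)%:R * k2 y w)%:E)%E by rewrite lee_fin.
rewrite liftE.
apply: (@le_trans _ _ (k2 y w *+ #|` fset_set (S y w)|)%:E).
  apply: esum_le_card => p.
    rewrite lee_fin f0/= lee_fin.
    have [Sp|nSp] := pselect (S y w p); last by rewrite fS.
    have [Uy Uw] := Sp.
    rewrite /f !indicE !mem_set// !mulr1; exact: hyw.
  by rewrite in_fset_set// => /negP nSp; rewrite fS// => Sp; apply: nSp; exact: mem_set.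
rewrite lee_fin mulr_natl ler_wpMn2l//.
rewrite fset_setX; [|exact: (hN y).1|exact: (hN w).1].
by apply: leq_trans (card_fsetM_le _ _) _; rewrite leq_mul//; [exact: (hN y).2|exact: (hN w).2].
Qed.

End localization.

(** * The discrete frame operator *)

Section discrete_frame_operator.
Context (R : realType) (I : pointedType).
Local Notation J := (discrete_space I).
Variable nu : {measure set J -> \bar R}.
Hypothesis nu_atom : forall i : J, (0 < nu [set i] < +oo)%E.

Lemma integral_discrete (f : J -> \bar R) : countable [set: I] ->
  (forall i, 0 <= f i)%E ->
  (\int[nu]_i f i = \esum_(i in [set: I]) (f i * nu [set i]))%E.
Proof.
move=> countI f0; have [D [tD UD D1]] := countable_singletons countI.
have fnu0 i : (0 <= f i * nu [set i])%E by rewrite mule_ge0.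
rewrite (esum_enum tD UD)//.
have -> : (\int[nu]_i f i = \int[nu]_(i in \bigcup_n (D n : set J)) f i)%E by rewrite UD.
rewrite ge0_integral_bigcup//; apply: eq_eseriesr => n _.
have [->|[i ->]] := D1 n; first by rewrite integral_set0 esum_set0.
rewrite esum_set1// -integral_cst//.
by apply: eq_integral => j; rewrite inE => ->.
Qed.

Lemma sum_fset_indic (V : pzRingType) (h : I -> V) (B : {fset I}) i :
  \sum_(j <- B) h j * \1_[set j] i = if i \in B then h i else 0.
Proof.
case: ifPn => iB.
  rewrite (bigD1_seq i) ?fset_uniq//=.
  rewrite indicE mem_set// mulr1 big1 ?addr0// => j ji.
  by rewrite indicE memNset ?mulr0// => ij; rewrite ij eqxx in ji.
rewrite big_seq big1// => j jB; rewrite indicE memNset ?mulr0//= => ij.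
by rewrite ij jB in iB.
Qed.

Context (H : completeNormedModType R[i]) (ip : H -> H -> R[i]).
Hypothesis hH : hilbert_space ip.
Variables (psi : J -> H) (C1 C2 : R).
Hypothesis C2_gt0 : 0 < C2.
Hypothesis frame_bounds : forall f, ((C1 * nrm f ^+ 2)%:E <=
  \int[nu]_x ((nrm (ip f (psi x)) ^+ 2)%:E) <= (C2 * nrm f ^+ 2)%:E)%E.
Let mpsi f : cmeasurable (fun x : J => ip f (psi x)) := discrete_cmeasurable _.
Local Notation synth := (synthesis ip nu psi).
Local Notation e_ := (@unit_vector R I).
Let synth_lin := synthesis_lin hH mpsi C2_gt0 frame_bounds.

Lemma synthesis_unit_vector j : synth (e_ j) = (mass nu j)%:C *: psi j.
Proof.
apply: (ip_ext hH) => g.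
rewrite (synthesisP hH mpsi C2_gt0 frame_bounds (L2_unit_vector nu_atom j).1).
rewrite (ipZl hH).
have := kact_unit_vector nu_atom (fun _ i => ip (psi i) g) j j.
by rewrite /kact => ->; rewrite mulrC.
Qed.

Definition fset_part (F : J -> R[i]) (B : {fset I}) : J -> R[i] :=
  fun i => if i \in B then F i else 0.

Lemma synthesis_fset_part F (B : {fset I}) :
  L2 nu (fset_part F B) /\
  synth (fset_part F B) = \sum_(j <- B) (F j * (mass nu j)%:C) *: psi j.
Proof.
have -> : fset_part F B = fun i => \sum_(j <- B) F j * e_ j i.
  apply/funext => i; rewrite /fset_part -sum_fset_indic.
  by apply: eq_bigr => j _; rewrite /unit_vector !indicE; case: (i \in _).
elim: (B : seq I) => [|j s [L IH]].
  have e0 : (fun i : J => \sum_(j <- [::]) F j * e_ j i) = fun=> 0 :> R[i].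
    by apply/funext => i; rewrite big_nil.
  have L0 := L2Z 0 (L2_unit_vector nu_atom point).1.
  rewrite big_nil e0; have E0 : (fun i => 0 * e_ point i) = fun=> 0.
    by apply/funext => i; rewrite mul0r.
  rewrite E0 in L0; split => //.
  have := synth_lin 0 L0 L0; rewrite scale0r add0r.
  have := synth_lin (-1) L0 L0; rewrite scaleN1r addNr.
  by move=> <- _; congr synthesis; apply/funext => i; rewrite mulr0 addr0.
have -> : (fun i => \sum_(k <- j :: s) F k * e_ k i) =
    fun i => F j * e_ j i + \sum_(k <- s) F k * e_ k i.
  by apply/funext => i; rewrite big_cons.
have Lj := (L2_unit_vector nu_atom j).1.
split; first exact: L2_lin.
by rewrite synth_lin// IH synthesis_unit_vector big_cons scalerA.
Qed.

(** Pythagoras for the restrictions of [F] to [B] and to its complement, whose supports are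
    disjoint. *)
Lemma L2norm_fset_part F (B : {fset I}) : L2 nu F ->
  L2norm nu (fun i => F i - fset_part F B i) ^+ 2 =
  L2norm nu F ^+ 2 - \sum_(j <- B) nrm (F j) ^+ 2 * mass nu j.
Proof.
move=> LF; have LB := (synthesis_fset_part F B).1.
apply/eqP; rewrite eq_sym subr_eq; apply/eqP/EFin_inj.
rewrite EFinD -!L2normE//; last exact: L2B.
rewrite -sumEFin.
under [in RHS]eq_bigr do
  rewrite EFinM -(discrete_integral_indic nu_atom (fun i => (nrm (F i) ^+ 2)%:E)).
rewrite -ge0_integral_sum//; last first.
  by move=> j i _; rewrite mule_ge0// lee_fin// sqr_ge0.
rewrite -ge0_integralD//; last 2 first.
- by move=> i _; rewrite lee_fin sqr_ge0.
- by move=> i _; apply: sume_ge0 => j _; rewrite mule_ge0// lee_fin// sqr_ge0.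
apply: eq_integral => i _.
rewrite (eq_bigr (fun j => (nrm (F i) ^+ 2 * \1_[set j] i)%:E)) => [|j _]//.
rewrite sumEFin -EFinD (sum_fset_indic (fun=> nrm (F i) ^+ 2)) /fset_part.
by case: ifPn => _; rewrite ?subrr ?subr0 ?nrm0 ?expr0n/= ?add0r ?addr0.
Qed.

(* The error of a partial sum is the synthesis of the remaining coefficients. *)
Lemma discrete_frame_opE : countable [set: I] ->
  discrete_frame_op ip (fun i => nu [set i]) psi = frame_op ip nu psi.
Proof.
move=> countI; apply/funext => f.
have LV := L2_analysis mpsi frame_bounds f.
have tot := @summability.totally_filter I.
rewrite /discrete_frame_op; set u := summability.partial_sum _.
(* [get] selects some limit of the partial sums; uniqueness of limits in [H] identifies it with the
   weakly defined frame operator. *)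
suff Pf : u @ summability.totally --> frame_op ip nu psi f.
  set P := [set h | _]; have Pf' : P (frame_op ip nu psi f) by exact: Pf.
  have h := @xgetPex _ point P (ex_intro (fun h => P h) _ Pf').
  exact: (cvg_unique (@norm_hausdorff _ _) h Pf).
apply/cvgrPdist_lt => e e0.
have e_re : e = (complex.Re e)%:C by rewrite RRe_real// gtr0_real.
move: e0; rewrite e_re ltcR; move: (complex.Re e) => {e_re}e e0.
pose F := analysis ip psi f; pose n2 := L2norm nu F ^+ 2.
have c0 : 0 < Num.sqrt C2 by rewrite sqrtr_gt0.
(* Synthesis has norm at most [sqrt C2], so a tail of [L2] norm less than [s] contributes less than
   [e]. *)
pose s := e / Num.sqrt C2; have s0 : 0 < s by rewrite divr_gt0.
have [B0 hB0] : exists B0 : {fset I}, n2 - s ^+ 2 <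
    \sum_(j <- B0) nrm (F j) ^+ 2 * mass nu j.
  apply: contrapT => /forallNP hB.
  suff : (n2%:E <= (n2 - s ^+ 2)%:E)%E.
    by rewrite lee_fin lerBrDl gerDr leNgt exprn_gt0.
  rewrite -L2normE// integral_discrete// => [|i]; last by rewrite lee_fin sqr_ge0.
  apply: esum_finite_le => [i|B]; first by rewrite mule_ge0// lee_fin sqr_ge0.
  rewrite (eq_bigr (fun j => (nrm (F j) ^+ 2 * mass nu j)%:E)); last first.
    by move=> j _; rewrite (massE nu_atom) EFinM.
  by rewrite sumEFin lee_fin leNgt; apply/negP/hB.
exists B0 => // B /= B0B; rewrite nrmE ltcR.
have uE : u B = synth (fset_part F B).
  rewrite (synthesis_fset_part F B).2 /u /summability.partial_sum.
  by rewrite -(big_seq_fsetE _ _ xpredT (fun i => (F i * (mass nu i)%:C) *: psi i)).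
have LB := (synthesis_fset_part F B).1.
have -> : frame_op ip nu psi f - u B = synth (fun i => F i - fset_part F B i).
  have := synth_lin (-1) LB LV; rewrite uE frame_op_synthesis scaleN1r addrC => <-.
  by congr synthesis; apply/funext => i; rewrite mulN1r addrC.
have LD := L2B LV LB.
apply: le_lt_trans (nrm_synthesis_le hH mpsi C2_gt0 frame_bounds LD) _.
rewrite mulrC -ltr_pdivlMr// -/s -ltr_sqr ?nnegrE ?L2norm_ge0 ?(ltW s0)//.
rewrite L2norm_fset_part// -/n2 ltrBlDl -ltrBlDr; apply: lt_le_trans hB0 _.
rewrite [leRHS](big_fsetID _ (mem B0))/= (_ : [fset j in B | j \in B0]%fset = B0).
  by rewrite lerDl sumr_ge0// => i _; rewrite mulr_ge0 ?sqr_ge0// ltW// mass_gt0.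
by apply/fsetP => i; rewrite !inE/= andb_idl// => /(fsubsetP B0B).
Qed.

End discrete_frame_operator.

(** * Smallness of the oscillation *)

Section schur_norm.
Context (R : realType) d (T : measurableType d) (mu : {measure set T -> \bar R}).

(** On a space of measure zero an essential supremum is [-oo], hence the positivity of the total
    mass. *)
Lemma normA1_ge0 K : (0 < mu [set: T])%E -> (0 <= normA1 mu K)%E.
Proof.
move=> mu0; rewrite /normA1 le_max; apply/orP; left.
rewrite -(ess_sup_cst 0%E mu0); apply: le_ess_sup.
by apply: aeW => x; apply: integral_ge0 => y _; rewrite lee_fin nrm_ge0.
Qed.

Lemma normA1_ae K (k : R) : (normA1 mu K <= k%:E)%E ->
  {ae mu, forall x, (\int[mu]_y (nrm (K x y))%:E <= k%:E)%E} /\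
  {ae mu, forall y, (\int[mu]_x (nrm (K x y))%:E <= k%:E)%E}.
Proof. by rewrite /normA1 ge_max => /andP[/ess_supP h1 /ess_supP h2]. Qed.

End schur_norm.

Lemma le_fine (R : realDomainType) (e : \bar R) : (e < +oo -> e <= (fine e)%:E)%E.
Proof. by case: e => //= _; exact: leNye. Qed.

Section weighted_oscillation.
Context (R : realType) (X : ptopologicalType) (mu : {measure set (borel X) -> \bar R}).
Variables (m : X -> X -> R) (o : borel X -> borel X -> R).
Hypothesis adm_m : admissible_weight m.
Hypothesis o_ge0 : forall z w, 0 <= o z w.
Hypothesis mo : measurable_fun setT (fun z : borel X * borel X => o z.1 z.2).

Let mm z : measurable_fun setT (m z : borel X -> R).
Proof.
apply: continuous_borel_measurable => w.
apply: (@continuous_comp _ _ _ (fun w => (z, w)) (fun p => m p.1 p.2)).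
  by apply: cvg_pair => //; exact: cvg_cst.
exact: (weight_continuous adm_m).
Qed.

(** The weight is at least [1], so the integrals of [o] are bounded by the weighted ones. *)
Lemma weighted_schur_ae (k : R) :
  (normA1 mu (kweight (fun z w => (o z w)%:C) m) <= k%:E)%E ->
  {ae mu, forall z, (\int[mu]_w (o z w)%:E <= k%:E)%E} /\
  {ae mu, forall w, (\int[mu]_z (o z w)%:E <= k%:E)%E}.
Proof.
have le_o z w : o z w <= nrm (kweight (fun z w => (o z w)%:C) m z w).
  have m1 := weight_ge1 adm_m z w.
  rewrite nrmM !nrm_real !ger0_norm//; last exact: le_trans m1.
  by rewrite ler_peMr.
have E z w : nrm (kweight (fun z w => (o z w)%:C) m z w) = o z w * m z w.
  have m1 := weight_ge1 adm_m z w.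
  by rewrite nrmM !nrm_real !ger0_norm//; exact: le_trans m1.
move=> /normA1_ae[h1 h2]; split.
  apply: (@filterS _ _ (ae_filter_ringOfSetsType mu) _ _ _ h1) => z; apply: le_trans.
  have mo1 : measurable_fun setT (o z) by exact: (measurableT_comp mo (measurable_pair1 z)).
  apply: ge0_le_integral => //.
  - by move=> w _; rewrite lee_fin.
  - exact/measurable_EFinP.
  - by apply/measurable_EFinP; under eq_fun do rewrite E; exact: measurable_funM.
  - by move=> w _; rewrite lee_fin.
apply: (@filterS _ _ (ae_filter_ringOfSetsType mu) _ _ _ h2) => w; apply: le_trans.
have mo2 : measurable_fun setT (o ^~ w) by exact: (measurableT_comp mo (measurable_pair2 w)).
apply: ge0_le_integral => //.
- by move=> z _; rewrite lee_fin.
- exact/measurable_EFinP.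
- apply/measurable_EFinP; under eq_fun do rewrite E (weight_sym adm_m).
  exact: measurable_funM.
- by move=> z _; rewrite lee_fin.
Qed.

End weighted_oscillation.

(** The second entry of the maximum gives [delta (2 n + delta) <= 1], hence [delta^2 <= 1]. *)
Lemma small_delta (R : realType) (delta n C : R) : 0 < delta -> 0 <= n ->
  delta * (n + Num.max (C * n) (n + delta)) <= 1 -> delta <= 1.
Proof.
move=> d0 n0 h; have : delta * (n + (n + delta)) <= 1.
  by apply: le_trans h; rewrite ler_pM2l// lerD2l le_max lexx orbT.
nra.
Qed.

(** * Choice of the Schur constant and passage to the measure space of indices *)

Theorem corollary6p4 (R : realType)
    (X : ptopologicalType) (mu : {measure set (borel X) -> \bar R})
    (H : completeNormedModType R[i]) (ip : H -> H -> R[i])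
    (m : X -> X -> R) (A : kernel_space R (borel X)) (psi : X -> H)
    (I : pointedType) (U : I -> set X) (x : I -> X) (delta C : R)
    (hausdorffX : hausdorff_space X)
    (lcX : locally_compact [set: X])
    (scX : sigma_compact X)
    (radon_mu : radon_measure mu)
    (supp_mu : full_support mu)
    (hilbertH : hilbert_space ip)
    (separableH : separable H)
    (adm_m : admissible_weight m)
    (adm_A : admissible_algebra mu A)
    (bimodA : bimodule mu (Am mu m) A)
    (frame_psi : continuous_frame (T := borel X) ip mu psi)
    (cont_psi : weakly_continuous ip psi)
    (bound_psi : norm_bounded psi)
    (loc_psi : intrinsically_localized ip A psi)
    (R_Am : Am mu m (frame_kernel ip mu psi))
    (delta_gt0 : 0 < delta)
    (D_psi : property_D mu U ip psi m delta C)
    (delta_small :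
       let normR := knorm (Am mu m) (frame_kernel ip mu psi) in
       delta * (normR + Num.max (C * normR) (normR + delta)) <= 1)
    (x_in_U : forall i, U i (x i)) :
  let psi_d := fun i => psi (x i) in
  let a := fun i => mu (U i) in
  let A_flat := flat (T := borel X) U A in
  [/\ discrete_frame ip a psi_d,
      intrinsically_localized ip A_flat psi_d &
      spectral_algebra (cover_measure (T := borel X) mu U) A_flat ->
        intrinsically_localized ip A_flat (canonical_dual ip a psi_d)].
Proof.
move=> psi_d a A_flat.
have [C1 [C2 [C1_gt0 C2_gt0 frame_bounds]]] := frame_psi.
have [covU modU _ osc_mem osc_small] := D_psi.
have mpsi f : cmeasurable (fun y : borel X => ip f (psi y)).
  by apply: continuous_cmeasurable; exact: cont_psi.
have mu_gt0 : (0 < mu [set: borel X])%E by apply: supp_mu; [exact: openT|exists point].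
have normR_ge0 : 0 <= knorm (Am mu m) (frame_kernel ip mu psi).
  by apply: fine_ge0; exact: normA1_ge0.
have delta_le1 := small_delta delta_gt0 normR_ge0 delta_small.
pose no := knorm (Am mu m) (osc U (frame_kernel ip mu psi)).
(* [no < delta <= 1]. The maximum keeps [k] positive even if [no = 0], since the frame bounds
   involve division by [k]. *)
pose k := Num.max no 2^-1.
have k_gt0 : 0 < k by rewrite lt_max invr_gt0 ltr0n orbT.
have k_lt1 : k < 1.
  by rewrite gt_max (lt_le_trans osc_small)//= invf_lt1 ?ltr0n// ltr1n.
have [[mosc _] osc_oo] := osc_mem.
have o0 := oscR_ge0 covU hilbertH mpsi C1_gt0 C2_gt0 frame_bounds bound_psi.
have osc_k : (normA1 mu (kweight (T := borel X) (osc U (frame_kernel ip mu psi)) m) <= k%:E)%E.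
  by apply: le_trans (le_fine osc_oo) _; rewrite lee_fin le_max lexx.
have [osc_row osc_col] := weighted_schur_ae adm_m o0 mosc osc_k.
have [D1 [D2 [D1_gt0 D2_gt0 bounds]]] := sampled_frame_bounds hausdorffX scX radon_mu covU modU
  hilbertH mpsi C1_gt0 C2_gt0 frame_bounds bound_psi mosc x_in_U k_gt0 k_lt1 osc_row osc_col.
have G_mem := sampled_gram_mem hausdorffX scX radon_mu covU modU hilbertH mpsi C1_gt0 C2_gt0
  frame_bounds bound_psi (weight_sym adm_m) adm_A bimodA osc_mem loc_psi x_in_U.
split => //; first by exists D1, D2.
move=> specA.
pose nu := cover_measure (T := borel X) mu U.
have nuE i : nu [set i] = mu (U i) by rewrite [LHS]esum_set1.
have nu_atom (i : discrete_space I) : (0 < nu [set i] < +oo)%E.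
  by rewrite nuE; exact: (cover_mass radon_mu covU modU).
have countI := cover_countable hausdorffX scX radon_mu covU modU.
have frame_nu f : ((D1 * nrm f ^+ 2)%:E <=
    \int[nu]_i ((nrm (ip f (psi_d i)) ^+ 2)%:E) <= (D2 * nrm f ^+ 2)%:E)%E.
  rewrite integral_discrete// => [|i]; last by rewrite lee_fin sqr_ge0.
  rewrite (_ : (\esum_(i in _) _ = \esum_(i in setT) ((nrm (ip f (psi_d i)) ^+ 2)%:E * a i))%E).
    exact: bounds.
  by apply: eq_esum => i _; congr (_ * _)%E; exact: nuE.
have aE : a = fun i => nu [set i] by apply/funext => i; exact/esym/nuE.
(* The canonical dual is defined by the norm-convergent series, whereas the resolvent argument uses
   the weak frame operator over [nu]; the two operators coincide. *)
have opE : discrete_frame_op ip a psi_d = frame_op ip nu psi_d.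
  by rewrite aE; exact: (discrete_frame_opE nu_atom hilbertH D2_gt0 frame_nu countI).
rewrite /canonical_dual opE.
exact: (gram_dual_mem nu_atom hilbertH D1_gt0 D2_gt0 frame_nu specA G_mem).
Qed.
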